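(* Let $L=(L_t)_{t\in\mathbb{R}}$ be a two-sided Lévy process without a Gaussian component such that $\mathbb{E}(L_1)=0$ and $\mathbb{E}(L_1^2)<\infty$. Let $f:\mathbb{R}^2\to\mathbb{R}$ be a measurable function such that $\mathbb{R}\ni u\mapsto f(t,u)$ belongs to $L^2(\mathbb{R})$ for all $t\in\mathbb{R}$, and let $S_t:=\int_{\mathbb{R}}f(t,u)\,L(\mathrm{d}u)$, $t\in\mathbb{R}$, be the generalized fractional Lévy process corresponding to the kernel function $f$. Let $\alpha,\delta\in\mathbb{R}$. If $$f(t,u)=T^{\alpha-\frac{\delta}{2}}f\left(\frac{t}{T},\frac{u}{T^{\delta}}\right),\qquad t,u\in\mathbb{R},\quad T>0,$$ then $(S_t)_{t\in\mathbb{R}}$ is $(\alpha,\delta)$-dilatively stable. If, in addition, $\mathbb{E}(L_1^2)>0$ and $\int_{\mathbb{R}}f(1,u)^2\,\mathrm{d}u>0$, then the parameters of dilative stability $\alpha$ and $\delta$ are uniquely determined (that is, if $(S_t)_{t\in\mathbb{R}}$ is also $(\alpha',\delta')$-dilatively stable for some $\alpha',\delta'\in\mathbb{R}$, then $\alpha'=\alpha$ and $\delta'=\delta$).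
   Context: All processes are defined on a probability space $(\Omega,\mathcal{F},\mathbb{P})$; $\mathbb{N}$ denotes the set of positive integers. A two-sided Lévy process is a process of the form $L_t:=L^{(1)}_t\mathbf{1}_{[0,\infty)}(t)-L^{(2)}_{(-t)-}\mathbf{1}_{(-\infty,0)}(t)$, $t\in\mathbb{R}$, where $L^{(1)}$ and $L^{(2)}$ are independent copies of a (real-valued) Lévy process on $[0,\infty)$ and $L^{(2)}_{s-}$ denotes the left limit at $s$. Under the assumptions that $L$ has no Gaussian component, $\mathbb{E}(L_1)=0$ and $\mathbb{E}(L_1^2)<\infty$, one has $\mathbb{E}(e^{i\theta L_t})=e^{-|t|\varphi(\theta)}$, $t,\theta\in\mathbb{R}$, with $\varphi(\theta)=\int_{\mathbb{R}}(1-e^{i\theta x}+i\theta x)\,\mu(\mathrm{d}x)$, where $\mu$ is the Lévy measure of $L$. For a measurable $f:\mathbb{R}^2\to\mathbb{R}$ with $f(t,\cdot)\in L^2(\mathbb{R})$ for all $t$, the integral $S_t=\int_{\mathbb{R}}f(t,u)\,L(\mathrm{d}u)$ exists in the $L^2(\Omega,\mathcal{F},\mathbb{P})$-sense for every $t\in\mathbb{R}$ (the extension from step functions by the isometry $\mathbb{E}(S_t^2)=\mathbb{E}(L_1^2)\int_{\mathbb{R}}f(t,u)^2\,\mathrm{d}u$). It is known that $\mathbb{E}(S_t)=0$ and that for $t_1<\cdots<t_k$ and $\theta_1,\ldots,\theta_k\in\mathbb{R}$, $$\mathbb{E}\left(\exp\left\{i\sum_{j=1}^k\theta_jS_{t_j}\right\}\right)=\exp\left\{-\int_{\mathbb{R}}\varphi\left(\sum_{j=1}^k\theta_jf(t_j,u)\right)\mathrm{d}u\right\}.$$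 The process $(S_t)_{t\in\mathbb{R}}$ is called the generalized fractional Lévy process corresponding to the kernel function $f$. A process $(X_t)_{t\in\mathbb{R}}$ is infinitely divisible if all its finite-dimensional distributions are infinitely divisible. For such a process, the characteristic exponent of $(X_{t_1},\ldots,X_{t_k})$ is the unique continuous function $\psi_{t_1,\ldots,t_k}:\mathbb{R}^k\to\mathbb{C}$ with $\psi_{t_1,\ldots,t_k}(0,\ldots,0)=0$ and $\mathbb{E}\left(e^{i\sum_{j=1}^k\theta_jX_{t_j}}\right)=e^{-\psi_{t_1,\ldots,t_k}(\theta_1,\ldots,\theta_k)}$ for all $\theta_1,\ldots,\theta_k\in\mathbb{R}$. For $\alpha,\delta\in\mathbb{R}$, the process $(X_t)_{t\in\mathbb{R}}$ is called $(\alpha,\delta)$-dilatively stable if it is infinitely divisible and $$\psi_{Tt_1,\ldots,Tt_k}(\theta_1,\ldots,\theta_k)=T^{\delta}\,\psi_{t_1,\ldots,t_k}\left(T^{\alpha-\frac{\delta}{2}}\theta_1,\ldots,T^{\alpha-\frac{\delta}{2}}\theta_k\right)$$ for all $T>0$, $k\in\mathbb{N}$, $\theta_1,\ldots,\theta_k\in\mathbb{R}$, $t_1,\ldots,t_k\in\mathbb{R}$. *)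

(* Defs.v *)
From HB Require Import structures.
From mathcomp Require Import all_boot all_order all_algebra.
From mathcomp Require Import complex.
From mathcomp Require Import all_classical all_reals all_analysis.
Import Order.TTheory GRing.Theory Num.Theory.
Import numFieldNormedType.Exports.

Local Open Scope classical_set_scope.
Local Open Scope complex_scope.
Local Open Scope ring_scope.

Definition expi {R : realType} (x : R) : R[i] := cos x +i* sin x.

Definition cexp {R : realType} (z : R[i]) : R[i] :=
  (expR (complex.Re z))%:C * expi (complex.Im z).

Definition cintegral {d} {T : measurableType d} {R : realType}
    (mu : {measure set T -> \bar R}) (F : T -> R[i]) : R[i] :=
  (\int[mu]_x complex.Re (F x)) +i* (\int[mu]_x complex.Im (F x)).

(* Equality of distributions; the two variables may live on different spaces. *)
Definition same_law {d1 d2 d} {T1 : measurableType d1} {T2 : measurableType d2}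
    {T : measurableType d} {R : realType}
    (P1 : probability T1 R) (X1 : T1 -> T)
    (P2 : probability T2 R) (X2 : T2 -> T) : Prop :=
  forall B, measurable B -> pushforward P1 X1 B = pushforward P2 X2 B.

Definition mutually_independent {d} {T : measurableType d} {R : realType}
    (P : probability T R) {I : finType} (F : I -> set_system T) : Prop :=
  forall (J : {set I}) (E : I -> set T),
    (forall i, i \in J -> F i (E i)) ->
    P (\bigcap_(i in [set` J]) E i) = (\prod_(i in J) P (E i))%E.

Definition mutually_independent_rv {d d'} {T : measurableType d}
    {T' : measurableType d'} {R : realType} (P : probability T R)
    {I : finType} (X : I -> T -> T') : Prop :=
  mutually_independent P
    (fun i => preimage_set_system [set: T] (X i) measurable).

(* A process indexed by [0, oo[ is a family indexed by R whose values at
   negative times are irrelevant. *)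
Definition sigma_process {d} {T : measurableType d} {R : realType}
    (X : R -> T -> R) : set_system T :=
  <<s [set A | exists2 t, 0 <= t &
                 preimage_set_system [set: T] (X t) measurable A] >>.

Definition cadlag {R : realType} (x : R -> R) : Prop :=
  (forall s, 0 <= s -> x u @[u --> s^'+] --> x s) /\
  (forall s, 0 < s -> cvg (x u @[u --> s^'-])).

Definition left_limit {R : realType} (x : R -> R) (s : R) : R :=
  lim (x u @[u --> s^'-]).

Definition levy_process {d} {T : measurableType d} {R : realType}
    (P : probability T R) (X : R -> {RV P >-> R}) : Prop :=
  [/\ {ae P, forall w, X 0 w = 0},
      forall (n : nat) (t : nat -> R), 0 <= t 0%N ->
        {homo t : i j / (i <= j)%N >-> i <= j} ->
        mutually_independent_rv P
          (fun (i : 'I_n) w => X (t i.+1) w - X (t i) w),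
      forall s h, 0 <= s -> 0 <= h ->
        same_law P (fun w => X (s + h) w - X s w) P (X h)
    & {ae P, forall w, cadlag (fun t => X t w)}].

Definition time_vector {d} {T : measurableType d} {R : realType}
    (X : R -> T -> R) {k : nat} (t : 'rV[R]_k) (w : T) : k.-tuple R :=
  [tuple X (t 0 j) w | j < k].

Definition independent_copies {d} {T : measurableType d} {R : realType}
    (P : probability T R) (X1 X2 : R -> {RV P >-> R}) : Prop :=
  (forall k (t : 'rV[R]_k), (forall j, 0 <= t 0 j) ->
     same_law P (time_vector X1 t) P (time_vector X2 t)) /\
  (forall A B, sigma_process X1 A -> sigma_process X2 B ->
     P (A `&` B) = (P A * P B)%E).

Definition two_sided_levy_process {d} {T : measurableType d} {R : realType}
    (P : probability T R) (L : R -> {RV P >-> R}) : Prop :=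
  exists L1 L2 : R -> {RV P >-> R},
    [/\ levy_process P L1, levy_process P L2, independent_copies P L1 L2
      & forall t w, L t w =
          if 0 <= t then L1 t w else - left_limit (fun s => L2 s w) (- t)].

(* Generating triplet (b, sigma2, mu) in the Levy-Khintchine formula, with
   truncation function x 1_{|x| <= 1}. *)
Definition levy_khintchine_exponent {R : realType} (b sigma2 : R)
    (mu : {measure set R -> \bar R}) (theta : R) : R[i] :=
  - 'i * (b * theta)%:C + (sigma2 * theta ^+ 2 / 2)%:C
  + cintegral mu (fun x =>
      1 - expi (theta * x) + 'i * (if `|x| <= 1 then theta * x else 0)%:C).

Definition levy_measure {R : realType} (mu : {measure set R -> \bar R}) : Prop :=
  mu [set 0] = 0%E /\ (\int[mu]_x (Num.min 1 (x ^+ 2))%:E < +oo)%E.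

Definition levy_triplet {d} {T : measurableType d} {R : realType}
    (P : probability T R) (X : T -> R)
    (b sigma2 : R) (mu : {measure set R -> \bar R}) : Prop :=
  [/\ 0 <= sigma2, levy_measure mu
    & forall theta, cintegral P (fun w => expi (theta * X w)) =
        cexp (- levy_khintchine_exponent b sigma2 mu theta)].

Definition no_gaussian_component {d} {T : measurableType d} {R : realType}
    (P : probability T R) (L : R -> {RV P >-> R}) : Prop :=
  exists (b : R) (mu : {measure set R -> \bar R}), levy_triplet P (L 1) b 0 mu.

(* The list of triples (a, (x, y)) with x <= y encodes the step function
   \sum a 1_{]x, y]}, whose integral with respect to L is
   \sum a (L_y - L_x). *)
Definition step_fun {R : realType} (s : seq (R * (R * R))) (u : R) : R :=
  \sum_(p <- s) (if p.2.1 < u <= p.2.2 then p.1 else 0).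

Definition step_integral {T : Type} {R : realType} (L : R -> T -> R)
    (s : seq (R * (R * R))) (w : T) : R :=
  \sum_(p <- s) p.1 * (L p.2.2 w - L p.2.1 w).

(* Y is (a version of) the L^2(P)-integral of g with respect to L. *)
Definition is_levy_integral {d} {T : measurableType d} {R : realType}
    (P : probability T R) (L : R -> {RV P >-> R})
    (g : R -> R) (Y : {RV P >-> R}) : Prop :=
  (Y : T -> R) \in Lfun P 2%:E /\
  exists s : nat -> seq (R * (R * R)),
    [/\ forall m, all (fun p => p.2.1 <= p.2.2) (s m),
        (\int[lebesgue_measure]_u ((step_fun (s m) u - g u) ^+ 2)%:E)%E
          @[m --> \oo] --> 0%E
      & ('E_P[(fun w => (step_integral L (s m) w - Y w) ^+ 2)%R])%E
          @[m --> \oo] --> 0%E].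

Definition infinitely_divisible_vector {d} {T : measurableType d}
    {R : realType} (P : probability T R) {k : nat} (V : T -> k.-tuple R) : Prop :=
  forall n : nat, (0 < n)%N ->
  exists (d' : measure_display) (T' : measurableType d')
         (P' : probability T' R) (Y : 'I_n -> {RV P' >-> k.-tuple R}),
    [/\ mutually_independent_rv P' Y,
        forall i j, same_law P' (Y i) P' (Y j)
      & same_law P V
          P' (fun w => [tuple \sum_(i < n) tnth (Y i w) j | j < k])].

Definition infinitely_divisible {d} {T : measurableType d} {R : realType}
    (P : probability T R) (X : R -> {RV P >-> R}) : Prop :=
  forall (k : nat) (t : 'rV[R]_k), (0 < k)%N ->
    infinitely_divisible_vector P (time_vector X t).

(* R[i]^o is R[i] with its topology as a normed field. These conditions
   determine psi. *)
Definition characteristic_exponent {d} {T : measurableType d} {R : realType}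
    (P : probability T R) (X : R -> {RV P >-> R})
    {k : nat} (t : 'rV[R]_k) (psi : 'rV[R]_k -> R[i]) : Prop :=
  [/\ continuous (psi : 'rV[R]_k -> R[i]^o), psi 0 = 0
    & forall theta : 'rV[R]_k,
        cintegral P (fun w => expi (\sum_(j < k) theta 0 j * X (t 0 j) w)) =
        cexp (- psi theta)].

(* psi k t is the characteristic exponent of (X_{t_1}, ..., X_{t_k}). *)
Definition dilatively_stable {d} {T : measurableType d} {R : realType}
    (P : probability T R) (X : R -> {RV P >-> R}) (alpha delta : R) : Prop :=
  infinitely_divisible P X /\
  exists psi : forall k : nat, 'rV[R]_k -> 'rV[R]_k -> R[i],
    (forall k (t : 'rV[R]_k), (0 < k)%N -> characteristic_exponent P X t (psi k t)) /\
    (forall (a : R) (k : nat) (theta t : 'rV[R]_k), 0 < a -> (0 < k)%N ->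
       psi k (a *: t) theta =
       (a `^ delta)%:C * psi k t (a `^ (alpha - delta / 2) *: theta)).

(* Main.v *)
Require Import Defs.
From HB Require Import structures.
From mathcomp Require Import all_boot all_order all_algebra.
From mathcomp Require Import complex ring lra.
From mathcomp Require Import all_classical all_reals all_analysis.
From mathcomp Require Import measurable_realfun.
Import Order.TTheory GRing.Theory Num.Theory.
Import numFieldNormedType.Exports.

(** Dilative stability is a statement about characteristic exponents, so that
    everything rests on one formula,

      E exp (i sum_j theta_j S_(t_j))
        = exp (- int phi (sum_j theta_j f (t_j, u)) du),

    where phi is the exponent of L_1 (chf_kernel_process). The scaling of f
    says that f (a t, u) = a^(alpha - delta/2) f (t, u / a^delta), and the
    substitution u -> a^delta u in the integral then produces the factor
    a^delta and the rescaled arguments (fdd_exponent_scaling).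

    The formula is proved for step functions first. As L_1 is centered and
    square integrable, Fatou's lemma at the origin shows that the Levy measure
    mu integrates x^2, and the drift disappears, so that
    phi theta = int (1 - exp (i theta x) + i theta x) mu (dx) (chf_exponent).
    Hence the real and imaginary parts of phi satisfy
    |k a - k b| <= V |a - b| (|a| + |b|), which is the property quad_lip that
    carries most later estimates. Over a time step 2^-n the exponent is
    2^-n phi, by continuity of the square root (chf_dyadic); independence of
    the increments gives step functions on a dyadic grid
    (chf_two_sided_grid), and right continuity of the paths gives all step
    functions (chf_step_integral). By quad_lip, the integral of phi o g is a
    continuous function of g in L2, and the formula passes to stochastic
    integrals.

    Infinite divisibility asks for a random vector with exponent 1/n times
    that of (S_(t_1), ..., S_(t_k)). The substitution u -> u / n shows that
    the integrals of the compressed kernels u -> f (t_j, n u) have it; they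
    are constructed as almost sure limits of integrals of compressed step
    functions (exists_compressed_integral). A product space carries n
    independent copies of this vector (exists_iid_copies), and their sum has
    the law of (S_(t_1), ..., S_(t_k)) because characteristic functions
    determine laws (same_law_of_chf).

    For the uniqueness of the parameters, let r x be the real part of the
    exponent of x S_1. With W the variance of S_1, r x / x^2 tends to W / 2 at
    the origin, while r 1 < W / 2: this strict inequality expresses that there
    is no Gaussian part. If both pairs of parameters are admissible, then
    a^delta r (a^(alpha - delta/2) x) = a^delta' r (a^(alpha' - delta'/2) x)
    for all a > 0. The limit x -> 0 yields alpha = alpha'. If delta and delta'
    were distinct, the powers of a would sweep the half-line and r would be
    exactly quadratic, against r 1 < W / 2 (parameters_unique). *)

Set Implicit Arguments.
Unset Strict Implicit.
Unset Printing Implicit Defensive.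

Local Open Scope classical_set_scope.
Local Open Scope ring_scope.

(** * Bounds on sine and cosine *)

Section trig.
Context {R : realType}.
Implicit Types x y : R.

(** The intermediate point is only controlled by |x| + |y|; this is where the
    modulus |x - y| (|x| + |y|) of the exponents comes from. *)
Lemma mean_value_any_order (f df : R -> R) x y :
  (forall z : R, is_derive z 1 f (df z)) ->
  exists2 c, `|c| <= `|x| + `|y| & f x - f y = df c * (x - y).
Proof.
move=> fdf.
wlog lexy : x y / y <= x => [hw|].
  have [/hw//|/ltW /hw [c cle e]] := leP y x.
  by exists c; [rewrite addrC | rewrite -opprB e -mulrN opprB].
have cf : {within `[y, x], continuous f}.
  apply: derivable_within_continuous => z _; exact: (@ex_derive _ _ _ _ _ _ _ (fdf z)).
have [c cyx e] := MVT_segment lexy (fun z _ => fdf z) cf.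
exists c => //; move: cyx; rewrite in_itv/= => /andP[yc cx].
have h1 := ler_norm x; have h2 := ler_norm (- y); have h3 := normr_ge0 x; have h4 := normr_ge0 y.
rewrite normrN in h2; rewrite ler_norml; apply/andP; split; lra.
Qed.

Lemma ler_norm_sin x : `|sin x| <= `|x|.
Proof.
have [c _ ] := @mean_value_any_order sin cos x 0 (fun z => is_derive_sin z).
rewrite sin0 !subr0 => ->; rewrite normrM ler_piMl//; exact: cos_max.
Qed.

Lemma one_sub_cosE x : 1 - cos x = 2 * sin (x / 2) ^+ 2.
Proof.
have -> : cos x = cos ((x / 2) *+ 2) by rewrite -mulr_natr divfK.
rewrite cos_mulr2n cos2sin2; lra.
Qed.

Lemma one_sub_cos_ge0 x : 0 <= 1 - cos x.
Proof. by rewrite subr_ge0 cos_le1. Qed.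

Lemma one_sub_cos_le2 x : 1 - cos x <= 2.
Proof. have := cos_geN1 x; lra. Qed.

Lemma one_sub_cos_le_sqr x : 1 - cos x <= x ^+ 2 / 2.
Proof.
rewrite one_sub_cosE; have := ler_norm_sin (x / 2).
rewrite -ler_sqr ?nnegrE ?normr_ge0// !real_normK ?num_real// => h.
have -> : x ^+ 2 / 2 = 2 * (x / 2) ^+ 2 by field.
by rewrite ler_pM2l.
Qed.

Lemma one_sub_cos_le_norm x : 1 - cos x <= `|x|.
Proof.
rewrite one_sub_cosE; have := ler_norm_sin (x / 2); have := sin_max (x / 2).
rewrite normrM (@ger0_norm _ 2^-1) ?invr_ge0// => h1 h2.
rewrite -real_normK ?num_real//; have := normr_ge0 (sin (x/2)); nra.
Qed.

(** The strict form is what separates the exponent of a law without Gaussian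
    part from a multiple of theta^2; the uniqueness of the parameters rests on
    it. *)
Lemma one_sub_cos_lt_sqr x : x != 0 -> 1 - cos x < x ^+ 2 / 2.
Proof.
move=> x0; rewrite one_sub_cosE.
have -> : x ^+ 2 / 2 = 2 * (x / 2) ^+ 2 by field.
rewrite ltr_pM2l//.
have : x / 2 != 0 by rewrite mulf_neq0.
move: (x / 2) => {x0}y y0.
have -> : sin y = sin ((y / 2) *+ 2) by rewrite -mulr_natr divfK.
have -> : y ^+ 2 = ((y / 2) *+ 2) ^+ 2 by rewrite -mulr_natr divfK.
have := ler_norm_sin (y / 2).
rewrite -ler_sqr ?nnegrE ?normr_ge0// !real_normK ?num_real// => h.
have z0 : 0 < (y / 2) ^+ 2 by rewrite exprn_even_gt0//= mulf_neq0.
rewrite sin_mulr2n.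
have -> : (cos (y / 2) * sin (y / 2) *+ 2) ^+ 2 =
  4 * (sin (y / 2) ^+ 2 * (1 - sin (y / 2) ^+ 2)) by rewrite -cos2sin2; ring.
have -> : (y / 2 *+ 2) ^+ 2 = 4 * (y / 2) ^+ 2 by ring.
rewrite ltr_pM2l//; move: h z0 (sqr_ge0 (sin (y / 2))).
move: (sin _ ^+ 2) ((y / 2) ^+ 2) => s z h z0 s0.
have [->|s1] := eqVneq s 0; first by rewrite mul0r.
have : 0 < s by rewrite lt_neqAle eq_sym s1.
nra.
Qed.

(** The derivative is at most |c| in absolute value at a point c, so that the
    increment is of second order near the origin, where a Levy measure is only
    required to integrate x^2. *)
Lemma one_sub_cos_lip x y :
  `|(1 - cos x) - (1 - cos y)| <= `|x - y| * (`|x| + `|y|).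
Proof.
have [|c cle ->] := @mean_value_any_order (fun z => 1 - cos z) sin x y.
  move=> z; have -> : sin z = 0 - (- sin z) by rewrite sub0r opprK.
  exact: (@is_deriveB _ _ _ (cst (1 : R^o)) cos z 1).
rewrite normrM mulrC ler_wpM2l//; exact: le_trans (ler_norm_sin _) cle.
Qed.

Lemma sub_sin_lip x y :
  `|(x - sin x) - (y - sin y)| <= `|x - y| * (`|x| + `|y|).
Proof.
have dv (z : R) : is_derive z 1 (fun z => z - sin z) (1 - cos z).
  exact: (@is_deriveB _ R^o _ id sin z 1).
have [c cle ->] := mean_value_any_order x y dv.
rewrite normrM mulrC ler_wpM2l//.
by rewrite ger0_norm ?one_sub_cos_ge0//; apply: le_trans (one_sub_cos_le_norm _) cle.
Qed.

Lemma cos_lip x y : `|cos x - cos y| <= `|x - y|.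
Proof.
have [c _ ->] := @mean_value_any_order cos (fun z => - sin z) x y (fun z => is_derive_cos z).
by rewrite normrM ler_piMl// normrN sin_max.
Qed.

Lemma sin_lip x y : `|sin x - sin y| <= `|x - y|.
Proof.
have [c _ ->] := @mean_value_any_order sin cos x y (fun z => is_derive_sin z).
by rewrite normrM ler_piMl// cos_max.
Qed.

(** Together with one_sub_cos_le_sqr this pins 2 (1 - cos x) to x^2 up to a
    cubic error, which identifies second moments in limits at the origin. *)
Lemma one_sub_cos_ge x : x ^+ 2 - `|x| ^+ 3 <= 2 * (1 - cos x).
Proof.
rewrite one_sub_cosE; have -> : x = (x / 2) * 2 by rewrite divfK.
move: (x / 2) => y; rewrite mulfK//.
have := sub_sin_lip y 0; rewrite sin0 !subr0 normr0 addr0 => h1.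
have h2 := ler_norm_sin y.
rewrite normrM (@ger0_norm _ 2)//.
suff : `|y ^+ 2 - sin y ^+ 2| <= (`|y| * `|y|) * (2 * `|y|).
  by move=> /ler_normlP[_] h; have := h; lra.
rewrite subr_sqr normrM ler_pM//.
by rewrite (le_trans (ler_normD _ _))// mulr2n mulrDl mul1r lerD2l.
Qed.

End trig.

(** * Limits of integrals and second moments *)

Notation leb := lebesgue_measure.
Notation rintegrable mu g := (mu.-integrable setT (EFin \o g)).

Section integration.
Context d (T : measurableType d) (R : realType).

Lemma integrable_bounded (P : probability T R) (g : T -> R) (M : R) :
  measurable_fun setT g -> (forall w, `|g w| <= M) -> rintegrable P g.
Proof.
move=> mg gM; apply: measurable_bounded_integrable => //.
  by rewrite (le_lt_trans (probability_le1 P _)) ?ltry.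
exists M; split; first exact: num_real.
by move=> x Mx y _ /=; exact: le_trans (gM y) (ltW Mx).
Qed.

Lemma rintegrableZl (mu : {measure set T -> \bar R}) (c : R) (g : T -> R) :
  rintegrable mu g -> rintegrable mu (fun x => c * g x).
Proof. by move=> ig; exact: (@integrableZl _ _ _ _ _ measurableT c _ ig). Qed.

Lemma rintegrableB (mu : {measure set T -> \bar R}) (g h : T -> R) :
  rintegrable mu g -> rintegrable mu h -> rintegrable mu (fun x => g x - h x).
Proof. by move=> ig ih; exact: (@integrableB _ _ _ _ _ measurableT _ _ ig ih). Qed.

Lemma cvg_Rintegral_dominated (mu : {measure set T -> \bar R})
    (g_ : nat -> T -> R) (g h : T -> R) :
  (forall n, measurable_fun setT (g_ n)) -> measurable_fun setT g ->
  rintegrable mu h -> (forall n w, `|g_ n w| <= h w) ->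
  {ae mu, forall w, g_ n w @[n --> \oo] --> g w} ->
  \int[mu]_w g_ n w @[n --> \oo] --> \int[mu]_w g w.
Proof.
move=> mg_ mg ih gh gg.
have [|||||ig _ cv] := @dominated_convergence _ T R mu setT measurableT
    (fun n => EFin \o g_ n) (EFin \o g) (EFin \o h).
- by move=> n; exact/measurable_EFinP.
- exact/measurable_EFinP.
- by apply: filterS gg => w gw _; apply: cvg_EFin; [exact: nearW|].
- by [].
- by apply: aeW => w n _; rewrite lee_fin.
have fin : (\int[mu]_w (EFin \o g) w)%E \is a fin_num by exact: integrable_fin_num.
by apply: fine_cvg; rewrite fineK.
Qed.

Lemma cvg_Rintegral_bounded (P : probability T R)
    (g_ : nat -> T -> R) (g : T -> R) (M : R) :
  (forall n, measurable_fun setT (g_ n)) -> measurable_fun setT g ->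
  (forall n w, `|g_ n w| <= M) ->
  {ae P, forall w, g_ n w @[n --> \oo] --> g w} ->
  \int[P]_w g_ n w @[n --> \oo] --> \int[P]_w g w.
Proof.
move=> mg_ mg gM; apply: (@cvg_Rintegral_dominated P g_ g (cst M)) => //.
by apply: (@integrable_bounded P _ `|M|).
Qed.

Lemma ae_eq_Rintegral (mu : {measure set T -> \bar R}) (g h : T -> R) :
  measurable_fun setT g -> measurable_fun setT h ->
  {ae mu, forall w, g w = h w} -> \int[mu]_w g w = \int[mu]_w h w.
Proof.
move=> mg mh gh; congr fine; apply: ae_eq_integral => //.
- exact/measurable_EFinP.
- exact/measurable_EFinP.
- by apply: filterS gh => w -> _.
Qed.

Lemma Rintegral_eq0_ae (mu : {measure set T -> \bar R}) (h : T -> R) :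
  rintegrable mu h -> (forall w, 0 <= h w) -> \int[mu]_w h w = 0 ->
  {ae mu, forall w, h w = 0}.
Proof.
move=> ih h0 E0.
have : (\int[mu]_w `|(EFin \o h) w| = 0)%E.
  have fin := integrable_fin_num measurableT ih.
  rewrite -[RHS](congr1 EFin E0) /Rintegral fineK//; apply: eq_integral => w _ /=.
  by rewrite ger0_norm.
move=> /(ae_eq_integral_abs _ measurableT (measurable_int _ ih)) H.
by apply: filterS H => w hw; have := hw Logic.I; case.
Qed.

(** Fatou's lemma along x -> 0, since 2 (1 - cos (x y)) / x^2 tends to y^2:
    the behaviour of the real part of an exponent or of a characteristic
    function at the origin bounds a second moment that may be infinite a
    priori. *)
Lemma integral_sqr_le_of_cos (mu : {measure set T -> \bar R}) (X : T -> R) (V e : R) :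
  measurable_fun setT X -> 0 < e ->
  (forall x, 0 < x <= e ->
     (\int[mu]_w (1 - cos (x * X w))%:E <= (x ^+ 2 * V / 2)%:E)%E) ->
  (\int[mu]_w (X w ^+ 2)%:E <= V%:E)%E.
Proof.
move=> mX e0 h.
have [x_ [x0 xe cvx]] : exists x_ : nat -> R,
    [/\ forall n, 0 < x_ n, forall n, x_ n <= e & x_ n @[n --> \oo] --> (0 : R)].
  exists (fun n => e / n.+1%:R); split => [n|n|].
  - by rewrite divr_gt0.
  - by rewrite ler_pdivrMr// ler_peMr ?(ltW e0)// ler1n.
  - rewrite -[X in _ --> X](mulr0 e); apply: cvgMr; exact: cvg_harmonic.
pose f_ n w := ((1 - cos (x_ n * X w)) * (2 / x_ n ^+ 2))%:E.
have mcos n : measurable_fun setT (fun w => 1 - cos (x_ n * X w)).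
  apply: measurable_funB => //; apply: measurableT_comp => //.
    exact: continuous_measurable_fun (@continuous_cos R).
  exact: measurable_funM.
have mf n : measurable_fun setT (f_ n).
  by apply/measurable_EFinP; exact: measurable_funM.
have f0 n w : setT w -> (0 <= f_ n w)%E.
  by rewrite lee_fin mulr_ge0 ?one_sub_cos_ge0// divr_ge0 ?sqr_ge0.
have cvf w : f_ n w @[n --> \oo] --> (X w ^+ 2)%:E.
  apply: cvg_EFin; first exact: nearW.
  apply: (@squeeze_cvgr _ _ _ _ (fun n => X w ^+ 2 - `|x_ n| * `|X w| ^+ 3 * 2) (fun=> X w ^+ 2)).
  - apply: nearW => n; have xn := x0 n; rewrite /=.
    have h1 := one_sub_cos_ge (x_ n * X w); have h2 := one_sub_cos_le_sqr (x_ n * X w).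
    have xn2 : 0 < x_ n ^+ 2 by rewrite exprn_gt0.
    have e1 : (1 - cos (x_ n * X w)) * (2 / x_ n ^+ 2) = 2 * (1 - cos (x_ n * X w)) / x_ n ^+ 2.
      by rewrite mulrCA mulrA.
    apply/andP; split; rewrite e1.
      rewrite ler_pdivlMr//; apply: le_trans h1; rewrite normrM.
      rewrite (gtr0_norm xn) !exprMn.
      have : 0 <= x_ n ^+ 3 * `|X w| ^+ 3 by rewrite mulr_ge0// exprn_ge0// ltW.
      lra.
    rewrite ler_pdivrMr//; move: h2; rewrite exprMn; lra.
  - rewrite -[X in _ --> X]subr0; apply: cvgB; first exact: cvg_cst.
    rewrite -[0](mul0r 2) -[X in X * 2](mul0r (`|X w| ^+ 3)) -[X in X * _ * 2](@normr0 _ R).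
    by do 2 apply: cvgMl; apply: cvg_norm.
  - exact: cvg_cst.
have := @fatou _ _ _ mu setT measurableT f_ mf f0.
rewrite (_ : (\int[mu]_w _)%E = (\int[mu]_w (X w ^+ 2)%:E)%E); last first.
  apply: eq_integral => w _; rewrite is_cvg_limn_einfE; first exact/cvg_lim.
  by apply/cvg_ex; eexists; exact: cvf.
move=> /le_trans; apply.
have en n : (\int[mu]_w f_ n w <= V%:E)%E.
  have p : 0 < 2 / x_ n ^+ 2 by rewrite divr_gt0// exprn_gt0.
  rewrite /f_; under eq_integral do rewrite EFinM.
  rewrite ge0_integralZr//; last 2 first.
  - exact/measurable_EFinP/mcos.
  - by rewrite lee_fin ltW.
  have := h (x_ n); rewrite x0 xe => /(_ isT) hx.
  apply: (@le_trans _ _ ((x_ n ^+ 2 * V / 2)%:E * (2 / x_ n ^+ 2)%:E)%E).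
    by apply: lee_wpmul2r => //; rewrite lee_fin ltW.
  rewrite -EFinM lee_fin le_eqVlt; apply/orP; left; apply/eqP; field.
  by rewrite gt_eqF.
rewrite limn_einf_lim; apply: lime_le; first exact: is_cvg_einfs.
apply: nearW => n; apply: le_trans (en n); apply: ereal_inf_lbound.
by exists n => //=.
Qed.

Lemma integral_norm_le_sqr (P : probability T R) (X : T -> R) (a : R) : 0 < a ->
  measurable_fun setT X -> (\int[P]_w `|X w|%:E <= a%:E + a^-1%:E * \int[P]_w (X w ^+ 2)%:E)%E.
Proof.
move=> a0 mX.
have mX2 : measurable_fun setT (fun w => (X w ^+ 2)%:E).
  by apply/measurable_EFinP; exact: measurable_funX.
have -> : (a%:E = \int[P]_w a%:E)%E.
  by rewrite integral_cst//= probability_setT mule1.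
rewrite -ge0_integralZl//; last 2 first.
- by move=> w _; rewrite lee_fin sqr_ge0.
- by rewrite lee_fin invr_ge0 ltW.
rewrite -ge0_integralD//; last 3 first.
- by move=> w _; rewrite lee_fin ltW.
- by move=> w _; rewrite -EFinM lee_fin mulr_ge0 ?sqr_ge0// invr_ge0 ltW.
- exact: measurable_funeM.
apply: ge0_le_integral => //.
- by apply/measurable_EFinP; exact: measurableT_comp.
- by apply: emeasurable_funD => //; exact: measurable_funeM.
- move=> w _; rewrite -EFinM -EFinD lee_fin -(real_normK (num_real (X w))).
  rewrite -(ler_pM2l a0) mulrDr mulVKf ?gt_eqF//.
  have := sqr_ge0 (a - `|X w|); have := normr_ge0 (X w); nra.
Qed.

End integration.

(** * Expectations of bounded functions *)

Section law_integrals.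
Context (R : realType).

Lemma same_law_Rintegral d1 d2 d (T1 : measurableType d1) (T2 : measurableType d2)
    (T : measurableType d) (P1 : probability T1 R) (P2 : probability T2 R)
    (X1 : T1 -> T) (X2 : T2 -> T) (g : T -> R) (M : R) :
  measurable_fun setT X1 -> measurable_fun setT X2 -> measurable_fun setT g ->
  (forall y, `|g y| <= M) -> same_law P1 X1 P2 X2 ->
  \int[P1]_w g (X1 w) = \int[P2]_w g (X2 w).
Proof.
move=> m1 m2 mg gM h.
pose Y1 : {mfun T1 >-> T} := mfun_Sub (mem_set m1).
pose Y2 : {mfun T2 >-> T} := mfun_Sub (mem_set m2).
have i1 : rintegrable P1 (g \o X1).
  by apply: (@integrable_bounded _ _ _ _ _ M) => [|w]; [exact: measurableT_comp|exact: gM].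
have i2 : rintegrable P2 (g \o X2).
  by apply: (@integrable_bounded _ _ _ _ _ M) => [|w]; [exact: measurableT_comp|exact: gM].
have mg' : measurable_fun setT (EFin \o g) by exact/measurable_EFinP.
congr fine.
have -> : (\int[P1]_w (g (X1 w))%:E = \int[distribution P1 Y1]_y (g y)%:E)%E.
  by rewrite (@integral_distribution _ _ _ _ _ P1 Y1).
have -> : (\int[P2]_w (g (X2 w))%:E = \int[distribution P2 Y2]_y (g y)%:E)%E.
  by rewrite (@integral_distribution _ _ _ _ _ P2 Y2).
by apply: eq_measure_integral => A mA _; exact: h.
Qed.

Lemma Rintegral_prob_cst d (T : measurableType d) (P : probability T R) (c : R) :
  \int[P]_w c = c.
Proof.
by rewrite /Rintegral integral_cst//= probability_setT mule1.
Qed.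

Lemma RintegralD_bounded d (T : measurableType d) (P : probability T R) (f g : T -> R) (M N : R) :
  measurable_fun setT f -> measurable_fun setT g ->
  (forall w, `|f w| <= M) -> (forall w, `|g w| <= N) ->
  \int[P]_w (f w + g w) = \int[P]_w f w + \int[P]_w g w.
Proof.
move=> mf mg fM gN; apply: RintegralD => //.
- exact: (integrable_bounded P mf fM).
- exact: (integrable_bounded P mg gN).
Qed.

Lemma RintegralZl_bounded d (T : measurableType d) (P : probability T R) (f : T -> R) (c M : R) :
  measurable_fun setT f -> (forall w, `|f w| <= M) ->
  \int[P]_w (c * f w) = c * \int[P]_w f w.
Proof. by move=> mf fM; apply: RintegralZl => //; exact: (integrable_bounded P mf fM). Qed.

Lemma Rintegral_lin_bounded d (T : measurableType d) (P : probability T R) (f g : T -> R)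
    (a b M N : R) :
  measurable_fun setT f -> measurable_fun setT g ->
  (forall w, `|f w| <= M) -> (forall w, `|g w| <= N) ->
  \int[P]_w (a * f w + b * g w) = a * \int[P]_w f w + b * \int[P]_w g w.
Proof.
move=> mf mg fM gN; rewrite -(RintegralZl_bounded _ _ mf fM) -(RintegralZl_bounded _ _ mg gN).
apply: (@RintegralD_bounded _ _ _ _ _ (`|a| * M) (`|b| * N)).
- exact: measurable_funM.
- exact: measurable_funM.
- by move=> w; rewrite normrM ler_wpM2l.
- by move=> w; rewrite normrM ler_wpM2l.
Qed.

Lemma Rintegral_sum_bounded d (T : measurableType d) (P : probability T R)
    (n : nat) (f : 'I_n -> T -> R) (M : R) :
  (forall i, measurable_fun setT (f i)) -> (forall i w, `|f i w| <= M) ->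
  \int[P]_w (\sum_(i < n) f i w) = \sum_(i < n) \int[P]_w f i w.
Proof.
elim: n f => [|n IH] f mf fM.
  under eq_Rintegral do rewrite big_ord0.
  by rewrite big_ord0 Rintegral_cst// mul0r.
under eq_Rintegral do rewrite big_ord_recr.
rewrite (@RintegralD_bounded _ _ _ _ _ (M *+ n) M)//=.
- by rewrite big_ord_recr/= IH.
- exact: measurable_sum.
- move=> w; rewrite (le_trans (ler_norm_sum _ _ _))//.
  by rewrite (le_trans (ler_sum _ (fun i _ => fM _ w)))// sumr_const card_ord.
Qed.

Lemma sum_ord_lt (n m : nat) : (\sum_(j < n) (j < m)%N = minn n m)%N.
Proof.
elim: n => [|n IH]; first by rewrite big_ord0 min0n.
rewrite big_ord_recr/= IH /minn; case: (ltnP n m) => h; last by rewrite addn0 ltnNge (leqW h).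
rewrite addn1; case: ltnP => // h'; apply/eqP; by rewrite eqn_leq h.
Qed.

(** The sum is the integer part of (n + 1) y, so that a function with values
    in the unit interval is uniformly close to an average of indicators of its
    superlevel sets. *)
Lemma layer_cake_approx (y : R) (n : nat) : 0 <= y <= 1 ->
  `|n.+1%:R^-1 * (\sum_(j < n.+1) (j.+1%:R <= n.+1%:R * y)%R%:R) - y| <= n.+1%:R^-1.
Proof.
move=> /andP[y0 y1].
have N0 : (0 : R) < n.+1%:R by [].
pose m := Num.truncn (n.+1%:R * y).
have ny0 : 0 <= n.+1%:R * y by rewrite mulr_ge0// ltW.
have := truncn_itv ny0; rewrite -/m => /andP[m1 m2].
have mn : (m <= n.+1)%N.
  by rewrite -(ler_nat R) (le_trans m1)// ler_piMr// ltW.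
have -> : \sum_(j < n.+1) ((j.+1%:R <= n.+1%:R * y)%R%:R : R) = m%:R.
  rewrite -natr_sum -[in RHS](minn_idPr mn) -sum_ord_lt; congr (_%:R).
  apply: eq_bigr => j _; congr nat_of_bool; apply/idP/idP => h.
    by rewrite -ltnS -(ltr_nat R) (le_lt_trans h).
  by rewrite (le_trans _ m1)// ler_nat.
have e : n.+1%:R^-1 * m%:R - y = n.+1%:R^-1 * (m%:R - n.+1%:R * y).
  by rewrite mulrBr mulKf// gt_eqF.
rewrite e normrM ger0_norm ?invr_ge0 ?(ltW N0)// ler_piMr ?invr_ge0 ?(ltW N0)//.
rewrite ler_norml; move: m1 m2; rewrite -natr1; lra.
Qed.

(** Both sides are linear in g and continuous under bounded convergence, and
    indicators of superlevel sets approximate g. In the proof of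
    chf_independent, W stands for the factors of a product that are not being
    split off. *)
Lemma factor_Rintegral d d' (T : measurableType d) (T' : measurableType d')
    (P : probability T R) (W : T -> R) (M c : R) (X : T -> T') (g : T' -> R) :
  measurable_fun setT W -> (forall w, `|W w| <= M) ->
  measurable_fun setT X ->
  (forall B, measurable B -> \int[P]_w (W w * \1_B (X w)) = c * \int[P]_w \1_B (X w)) ->
  measurable_fun setT g -> (forall y, `|g y| <= 1) ->
  \int[P]_w (W w * g (X w)) = c * \int[P]_w g (X w).
Proof.
move=> mW WM mX h mg g1.
have M0 : 0 <= M := le_trans (normr_ge0 _) (WM point).
have mI B : measurable B -> measurable_fun setT (fun w => \1_B (X w) : R).
  by move=> mB; apply: measurableT_comp => //; exact: measurable_indic.
have I1 B w : `|\1_B (X w) : R| <= 1.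
  by rewrite indicE; case: (_ \in _); rewrite ?normr1 ?normr0.
(* Superlevel sets handle functions between 0 and 1, to which g is reduced at
   the end by an affine map. *)
have pos (k : T' -> R) : measurable_fun setT k -> (forall y, 0 <= k y <= 1) ->
    \int[P]_w (W w * k (X w)) = c * \int[P]_w k (X w).
  move=> mk k01.
  have k1 w : `|k w| <= 1.
    by have /andP[a b] := k01 w; rewrite ger0_norm.
  pose B n (j : nat) := [set y | j.+1%:R <= n.+1%:R * k y].
  have mB n j : measurable (B n j).
    have -> : B n j = (fun y => n.+1%:R * k y) @^-1` `[j.+1%:R, +oo[.
      by apply/seteqP; split => y; rewrite /B/= in_itv/= andbT.
    rewrite -[X in measurable X]setTI; apply: (measurable_funM _ mk) => //.
  pose k_ n y := n.+1%:R^-1 * (\sum_(j < n.+1) \1_(B n j) y) : R.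
  have k_E n y : k_ n y = n.+1%:R^-1 * (\sum_(j < n.+1) (j.+1%:R <= n.+1%:R * k y)%R%:R).
    by congr (_ * _); apply: eq_bigr => j _; rewrite indicE/B mem_setE.
  have kk n y : `|k_ n y - k y| <= n.+1%:R^-1 by rewrite k_E layer_cake_approx.
  have mk_ n : measurable_fun setT (fun w => k_ n (X w)).
    apply: measurable_funM => //; apply: measurable_sum => j; exact: mI.
  have k_1 n y : `|k_ n y| <= 2.
    rewrite -[k_ n y](subrK (k y)) (le_trans (ler_normD _ _))//.
    rewrite (_ : 2 = 1 + 1)// lerD// (le_trans (kk _ _))// invf_le1 ?ler1n//.
  have cvk y : k_ n y @[n --> \oo] --> k y.
    apply/cvgrPdist_le => e e0; near=> n.
    rewrite distrC (le_trans (kk _ _))//; near: n.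
    have := @cvg_harmonic R => /cvgrPdist_le /(_ _ e0).
    by apply: filterS => n; rewrite sub0r normrN ger0_norm// /harmonic/= invr_ge0.
  have c1 : \int[P]_w (W w * k_ n (X w)) @[n --> \oo] --> \int[P]_w (W w * k (X w)).
    apply: (@cvg_Rintegral_bounded _ _ _ _ _ _ (M * 2)).
    - by move=> n; exact: measurable_funM.
    - by apply: measurable_funM => //; exact: measurableT_comp.
    - by move=> n w; rewrite normrM ler_pM.
    - by apply: aeW => w; apply: cvgMr; exact: cvk.
  have c2 : c * \int[P]_w k_ n (X w) @[n --> \oo] --> c * \int[P]_w k (X w).
    apply: cvgMr; apply: (@cvg_Rintegral_bounded _ _ _ _ _ _ 2) => //.
    - exact: measurableT_comp.
    - by apply: aeW => w; exact: cvk.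
  have e n : \int[P]_w (W w * k_ n (X w)) = c * \int[P]_w k_ n (X w).
    have -> : \int[P]_w (W w * k_ n (X w)) =
        n.+1%:R^-1 * \int[P]_w (\sum_(j < n.+1) W w * \1_(B n j) (X w)).
      rewrite -(@RintegralZl_bounded _ _ _ _ _ (M *+ n.+1)).
      - by apply: eq_Rintegral => w _; rewrite /k_ mulrCA mulr_sumr.
      - apply: measurable_sum => j; apply: measurable_funM => //; exact: mI.
      - move=> w; rewrite (le_trans (ler_norm_sum _ _ _))//.
        have hh (j : 'I_n.+1) : true -> `|W w * \1_(B n j) (X w)| <= M.
          by move=> _; rewrite normrM -[M]mulr1 ler_pM.
        by rewrite (le_trans (ler_sum _ hh))// sumr_const card_ord.
    rewrite (@Rintegral_sum_bounded _ _ _ _ _ M).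
    - rewrite (@RintegralZl_bounded _ _ _ _ _ n.+1%:R).
      + rewrite (@Rintegral_sum_bounded _ _ _ _ _ 1) => [|i|i w].
        * rewrite [RHS]mulrCA [X in _ = _ * X]mulr_sumr; congr (_ * _).
          by apply: eq_bigr => i _; exact: h.
        * exact: mI.
        * exact: I1.
      + apply: measurable_sum => j; exact: mI.
      + move=> w; rewrite (le_trans (ler_norm_sum _ _ _))//.
        have hh (j : 'I_n.+1) : true -> `|\1_(B n j) (X w) : R| <= 1 by [].
        by rewrite (le_trans (ler_sum _ hh))// sumr_const card_ord.
    - by move=> i; apply: measurable_funM => //; exact: mI.
    - by move=> i w; rewrite normrM -[M]mulr1 ler_pM.
  move: c1; under eq_fun do rewrite e.
  by move=> c1; exact: (cvg_unique _ c1 c2).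
pose k y := 2^-1 * (g y + 1).
have k01 y : 0 <= k y <= 1 by have := g1 y; rewrite /k ler_norml; lra.
have mk : measurable_fun setT k by apply: measurable_funM => //; exact: measurable_funD.
have mkX : measurable_fun setT (fun w => k (X w)) by exact: measurableT_comp.
have k1 y : `|k y| <= 1 by have /andP[k0 k1] := k01 y; rewrite ger0_norm.
have W1 : \int[P]_w W w = c * \int[P]_w 1.
  have := h setT measurableT.
  under eq_Rintegral do rewrite indicT mulr1; rewrite -/(Rintegral _ _ _) => ->.
  by under eq_Rintegral do rewrite indicT.
have -> : \int[P]_w (W w * g (X w)) = 2 * \int[P]_w (W w * k (X w)) + -1 * \int[P]_w W w.
  rewrite -(@Rintegral_lin_bounded _ _ _ _ _ _ _ M M)//.
  - by apply: eq_Rintegral => w _; rewrite /k; field.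
  - exact: measurable_funM.
  - by move=> w; rewrite normrM -[M]mulr1 ler_pM.
have -> : \int[P]_w g (X w) = 2 * \int[P]_w k (X w) + -1 * \int[P]_w 1.
  rewrite -(@Rintegral_lin_bounded _ _ _ _ _ _ _ 1 1)//.
  - by apply: eq_Rintegral => w _; rewrite /k; field.
  - by move=> w; rewrite normr1.
rewrite pos// W1; ring.
Unshelve. all: by end_near. Qed.

End law_integrals.

(** * Complex exponentials and characteristic functions *)

Local Open Scope complex_scope.

Section complex_exponential.
Context {R : realType}.
Implicit Types (x y : R) (z : R[i]).

Lemma complex_ext (z1 z2 : R[i]) :
  complex.Re z1 = complex.Re z2 -> complex.Im z1 = complex.Im z2 -> z1 = z2.
Proof. by case: z1 z2 => [a b] [a' b'] /= -> ->. Qed.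

Lemma complex_ReM z1 z2 : complex.Re (z1 * z2) =
  complex.Re z1 * complex.Re z2 - complex.Im z1 * complex.Im z2.
Proof. by case: z1 z2 => [a b] [a' b']. Qed.

Lemma complex_ImM z1 z2 : complex.Im (z1 * z2) =
  complex.Re z1 * complex.Im z2 + complex.Im z1 * complex.Re z2.
Proof. by case: z1 z2 => [a b] [a' b']. Qed.

Lemma expi0 : expi 0 = 1 :> R[i].
Proof. by rewrite /expi cos0 sin0. Qed.

Lemma expiD x y : expi (x + y) = expi x * expi y.
Proof.
by apply: complex_ext; rewrite ?complex_ReM ?complex_ImM/= ?cosD ?sinD//; ring.
Qed.

Lemma expi_sum (I : Type) (s : seq I) (x : I -> R) :
  expi (\sum_(i <- s) x i) = \prod_(i <- s) expi (x i).
Proof.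
elim: s => [|i s IH]; first by rewrite !big_nil expi0.
by rewrite !big_cons expiD IH.
Qed.

Lemma cexp0 : cexp 0 = 1 :> R[i].
Proof. by rewrite /cexp/= expR0 expi0 mulr1. Qed.

Lemma cexpD z1 z2 : cexp (z1 + z2) = cexp z1 * cexp z2.
Proof.
case: z1 z2 => [a b] [a' b']; rewrite /cexp/= expRD expiD rmorphM/=.
by rewrite mulrACA.
Qed.

Lemma cexp_sum (I : Type) (s : seq I) (z : I -> R[i]) :
  cexp (\sum_(i <- s) z i) = \prod_(i <- s) cexp (z i).
Proof.
elim: s => [|i s IH]; first by rewrite !big_nil cexp0.
by rewrite !big_cons cexpD IH.
Qed.

Lemma Re_cexp z : complex.Re (cexp z) = expR (complex.Re z) * cos (complex.Im z).
Proof. by rewrite /cexp complex_ReM/= mul0r subr0. Qed.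

Lemma Im_cexp z : complex.Im (cexp z) = expR (complex.Re z) * sin (complex.Im z).
Proof. by rewrite /cexp complex_ImM/= mul0r addr0. Qed.

(** The squared modulus, with values in R rather than in R[i]. *)
Definition sqnorm z : R := complex.Re z ^+ 2 + complex.Im z ^+ 2.

Lemma sqnormM z1 z2 : sqnorm (z1 * z2) = sqnorm z1 * sqnorm z2.
Proof. by rewrite /sqnorm complex_ReM complex_ImM; ring. Qed.

Lemma sqnorm_expi x : sqnorm (expi x) = 1.
Proof. by rewrite /sqnorm/= cos2Dsin2. Qed.

Lemma sqnorm_cexp z : sqnorm (cexp z) = expR (complex.Re z) ^+ 2.
Proof. by rewrite sqnormM sqnorm_expi mulr1 /sqnorm/= expr0n/= addr0. Qed.

Lemma sqnorm_ge0 z : 0 <= sqnorm z.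
Proof. by rewrite addr_ge0 ?sqr_ge0. Qed.

Lemma sqnorm_Re_le z : sqnorm z <= 1 -> `|complex.Re z| <= 1.
Proof.
move=> h; rewrite -(@ler_pXn2r _ 2) ?nnegrE// real_normK ?num_real// expr1n.
by apply: le_trans h; rewrite lerDl sqr_ge0.
Qed.

Lemma sqnorm_Im_le z : sqnorm z <= 1 -> `|complex.Im z| <= 1.
Proof.
move=> h; rewrite -(@ler_pXn2r _ 2) ?nnegrE// real_normK ?num_real// expr1n.
by apply: le_trans h; rewrite lerDr sqr_ge0.
Qed.

End complex_exponential.

(** The characteristic function at the point 1; its value at theta is that of
    the variable theta X, and the value at a vector is that of a linear
    combination. *)
Definition chf d (T : measurableType d) (R : realType) (P : probability T R)
  (X : T -> R) : R[i] := cintegral P (fun w => expi (X w)).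

Section bounded_complex.
Context d (T : measurableType d) (R : realType) (P : probability T R).
Implicit Types (F G : T -> R[i]).

Definition unit_disc_valued F := [/\ measurable_fun setT (fun w => complex.Re (F w)),
  measurable_fun setT (fun w => complex.Im (F w)) & forall w, sqnorm (F w) <= 1].

Lemma unit_disc_valued_expi (X : T -> R) :
  measurable_fun setT X -> unit_disc_valued (fun w => expi (X w)).
Proof.
move=> mX; split => [||w].
- by apply: measurableT_comp => //; exact: continuous_measurable_fun (@continuous_cos R).
- by apply: measurableT_comp => //; exact: continuous_measurable_fun (@continuous_sin R).
- by rewrite sqnorm_expi.
Qed.

Lemma unit_disc_valued_indic (A : set T) :
  measurable A -> unit_disc_valued (fun w => (\1_A w)%:C).
Proof.
move=> mA; split => [||w].
- exact: measurable_indic.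
- exact: measurable_cst.
- by rewrite /sqnorm indicE; case: (w \in A); rewrite /= !(expr0n, expr1n)/= addr0.
Qed.

Lemma unit_disc_valuedM F G : unit_disc_valued F -> unit_disc_valued G ->
  unit_disc_valued (fun w => F w * G w).
Proof.
move=> [mF1 mF2 F1] [mG1 mG2 G1]; split => [||w].
- by under eq_fun do rewrite complex_ReM; apply: measurable_funB; exact: measurable_funM.
- by under eq_fun do rewrite complex_ImM; apply: measurable_funD; exact: measurable_funM.
- by rewrite sqnormM mulr_ile1 ?sqnorm_ge0.
Qed.

Lemma unit_disc_valued_prod (I : Type) (s : seq I) (F : I -> T -> R[i]) :
  (forall i, unit_disc_valued (F i)) -> unit_disc_valued (fun w => \prod_(i <- s) F i w).
Proof.
move=> hF; elim: s => [|i s IH].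
  under eq_fun do rewrite big_nil.
  by split => //= w; rewrite /sqnorm/= expr1n expr0n/= addr0.
by under eq_fun do rewrite big_cons; exact: unit_disc_valuedM.
Qed.

Lemma cintegral_indic (A : set T) : measurable A ->
  cintegral P (fun w => (\1_A w)%:C) = (fine (P A))%:C.
Proof.
move=> mA; apply: complex_ext => /=; last by rewrite Rintegral_cst// mul0r.
by rewrite /Rintegral integral_indic// setIT.
Qed.

Lemma Re_cintegralM F G : unit_disc_valued F -> unit_disc_valued G ->
  complex.Re (cintegral P (fun w => F w * G w)) =
  \int[P]_w (complex.Re (F w) * complex.Re (G w)) -
  \int[P]_w (complex.Im (F w) * complex.Im (G w)).
Proof.
move=> [mF1 mF2 F1] [mG1 mG2 G1] /=.
under eq_Rintegral do rewrite complex_ReM.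
rewrite RintegralB//; apply: (@integrable_bounded _ _ _ _ _ 1).
- exact: measurable_funM.
- by move=> w; rewrite normrM mulr_ile1// sqnorm_Re_le.
- exact: measurable_funM.
- by move=> w; rewrite normrM mulr_ile1// sqnorm_Im_le.
Qed.

Lemma Im_cintegralM F G : unit_disc_valued F -> unit_disc_valued G ->
  complex.Im (cintegral P (fun w => F w * G w)) =
  \int[P]_w (complex.Re (F w) * complex.Im (G w)) +
  \int[P]_w (complex.Im (F w) * complex.Re (G w)).
Proof.
move=> [mF1 mF2 F1] [mG1 mG2 G1] /=.
under eq_Rintegral do rewrite complex_ImM.
rewrite RintegralD//; apply: (@integrable_bounded _ _ _ _ _ 1).
- exact: measurable_funM.
- by move=> w; rewrite normrM mulr_ile1// ?sqnorm_Re_le ?sqnorm_Im_le.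
- exact: measurable_funM.
- by move=> w; rewrite normrM mulr_ile1// ?sqnorm_Re_le ?sqnorm_Im_le.
Qed.

(** The real and the imaginary part of F are the two weights to which
    factor_Rintegral applies. *)
Lemma factor_cintegral_expi F (X : T -> R) (c : R) :
  unit_disc_valued F -> measurable_fun setT X ->
  (forall B, measurable B ->
    cintegral P (fun w => F w * (\1_(X @^-1` B) w)%:C) =
    cintegral P F * (fine (P (X @^-1` B)))%:C) ->
  cintegral P (fun w => F w * expi (c * X w)) = cintegral P F * chf P (fun w => c * X w).
Proof.
move=> uF mX h.
have uI B : measurable B -> unit_disc_valued (fun w => (\1_(X @^-1` B) w)%:C).
  by move=> mB; apply: unit_disc_valued_indic; rewrite -[X in measurable X]setTI; exact: mX.
have uE : unit_disc_valued (fun w => expi (c * X w)).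
  by apply: unit_disc_valued_expi; exact: measurable_funM.
have e0 : \int[P]_w (0 : R) = 0 by rewrite Rintegral_cst// mul0r.
have hR B : measurable B -> \int[P]_w (complex.Re (F w) * \1_B (X w)) =
    complex.Re (cintegral P F) * \int[P]_w \1_B (X w).
  move=> mB; have := h _ mB => /(congr1 (@complex.Re R)); rewrite (Re_cintegralM uF (uI _ mB)).
  rewrite -cintegral_indic; last by rewrite -[X in measurable X]setTI; exact: mX.
  rewrite complex_ReM/=; under [X in _ - X = _ -> _]eq_Rintegral do rewrite mulr0.
  by rewrite e0 mulr0 !subr0.
have hI B : measurable B -> \int[P]_w (complex.Im (F w) * \1_B (X w)) =
    complex.Im (cintegral P F) * \int[P]_w \1_B (X w).
  move=> mB; have := h _ mB => /(congr1 (@complex.Im R)); rewrite (Im_cintegralM uF (uI _ mB)).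
  rewrite -cintegral_indic; last by rewrite -[X in measurable X]setTI; exact: mX.
  rewrite complex_ImM/=; under [X in X + _ = _ -> _]eq_Rintegral do rewrite mulr0.
  by rewrite e0 mulr0 !add0r.
have [mF1 mF2 F1] := uF.
have mcos : measurable_fun setT (fun x : R => cos (c * x)).
  apply: measurableT_comp; first exact: continuous_measurable_fun (@continuous_cos R).
  exact: measurable_funM.
have msin : measurable_fun setT (fun x : R => sin (c * x)).
  apply: measurableT_comp; first exact: continuous_measurable_fun (@continuous_sin R).
  exact: measurable_funM.
have F1' w := sqnorm_Re_le (F1 w); have F2' w := sqnorm_Im_le (F1 w).
have c1 y := @cos_max R (c * y); have s1 y := @sin_max R (c * y).
apply: complex_ext.
- rewrite (Re_cintegralM uF uE) complex_ReM /=.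
  by rewrite (factor_Rintegral mF1 F1' mX hR mcos c1) (factor_Rintegral mF2 F2' mX hI msin s1).
- rewrite (Im_cintegralM uF uE) complex_ImM /=.
  by rewrite (factor_Rintegral mF1 F1' mX hR msin s1) (factor_Rintegral mF2 F2' mX hI mcos c1).
Qed.

(** The factors are split off one at a time. For each of them it suffices to
    put the indicator of an event in its place, so that the induction carries
    indicators along with exponentials. *)
Lemma chf_independent (I : finType) (X : I -> T -> R) (c : I -> R) :
  (forall i, measurable_fun setT (X i)) ->
  mutually_independent_rv P X ->
  chf P (fun w => \sum_i c i * X i w) = \prod_i chf P (fun w => c i * X i w).
Proof.
move=> mX iX.
have meas i B : measurable B -> measurable (X i @^-1` B).
  by move=> mB; rewrite -[X in measurable X]setTI; exact: mX.
have capm (K : {set I}) (E : I -> set R) : (forall i, measurable (E i)) ->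
    measurable (\bigcap_(i in [set` K]) (X i @^-1` (E i))).
  by move=> mE; apply: fin_bigcap_measurable => // i _; exact: meas.
(* The variables of s enter through their exponentials, those of K through
   events. *)
suff H (s : seq I) (K : {set I}) (E : I -> set R) : uniq s ->
    (forall i, i \in s -> i \notin K) -> (forall i, measurable (E i)) ->
    cintegral P (fun w => (\prod_(i <- s) expi (c i * X i w)) *
       (\1_(\bigcap_(i in [set` K]) (X i @^-1` (E i))) w)%:C) =
    (\prod_(i <- s) chf P (fun w => c i * X i w)) *
      (fine (P (\bigcap_(i in [set` K]) (X i @^-1` (E i)))))%:C.
  have := @H (index_enum I) (@finset.set0 I) (fun=> setT) (index_enum_uniq _).
  rewrite (_ : \bigcap_(i in _) _ = setT); last first.
    by apply/seteqP; split => // w _ i /=.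
  rewrite probability_setT/= mulr1 => <- //; last by move=> i _; rewrite inE.
  rewrite /chf; congr (cintegral P _); apply/funext => w.
  by rewrite indicT/= mulr1 expi_sum.
elim: s K E => [|j s IH] K E.
  move=> _ _ mE; rewrite big_nil mul1r -cintegral_indic; last exact: capm.
  by congr (cintegral P _); apply/funext => w; rewrite big_nil mul1r.
move=> /= /andP[js us] hK mE.
have jK : j \notin K by apply: hK; rewrite mem_head.
have sK i : i \in s -> i \notin K by move=> si; apply: hK; rewrite in_cons si orbT.
pose F w := (\prod_(i <- s) expi (c i * X i w)) *
       (\1_(\bigcap_(i in [set` K]) (X i @^-1` (E i))) w)%:C.
have uF : unit_disc_valued F.
  apply: unit_disc_valuedM; last by apply: unit_disc_valued_indic; exact: capm.
  apply: unit_disc_valued_prod => i; apply: unit_disc_valued_expi; exact: measurable_funM.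
transitivity (cintegral P (fun w => F w * expi (c j * X j w))).
  congr (cintegral P _); apply/funext => w; rewrite big_cons /F.
  by rewrite -mulrA [LHS]mulrC.
rewrite (factor_cintegral_expi (c j) uF (mX j)); last first.
  move=> B mB.
  pose E' i := if i == j then B else E i.
  have mE' i : measurable (E' i) by rewrite /E'; case: ifP.
  have capE : \bigcap_(i in [set` finset.setU (finset.set1 j) K]) (X i @^-1` E' i) =
      (X j @^-1` B) `&` \bigcap_(i in [set` K]) (X i @^-1` E i).
    apply/seteqP; split => w /=.
      move=> h; split; first by have := h j; rewrite /E' eqxx /=; apply; rewrite !inE eqxx.
      move=> i /= iK; have := h i; rewrite /E' /= !inE iK orbT => /(_ isT).
      by case: eqP => // ij; move: jK; rewrite -ij iK.
    move=> [hB hE] i /=; rewrite !inE /E'; case: eqP => [->//|_ /= iK]; exact: hE.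
  transitivity (cintegral P (fun w => (\prod_(i <- s) expi (c i * X i w)) *
      (\1_(\bigcap_(i in [set` finset.setU (finset.set1 j) K]) (X i @^-1` E' i)) w)%:C)).
    congr (cintegral P _); apply/funext => w.
    rewrite /F capE indicI -mulrA -rmorphM; congr (_ * (_)%:C); exact: mulrC.
  rewrite IH//; last first.
    move=> i si; rewrite !inE negb_or sK// andbT.
    by apply: contraNneq js => <-.
  rewrite IH// -mulrA -rmorphM/=; congr (_ * (_)%:C).
  have pre (J : {set I}) (D : I -> set R) : (forall i, measurable (D i)) ->
     P (\bigcap_(i in [set` J]) (X i @^-1` D i)) = (\prod_(i in J) P (X i @^-1` D i))%E.
    by move=> mD; apply: iX => i iJ; exists (D i) => //; rewrite setTI.
  rewrite pre// pre// big_setU1//= /E' eqxx.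
  rewrite [in RHS]mulrC -fineM; last 2 first.
  - exact: fin_num_measure (meas _ _ mB).
  - by rewrite -pre//; apply: fin_num_measure; exact: capm.
  congr (fine (_ * _)%E); apply: eq_bigr => i iK.
  by case: eqP => // ij; move: jK; rewrite -ij iK.
by rewrite IH// big_cons mulrAC; congr (_ * _); exact: mulrC.
Qed.

End bounded_complex.

(** * Limits of characteristic functions *)

Section complex_limits.
Context {R : realType}.
Implicit Types (z : R[i]).

(** Coordinatewise, so that limits of complex integrals reduce to limits of
    real ones. *)
Definition ccvg (z_ : nat -> R[i]) z : Prop :=
  complex.Re (z_ n) @[n --> \oo] --> complex.Re z /\
  complex.Im (z_ n) @[n --> \oo] --> complex.Im z.

Lemma ccvg_unique (z_ : nat -> R[i]) z z' : ccvg z_ z -> ccvg z_ z' -> z = z'.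
Proof.
move=> [a b] [a' b']; apply: complex_ext.
  exact: (cvg_unique _ a a').
exact: (cvg_unique _ b b').
Qed.

Lemma ccvg_cexpN (z_ : nat -> R[i]) z : ccvg z_ z -> ccvg (fun n => cexp (- z_ n)) (cexp (- z)).
Proof.
move=> [a b].
have ReN (x : R[i]) : complex.Re (- x) = - complex.Re x by case: x.
have ImN (x : R[i]) : complex.Im (- x) = - complex.Im x by case: x.
split; [under eq_fun do rewrite Re_cexp ReN ImN|under eq_fun do rewrite Im_cexp ReN ImN];
  rewrite ?Re_cexp ?Im_cexp ReN ImN; apply: cvgM.
- exact: (cvg_comp _ _ (cvgN a) (@continuous_expR R _)).
- exact: (cvg_comp _ _ (cvgN b) (@continuous_cos R _)).
- exact: (cvg_comp _ _ (cvgN a) (@continuous_expR R _)).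
- exact: (cvg_comp _ _ (cvgN b) (@continuous_sin R _)).
Qed.

Lemma ccvgM (z_ z'_ : nat -> R[i]) z z' : ccvg z_ z -> ccvg z'_ z' -> ccvg (fun n => z_ n * z'_ n) (z * z').
Proof.
move=> [a b] [a' b']; split; [rewrite complex_ReM (eq_cvg _ _ (fun n => complex_ReM (z_ n) (z'_ n)))|
  rewrite complex_ImM (eq_cvg _ _ (fun n => complex_ImM (z_ n) (z'_ n)))].
  by apply: cvgB; exact: cvgM.
by apply: cvgD; exact: cvgM.
Qed.

End complex_limits.

Section chf_limits.
Context d (T : measurableType d) (R : realType) (P : probability T R).
Implicit Types X : T -> R.

Lemma measurable_cos X : measurable_fun setT X -> measurable_fun setT (fun w => cos (X w)).
Proof. by move=> mX; apply: measurableT_comp => //; exact: continuous_measurable_fun (@continuous_cos R). Qed.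

Lemma measurable_sin X : measurable_fun setT X -> measurable_fun setT (fun w => sin (X w)).
Proof. by move=> mX; apply: measurableT_comp => //; exact: continuous_measurable_fun (@continuous_sin R). Qed.

Lemma integrable_one_sub_cos_law X : measurable_fun setT X ->
  rintegrable P (fun w => 1 - cos (X w)).
Proof.
move=> mX; have mc : measurable_fun setT (fun w => 1 - cos (X w)).
  by apply: measurable_funB => //; exact: measurable_cos.
apply: (integrable_bounded (M := 2) P mc) => w.
by rewrite ger0_norm ?one_sub_cos_ge0// one_sub_cos_le2.
Qed.

Lemma Rintegral_one_sub_cos X : measurable_fun setT X ->
  \int[P]_w (1 - cos (X w)) = 1 - complex.Re (chf P X).
Proof.
move=> mX; rewrite RintegralB ?Rintegral_prob_cst//.
  exact: finite_measure_integrable_cst.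
apply: (integrable_bounded P (measurable_cos mX)) => w; exact: cos_max.
Qed.

Lemma cvg_chf_ae (X_ : nat -> T -> R) X :
  (forall n, measurable_fun setT (X_ n)) -> measurable_fun setT X ->
  {ae P, forall w, X_ n w @[n --> \oo] --> X w} ->
  ccvg (fun n => chf P (X_ n)) (chf P X).
Proof.
move=> mX_ mX h; split => /=.
- apply: (@cvg_Rintegral_bounded _ _ _ _ _ _ 1) => [n|||].
  + exact: measurable_cos.
  + exact: measurable_cos.
  + by move=> n w; exact: cos_max.
  + by apply: filterS h => w hw; exact: (cvg_comp _ _ hw (@continuous_cos R _)).
- apply: (@cvg_Rintegral_bounded _ _ _ _ _ _ 1) => [n|||].
  + exact: measurable_sin.
  + exact: measurable_sin.
  + by move=> n w; exact: sin_max.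
  + by apply: filterS h => w hw; exact: (cvg_comp _ _ hw (@continuous_sin R _)).
Qed.

Lemma chf_ae_eq X X' : measurable_fun setT X -> measurable_fun setT X' ->
  {ae P, forall w, X w = X' w} -> chf P X = chf P X'.
Proof.
move=> mX mX' h; apply: complex_ext => /=; apply: ae_eq_Rintegral;
  do ?[exact: measurable_cos|exact: measurable_sin].
  by apply: filterS h => w ->.
by apply: filterS h => w ->.
Qed.

(** The Lipschitz property reduces the claim to convergence in mean, and y <=
    a + y^2 / a replaces the Cauchy-Schwarz inequality. *)
Lemma cvg_Rintegral_lip_L2 (phi : R -> R) (X_ : nat -> T -> R) X :
  measurable_fun setT phi -> (forall x, `|phi x| <= 1) ->
  (forall x y, `|phi x - phi y| <= `|x - y|) ->
  (forall n, measurable_fun setT (X_ n)) -> measurable_fun setT X ->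
  (\int[P]_w ((X_ n w - X w) ^+ 2)%:E)%E @[n --> \oo] --> 0%E ->
  \int[P]_w phi (X_ n w) @[n --> \oo] --> \int[P]_w phi (X w).
Proof.
move=> mphi phi1 lphi mX_ mX cv.
apply/cvgrPdist_le => e e0.
have h0 : 0 < e / 2 by rewrite divr_gt0.
have /fine_cvgP[fin /cvgrPdist_le /(_ _ (exprn_gt0 2 h0))] := cv.
move: fin; apply: filterS2 => n fn; rewrite sub0r normrN => /(le_trans (ler_norm _)).
rewrite -lee_fin fineK// => dn.
have mp (Y : T -> R) : measurable_fun setT Y -> measurable_fun setT (fun w => phi (Y w)).
  by move=> mY; exact: (measurableT_comp mphi mY).
have ip (Y : T -> R) : measurable_fun setT Y -> rintegrable P (fun w => phi (Y w)).
  by move=> mY; apply: (@integrable_bounded _ _ _ _ _ 1) => //; exact: mp.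
rewrite -RintegralB//; [|exact: ip|exact: ip].
have iB : rintegrable P (fun w => phi (X w) - phi (X_ n w)).
  exact: (rintegrableB (ip _ mX) (ip _ (mX_ n))).
rewrite (le_trans (le_normr_Rintegral _ iB))//.
have mD : measurable_fun setT (fun w => X_ n w - X w) by exact: measurable_funB.
have mphiD : measurable_fun setT (fun w => phi (X w) - phi (X_ n w)).
  by apply: measurable_funB; exact: mp.
rewrite -lee_fin /Rintegral fineK; last exact: integrable_fin_num (integrable_norm iB).
apply: (@le_trans _ _ (\int[P]_w `|X_ n w - X w|%:E)%E).
  apply: ge0_le_integral => //.
  - by apply/measurable_EFinP; exact: measurableT_comp.
  - by apply/measurable_EFinP; exact: measurableT_comp.
  - by move=> w _; rewrite lee_fin distrC lphi.
apply: (le_trans (integral_norm_le_sqr P h0 mD)).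
rewrite (_ : e%:E = (e / 2)%:E + (e / 2)^-1%:E * ((e / 2) ^+ 2)%:E)%E; last first.
  by rewrite -!EFinM -EFinD expr2 mulKf ?gt_eqF// -splitr.
by rewrite leeD2l// lee_wpmul2l// lee_fin invr_ge0 ltW.
Qed.

Lemma cvg_chf_L2 (X_ : nat -> T -> R) X :
  (forall n, measurable_fun setT (X_ n)) -> measurable_fun setT X ->
  (\int[P]_w ((X_ n w - X w) ^+ 2)%:E)%E @[n --> \oo] --> 0%E ->
  ccvg (fun n => chf P (X_ n)) (chf P X).
Proof.
move=> mX_ mX h; split => /=; apply: cvg_Rintegral_lip_L2 => //.
- exact: continuous_measurable_fun (@continuous_cos R).
- exact: cos_max.
- exact: cos_lip.
- exact: continuous_measurable_fun (@continuous_sin R).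
- exact: sin_max.
- exact: sin_lip.
Qed.

End chf_limits.

Lemma chf_same_law d1 d2 (T1 : measurableType d1) (T2 : measurableType d2) (R : realType)
    (P1 : probability T1 R) (P2 : probability T2 R) (X1 : T1 -> R) (X2 : T2 -> R) (c : R) :
  measurable_fun setT X1 -> measurable_fun setT X2 -> same_law P1 X1 P2 X2 ->
  chf P1 (fun w => c * X1 w) = chf P2 (fun w => c * X2 w).
Proof.
move=> m1 m2 h; apply: complex_ext => /=.
- apply: (@same_law_Rintegral _ _ _ _ _ _ _ P1 P2 X1 X2 (fun x => cos (c * x)) 1) => //.
    by apply: measurable_cos; exact: measurable_funM.
  by move=> y; exact: cos_max.
- apply: (@same_law_Rintegral _ _ _ _ _ _ _ P1 P2 X1 X2 (fun x => sin (c * x)) 1) => //.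
    by apply: measurable_sin; exact: measurable_funM.
  by move=> y; exact: sin_max.
Qed.

(** * Polynomials approximating a step *)

Section step_polynomials.
Context {R : realType}.
Implicit Types x y t : R.

Lemma bernoulli_le t n : 0 <= t <= 1 -> 1 - n%:R * t <= (1 - t) ^+ n.
Proof.
move=> /andP[t0 t1]; elim: n => [|n IH]; first by rewrite mul0r subr0 expr0.
rewrite exprS -natr1.
apply: le_trans (ler_wpM2l _ IH); last by rewrite subr_ge0.
have : 0 <= n%:R * t ^+ 2 by rewrite mulr_ge0// sqr_ge0.
lra.
Qed.

Lemma bernoulli_ge t n : 0 <= t -> 1 + n%:R * t <= (1 + t) ^+ n.
Proof.
move=> t0; elim: n => [|n IH]; first by rewrite mul0r addr0 expr0.
rewrite exprS -natr1.
apply: le_trans (ler_wpM2l _ IH); last by rewrite addr_ge0.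
have : 0 <= n%:R * t ^+ 2 by rewrite mulr_ge0// sqr_ge0.
lra.
Qed.

Lemma cvg_natM_expr x : 0 <= x < 1 -> n%:R * x ^+ n @[n --> \oo] --> (0 : R).
Proof.
move=> /andP[x0 x1].
have [xe|xn] := eqVneq x 0.
  apply: cvg_near_cst; exists 1%N => // n /= n1.
  by rewrite xe expr0n eqn0Ngt n1 mulr0.
pose y := Num.sqrt x.
have xp : 0 < x by rewrite lt_neqAle eq_sym xn.
have y0 : 0 < y by rewrite sqrtr_gt0.
have y1 : y < 1 by rewrite -sqrtr1 ltr_sqrt.
have xy : x = y * y by rewrite -expr2 sqr_sqrtr.
pose t := y^-1 - 1.
have t0 : 0 < t by rewrite subr_gt0 invf_gt1.
have bnd n : n%:R * y ^+ n <= t^-1.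
  have := @bernoulli_ge t n (ltW t0); rewrite (_ : 1 + t = y^-1) ?exprVn => [h|]; last by rewrite addrC subrK.
  have yn : 0 < y ^+ n by rewrite exprn_gt0.
  rewrite -(ler_pM2r t0) mulVf ?gt_eqF// mulrAC -ler_pdivlMr// div1r.
  by apply: le_trans h; rewrite lerDr.
apply: (@squeeze_cvgr _ _ _ _ (fun=> 0) (fun n => t^-1 * y ^+ n)).
- apply: nearW => n; rewrite mulr_ge0 ?exprn_ge0//= xy exprMn mulrA.
  by rewrite ler_wpM2r// exprn_ge0// ltW.
- exact: cvg_cst.
- rewrite -[X in _ --> X](mulr0 t^-1); apply: cvgMr.
  by apply: cvg_expr; rewrite ger0_norm ?ltW.
Qed.

(** Polynomials converging on the unit interval to the indicator of the values
    below 1/2. *)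
Definition step_poly n x : R := (1 - x ^+ n) ^+ (n * 2 ^ n).

Lemma step_poly_bound n x : 0 <= x <= 1 -> 0 <= step_poly n x <= 1.
Proof.
move=> /andP[x0 x1]; have h0 : 0 <= x ^+ n by rewrite exprn_ge0.
have h1 : x ^+ n <= 1 by rewrite exprn_ile1.
have h2 : 0 <= 1 - x ^+ n by rewrite subr_ge0.
rewrite /step_poly exprn_ge0//= exprn_ile1//; lra.
Qed.

(** Below 1/2, n 2^n x^n tends to 0 and Bernoulli's inequality keeps the power
    close to 1; from 1/2 on, n 2^n x^n is at least n and the power is at most
    exp (- n). *)
Lemma cvg_step_poly x : 0 <= x <= 1 ->
  step_poly n x @[n --> \oo] --> ((x < 2^-1)%R%:R : R).
Proof.
move=> /[dup] x01 /andP[x0 x1].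
case: ltP => hx; rewrite ?mulr1n ?mulr0n.
- apply: (@squeeze_cvgr _ _ _ _ (fun n => 1 - n%:R * (2 * x) ^+ n) (fun=> 1)).
  + apply: nearW => n; have /andP[_ ->] := step_poly_bound n x01.
    rewrite andbT; apply: le_trans (bernoulli_le _ _).
      by rewrite natrM natrX exprMn mulrA.
    by rewrite exprn_ge0//= exprn_ile1.
  + rewrite -[X in _ --> X]subr0; apply: cvgB; first exact: cvg_cst.
    by apply: cvg_natM_expr; rewrite mulr_ge0//=; lra.
  + exact: cvg_cst.
- apply: (@squeeze_cvgr _ _ _ _ (fun=> 0) (fun n => n.+1%:R^-1)).
  + apply: nearW => n; have /andP[-> _] /= := step_poly_bound n x01.
    have h0 : 2^-1 ^+ n <= x ^+ n by rewrite lerXn2r// nnegrE.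
    have h1 : x ^+ n <= 1 by rewrite exprn_ile1.
    have : 1 - x ^+ n <= expR (- (2^-1 ^+ n)).
      by apply: le_trans (expR_ge1Dx _); lra.
    move=> h; apply: (@le_trans _ _ (expR (- (2^-1 ^+ n)) ^+ (n * 2 ^ n))).
      by apply: lerXn2r => //; rewrite nnegrE ?subr_ge0// expR_ge0.
    rewrite -expRM_natl natrM natrX exprVn -mulrA mulrN divff ?expf_neq0// mulrN1.
    rewrite expRN lef_pV2 ?posrE ?expR_gt0//.
    by apply: le_trans (expR_ge1Dx _); rewrite -natr1 addrC.
  + exact: cvg_cst.
  + exact: cvg_harmonic.
Qed.

(** On a bounded range a slow sine has the sign of its argument: half-lines
    are limits of events given by the sign of a trigonometric polynomial. *)
Lemma cvg_sin_sign y :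
  ((sin (y / n.+1%:R) < 0)%R%:R : R) @[n --> \oo] --> ((y < 0)%R%:R : R).
Proof.
apply: cvg_near_cst.
have [N hN] : exists N, forall n, (N <= n)%N -> `|y| / n.+1%:R < 2.
  exists (Num.truncn `|y|) => n hn; rewrite ltr_pdivrMr//.
  apply: lt_le_trans (truncnS_gt `|y|) _.
  by rewrite -natrM ler_nat; apply: (@leq_trans n.+1); [rewrite ltnS|rewrite leq_pmull].
exists N => // n /= /hN h.
have N0 : (0 : R) < n.+1%:R by [].
congr (nat_of_bool _)%:R.
have [y0|y0|->] := ltgtP y 0.
- rewrite -oppr_gt0 -sinN; apply: sin2_gt0; move: h; rewrite ltr0_norm// mulNr => ->.
  by rewrite oppr_gt0 pmulr_llt0 ?invr_gt0// y0.
- apply/negbTE; rewrite -leNgt ltW//; apply: sin2_gt0; move: h; rewrite gtr0_norm// => ->.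
  by rewrite divr_gt0.
- by rewrite mul0r sin0 ltxx.
Qed.

End step_polynomials.

(** * Characteristic functions determine laws *)

Section chf_uniqueness.
Context d1 d2 (T1 : measurableType d1) (T2 : measurableType d2) (R : realType).
Context (P1 : probability T1 R) (P2 : probability T2 R) (k : nat).
Local Notation V := (k.-tuple R).
Variables (X : T1 -> V) (Y : T2 -> V).
Hypotheses (mX : measurable_fun setT X) (mY : measurable_fun setT Y).
Hypothesis chfE : forall theta : 'I_k -> R,
  chf P1 (fun w => \sum_j theta j * tnth (X w) j) =
  chf P2 (fun w => \sum_j theta j * tnth (Y w) j).

Definition trig (theta : 'I_k -> R) (b : R) (v : V) : R :=
  cos (b + \sum_j theta j * tnth v j).

Definition bounded_meas (g : V -> R) :=
  measurable_fun setT g /\ exists M, forall v, `|g v| <= M.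

(** Equality of the characteristic functions says that the constant 1 belongs
    to this class. *)
Definition same_transform (g : V -> R) := bounded_meas g /\
  forall theta b, \int[P1]_w (g (X w) * trig theta b (X w)) =
                  \int[P2]_w (g (Y w) * trig theta b (Y w)).

(** Functions with equal integrals under both laws need not be stable under
    products. Multipliers are, and under bounded limits as well, so that the
    sets among them form a sigma-algebra. *)
Definition multiplier (g : V -> R) := bounded_meas g /\
  forall h, same_transform h -> same_transform (fun v => g v * h v).

Lemma measurable_trig theta b : measurable_fun setT (trig theta b).
Proof.
apply: measurable_cos; apply: measurable_funD => //.
apply: measurable_sum => j; apply: measurable_funM => //; exact: measurable_tnth.
Qed.

Lemma trig_le1 theta b v : `|trig theta b v| <= 1.
Proof. exact: cos_max. Qed.

Lemma bounded_meas_ge0 g : bounded_meas g ->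
  exists M, [/\ measurable_fun setT g, 0 <= M & forall v, `|g v| <= M].
Proof.
move=> [mg [M hM]]; exists M; split => //.
exact: le_trans (normr_ge0 _) (hM [tuple 0 | _ < k]).
Qed.

Lemma bounded_measM g h : bounded_meas g -> bounded_meas h ->
  bounded_meas (fun v => g v * h v).
Proof.
move=> /bounded_meas_ge0[M [mg M0 gM]] /bounded_meas_ge0[N [mh N0 hN]]; split.
  exact: measurable_funM.
by exists (M * N) => v; rewrite normrM ler_pM.
Qed.

Lemma bounded_measD g h : bounded_meas g -> bounded_meas h ->
  bounded_meas (fun v => g v + h v).
Proof.
move=> [mg [M gM]] [mh [N hN]]; split; first exact: measurable_funD.
by exists (M + N) => v; rewrite (le_trans (ler_normD _ _))// lerD.
Qed.

Lemma bounded_meas_cst c : bounded_meas (fun=> c).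
Proof. by split => //; exists `|c|. Qed.

Lemma bounded_meas_trig theta b : bounded_meas (trig theta b).
Proof. by split; [exact: measurable_trig|exists 1 => v; exact: trig_le1]. Qed.

Lemma Rintegral_law_lin d (T : measurableType d) (P : probability T R) (Z : T -> V)
    (c c' : R) (g h : V -> R) :
  measurable_fun setT Z -> bounded_meas g -> bounded_meas h ->
  \int[P]_w (c * g (Z w) + c' * h (Z w)) = c * \int[P]_w g (Z w) + c' * \int[P]_w h (Z w).
Proof.
move=> mZ [mg [M gM]] [mh [N hN]].
apply: (@Rintegral_lin_bounded _ _ _ _ _ _ _ _ M N) => //; exact: measurableT_comp.
Qed.

Lemma same_transform_lin c c' g h : same_transform g -> same_transform h ->
  same_transform (fun v => c * g v + c' * h v).
Proof.
move=> [bg eg] [bh eh].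
have bt := bounded_meas_trig; have bc := bounded_meas_cst.
split; first by apply: bounded_measD; apply: bounded_measM.
move=> theta b.
have e v : (c * g v + c' * h v) * trig theta b v =
    c * (g v * trig theta b v) + c' * (h v * trig theta b v) by ring.
have lin d (T : measurableType d) (P : probability T R) (Z : T -> V) (mZ : measurable_fun setT Z) :=
  Rintegral_law_lin P c c' mZ (bounded_measM bg (bt theta b)) (bounded_measM bh (bt theta b)).
under eq_Rintegral do rewrite e.
under [RHS]eq_Rintegral do rewrite e.
by rewrite !lin// eg eh.
Qed.

Lemma same_transform_cst c : same_transform (fun=> c).
Proof.
split; first exact: bounded_meas_cst.
move=> theta b.
have mS : measurable_fun setT (fun v : V => \sum_j theta j * tnth v j).
  apply: measurable_sum => j; apply: measurable_funM => //; exact: measurable_tnth.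
have bC : bounded_meas (fun v => cos (\sum_j theta j * tnth v j)).
  by split; [exact: measurable_cos|exists 1 => v; exact: cos_max].
have bS : bounded_meas (fun v => sin (\sum_j theta j * tnth v j)).
  by split; [exact: measurable_sin|exists 1 => v; exact: sin_max].
have e v : c * trig theta b v = c * cos b * cos (\sum_j theta j * tnth v j) +
    - (c * sin b) * sin (\sum_j theta j * tnth v j) by rewrite /trig cosD; ring.
have lin d (T : measurableType d) (P : probability T R) (Z : T -> V) (mZ : measurable_fun setT Z) :=
  Rintegral_law_lin P (c * cos b) (- (c * sin b)) mZ bC bS.
under eq_Rintegral do rewrite e.
under [RHS]eq_Rintegral do rewrite e.
rewrite !lin//; congr (_ * _ + _ * _).
- exact: (congr1 (@complex.Re R) (chfE theta)).
- exact: (congr1 (@complex.Im R) (chfE theta)).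
Qed.

Lemma multiplier_cst c : multiplier (fun=> c).
Proof.
split; first exact: bounded_meas_cst.
move=> h hh; have := same_transform_lin c 0 hh hh.
by congr same_transform; apply/funext => v; rewrite mul0r addr0.
Qed.

Lemma multiplierM g h : multiplier g -> multiplier h -> multiplier (fun v => g v * h v).
Proof.
move=> [bg hg] [bh hh]; split; first exact: bounded_measM.
move=> u /hh/hg; by congr same_transform; apply/funext => v; rewrite mulrA.
Qed.

Lemma multiplierX g n : multiplier g -> multiplier (fun v => g v ^+ n).
Proof.
move=> hg; elim: n => [|n IH].
  by under eq_fun do rewrite expr0; exact: multiplier_cst.
by under eq_fun do rewrite exprS; exact: multiplierM.
Qed.

Lemma multiplier_lin c c' g h : multiplier g -> multiplier h ->
  multiplier (fun v => c * g v + c' * h v).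
Proof.
move=> [bg hg] [bh hh]; have bc := bounded_meas_cst.
split; first by apply: bounded_measD; apply: bounded_measM.
move=> u hu; have := same_transform_lin c c' (hg _ hu) (hh _ hu).
by congr same_transform; apply/funext => v; ring.
Qed.

Lemma multiplierC g : multiplier g -> multiplier (fun v => 1 - g v).
Proof.
move=> hg; have := multiplier_lin 1 (-1) (multiplier_cst 1) hg.
by congr multiplier; apply/funext => v; ring.
Qed.

(** The product of two cosines is a combination of cosines. *)
Lemma multiplier_trig theta b : multiplier (trig theta b).
Proof.
split; first exact: bounded_meas_trig.
move=> h [bh eh]; split; first exact: bounded_measM (bounded_meas_trig _ _) bh.
move=> theta' b'.
pose tp j := theta' j + theta j; pose tm j := theta' j - theta j.
have prod v : trig theta b v * h v * trig theta' b' v =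
    2^-1 * (h v * trig tp (b' + b) v) + 2^-1 * (h v * trig tm (b' - b) v).
  rewrite /trig /tp /tm.
  have -> : b' + b + \sum_j (theta' j + theta j) * tnth v j =
     (b' + \sum_j theta' j * tnth v j) + (b + \sum_j theta j * tnth v j).
    rewrite addrACA -big_split/=; congr (_ + _); apply: eq_bigr => j _; exact: mulrDl.
  have -> : b' - b + \sum_j (theta' j - theta j) * tnth v j =
     (b' + \sum_j theta' j * tnth v j) - (b + \sum_j theta j * tnth v j).
    rewrite opprD addrACA -sumrN -big_split/=; congr (_ + _); apply: eq_bigr => j _; exact: mulrBl.
  move: (b' + _) (b + _) => A B; rewrite cosD cosB; by field.
have lin d (T : measurableType d) (P : probability T R) (Z : T -> V) (mZ : measurable_fun setT Z) :=
  Rintegral_law_lin P 2^-1 2^-1 mZ (bounded_measM bh (bounded_meas_trig tp (b' + b)))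
    (bounded_measM bh (bounded_meas_trig tm (b' - b))).
under eq_Rintegral do rewrite prod.
under [RHS]eq_Rintegral do rewrite prod.
by rewrite !lin// !eh.
Qed.

Lemma multiplier_lim (g_ : nat -> V -> R) (g : V -> R) (M : R) :
  (forall n, multiplier (g_ n)) -> (forall n v, `|g_ n v| <= M) ->
  (forall v, g_ n v @[n --> \oo] --> g v) -> multiplier g.
Proof.
move=> hg_ gM cg.
have mg : measurable_fun setT g.
  apply: (@measurable_fun_cvg _ _ _ _ g_) => [n|v _]; last exact: cg.
  by have [[]] := hg_ n.
have bg : bounded_meas g.
  split => //; exists M => v.
  have cn : `|g_ n v| @[n --> \oo] --> `|g v| by apply: cvg_norm; exact: cg.
  by apply: (cvgr_to_le cn); apply: nearW => n; exact: gM.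
split => // h [bh eh]; split; first exact: bounded_measM.
have [N [mh N0 hN]] := bounded_meas_ge0 bh.
have M0 : 0 <= M := le_trans (normr_ge0 _) (gM 0%N [tuple 0 | _ < k]).
move=> theta b.
have lim d (T : measurableType d) (P : probability T R) (Z : T -> V) :
    measurable_fun setT Z ->
    \int[P]_w (g_ n (Z w) * h (Z w) * trig theta b (Z w)) @[n --> \oo] -->
    \int[P]_w (g (Z w) * h (Z w) * trig theta b (Z w)).
  move=> mZ.
  have mc (u : V -> R) : measurable_fun setT u -> measurable_fun setT (fun w => u (Z w)).
    by move=> mu; exact: (measurableT_comp mu mZ).
  have mt := mc _ (measurable_trig theta b).
  apply: (@cvg_Rintegral_bounded _ _ _ _ _ _ (M * N)).
  - move=> n; have [[mgn _] _] := hg_ n.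
    by do 2 (apply: measurable_funM => //); apply: mc.
  - by do 2 (apply: measurable_funM => //); apply: mc.
  - move=> n w; rewrite 2!normrM -[M * N]mulr1.
    by apply: ler_pM; rewrite ?mulr_ge0//; [apply: ler_pM|exact: trig_le1].
  - by apply: aeW => w; do 2 apply: cvgMl; exact: cg.
have e n : \int[P1]_w (g_ n (X w) * h (X w) * trig theta b (X w)) =
           \int[P2]_w (g_ n (Y w) * h (Y w) * trig theta b (Y w)).
  by have [_ hn] := hg_ n; have [_ ->] := hn h (conj bh eh).
have := lim _ _ P1 X mX; rewrite (eq_cvg _ _ e) => l1.
exact: (cvg_unique _ l1 (lim _ _ P2 Y mY)).
Qed.

(** The half-line is a limit of signs of slow sines (cvg_sin_sign), and the
    sign of a sine is a limit of polynomials in it (cvg_step_poly). *)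
Lemma multiplier_coord_lt (j : 'I_k) (a : R) :
  multiplier (fun v => (tnth v j < a)%R%:R).
Proof.
have msin (n : nat) : multiplier (fun v => sin ((tnth v j - a) / n.+1%:R)).
  (* A sine is a cosine shifted by pi / 2. *)
  have := multiplier_trig (fun i => (i == j)%:R / n.+1%:R) (- (a / n.+1%:R) - pi / 2).
  congr multiplier; apply/funext => v; rewrite /trig (bigD1 j)//= eqxx big1 => [|i ij]; last first.
    by rewrite (negbTE ij) !mul0r.
  by rewrite -cosBpihalf; congr (cos _); rewrite mulr1n; set N := _.+1%:R; ring.
pose x_ n v := 2^-1 * (1 + sin ((tnth v j - a) / n.+1%:R)).
have x01 n v : 0 <= x_ n v <= 1.
  rewrite /x_; have := sin_geN1 ((tnth v j - a) / n.+1%:R).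
  by have := sin_le1 ((tnth v j - a) / n.+1%:R); lra.
have mx n : multiplier (x_ n).
  have := multiplier_lin 2^-1 2^-1 (multiplier_cst 1) (msin n).
  by congr multiplier; apply/funext => v; rewrite /x_; ring.
apply: (@multiplier_lim (fun n v => (sin ((tnth v j - a) / n.+1%:R) < 0)%R%:R) _ 1).
- move=> n; apply: (@multiplier_lim (fun m v => step_poly m (x_ n v)) _ 1).
  + move=> m; rewrite /step_poly; apply: multiplierX; apply: multiplierC; exact: multiplierX.
  + move=> m v; have /andP[h0 h1] := step_poly_bound m (x01 n v).
    by rewrite ger0_norm.
  + move=> v; have := cvg_step_poly (x01 n v).
    suff -> : (x_ n v < 2^-1) = (sin ((tnth v j - a) / n.+1%:R) < 0) by [].
    by rewrite /x_; apply/idP/idP; lra.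
- by move=> n v; case: (_ < _)%R; rewrite ?normr1 ?normr0.
- move=> v; have := @cvg_sin_sign R (tnth v j - a).
  by rewrite subr_lt0.
Qed.

Definition multiplier_set (B : set V) := measurable B /\ multiplier (\1_B : V -> R).

(** Complements come from linearity; the complement of a finite union is a
    product, and a countable union is a bounded limit of finite ones. *)
Lemma multiplier_set_sigma_algebra : sigma_algebra setT multiplier_set.
Proof.
have mC B : multiplier_set B -> multiplier_set (~` B).
  move=> [mB hB]; split; first exact: measurableC.
  have := multiplierC hB; congr multiplier; apply/funext => v.
  by rewrite !indicE in_setC; case: (v \in B); rewrite ?subrr ?subr0.
split.
- split => //; have := multiplier_cst 0; congr multiplier; apply/funext => v.
  by rewrite indic0.
- by move=> B /mC; rewrite setTD.
- move=> B hB; split; first by apply: bigcup_measurable => n _; have [] := hB n.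
  pose g n v : R := \prod_(i < n) (1 - \1_(B i) v).
  have g01 n v : g n v = [forall i : 'I_n, v \notin B i]%:R.
    have [/forallP h|] := boolP [forall i : 'I_n, v \notin B i].
      by rewrite /g big1// => i _; rewrite indicE (negbTE (h i)) subr0.
    move=> /forallPn[ i]; rewrite negbK => hi.
    by rewrite /g (bigD1 i)//= indicE hi subrr mul0r.
  apply: (@multiplier_lim (fun n v => 1 - g n v) _ 1).
  + move=> n; apply: multiplierC; rewrite /g; elim: n => [|n IH].
      by under eq_fun do rewrite big_ord0; exact: multiplier_cst.
    under eq_fun do rewrite big_ord_recr/=; apply: multiplierM => //.
    by apply: multiplierC; have [] := hB n.
  + by move=> n v; rewrite g01; case: [forall _, _]; rewrite ?subrr ?subr0 ?normr0 ?normr1.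
  + move=> v; apply: cvg_near_cst.
    have [[m _ vm]|nv] := pselect ((\bigcup_n B n) v).
      exists m.+1 => // n /= mn; rewrite g01 indicE mem_set; last by exists m.
      have -> : [forall i : 'I_n, v \notin B i] = false.
        by apply/negbTE; apply/forallPn; exists (Ordinal mn); rewrite negbK mem_set.
      by rewrite subr0.
    apply: nearW => n; rewrite g01 indicE memNset//.
    have -> : [forall i : 'I_n, v \notin B i].
      by apply/forallP => i; rewrite memNset// => vi; apply: nv; exists i.
    by rewrite subrr.
Qed.

Lemma multiplier_coord (j : 'I_k) (B : set R) : measurable B ->
  multiplier_set ((fun v => tnth v j) @^-1` B).
Proof.
move=> mB.
pose G := [set B : set R | multiplier_set ((fun v => tnth v j) @^-1` B)].
have [s0 sD sU] := multiplier_set_sigma_algebra.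
have sG : sigma_algebra setT G.
  split => [|A|A hA]; rewrite /G/=.
  - by rewrite preimage_set0.
  - by move=> hA; have := sD _ hA; rewrite !setTD preimage_setC.
  - by rewrite preimage_bigcup; exact: sU.
have mB' : (@RGenInftyO.G R).-sigma.-measurable B by rewrite -RGenInftyO.measurableE.
have sub : <<s @RGenInftyO.G R >> `<=` G.
  apply: smallest_sub => // A [x ->]; rewrite /G/=; split.
    rewrite -[X in measurable X]setTI; exact: measurable_tnth.
  have := multiplier_coord_lt j x; congr multiplier; apply/funext => v.
  rewrite indicE; congr (nat_of_bool _)%:R; apply/idP/idP => h.
    by rewrite inE/= in_itv.
  by move: h; rewrite inE/= in_itv.
exact: sub.
Qed.

(** Every Borel set of tuples is a multiplier because the coordinate events
    are; multiplying the constant 1 by its indicator gives the equality of the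
    two measures. *)
Lemma same_law_of_chf : same_law P1 X P2 Y.
Proof.
move=> B mB.
have sub : g_sigma_preimage (fun (i : 'I_k) (v : V) => tnth v i) `<=` multiplier_set.
  apply: smallest_sub; first exact: multiplier_set_sigma_algebra.
  rewrite -bigcup_seq => A [ i _ [C mC <-]]; rewrite setTI; exact: multiplier_coord.
have [_ [_ hB]] := sub B mB.
have [_ e] := hB _ (same_transform_cst 1).
have := e (fun=> 0) 0.
have t1 v : trig (fun=> 0) 0 v = 1.
  by rewrite /trig add0r big1 ?cos0// => i _; rewrite mul0r.
under eq_Rintegral do rewrite t1 !mulr1.
under [in X in _ = X -> _]eq_Rintegral do rewrite t1 !mulr1.
have indicX d (T : measurableType d) (P : probability T R) (Z : T -> V) :
    measurable_fun setT Z -> (\int[P]_w (\1_B (Z w) : R))%:E = pushforward P Z B.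
  move=> mZ; rewrite /Rintegral.
  have mZB : measurable (Z @^-1` B) by rewrite -[X in measurable X]setTI; exact: mZ.
  have -> : (\int[P]_w (\1_B (Z w))%:E = \int[P]_w (\1_(Z @^-1` B) w)%:E)%E by [].
  rewrite integral_indic// setIT fineK//; exact: fin_num_measure.
by move=> h; rewrite -!indicX// h.
Qed.

End chf_uniqueness.

(** * Independent copies *)

Section iid_copies.
Context (R : realType).

(** A subfamily of events is completed by the sure event for the missing
    indices. *)
Lemma independent_of_product_rule d d' (T : measurableType d) (V : measurableType d')
    (P : probability T R) (I : finType) (Y : I -> T -> V) :
  (forall i, measurable_fun setT (Y i)) ->
  (forall D : I -> set V, (forall i, measurable (D i)) ->
    P (\bigcap_i (Y i @^-1` D i)) = (\prod_i P (Y i @^-1` D i))%E) ->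
  mutually_independent_rv P Y.
Proof.
move=> mY h J E hE.
have hD i : exists D, measurable D /\ (i \in J -> E i = Y i @^-1` D) /\ (i \notin J -> D = setT).
  have [iJ|iJ] := boolP (i \in J).
    by have [D mD <-] := hE _ iJ; exists D; split => //; split => //; rewrite setTI.
  by exists setT; split.
have /choice[D hD'] := hD.
have -> : \bigcap_(i in [set` J]) E i = \bigcap_i (Y i @^-1` D i).
  apply/seteqP; split => w /= hw i.
    have [iJ|iJ] := boolP (i \in J).
      by have [_ [<- // _]] := hD' i; move=> _; exact: hw.
    by have [_ [_ ->]] := hD' i.
  by move=> iJ; have [_ [-> // _]] := hD' i; exact: hw.
rewrite h; last by move=> i; have [] := hD' i.
rewrite (bigID (mem J))/= [X in (_ * X)%E]big1 ?mule1.
  by apply: eq_bigr => i iJ; have [_ [-> // _]] := hD' i.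
by move=> i iJ; have [_ [_ -> //]] := hD' i; rewrite preimage_setT probability_setT.
Qed.

(** Induction on n: the second factor of the product space carries the new
    copy. *)
Lemma exists_iid_copies d d' (T : measurableType d) (V : measurableType d')
    (P : probability T R) (X : T -> V) (n : nat) : measurable_fun setT X ->
  exists (d'' : measure_display) (T' : measurableType d'') (P' : probability T' R)
      (Y : 'I_n -> {RV P' >-> V}),
    mutually_independent_rv P' Y /\ forall i, same_law P' (Y i) P X.
Proof.
move=> mX.
suff [d'' [T' [P' [Y [h1 h2 h3]]]]] : exists (d'' : measure_display) (T' : measurableType d'')
    (P' : probability T' R) (Y : 'I_n -> T' -> V),
    [/\ forall i, measurable_fun setT (Y i),
        forall D : 'I_n -> set V, (forall i, measurable (D i)) ->
          P' (\bigcap_i (Y i @^-1` D i)) = (\prod_i P' (Y i @^-1` D i))%E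
      & forall i, same_law P' (Y i) P X].
  exists d'', T', P', (fun i => mfun_Sub (mem_set (h1 i))); split => //.
  exact: independent_of_product_rule.
elim: n => [|n [d1 [T1 [P1 [Y [mY iY lY]]]]]].
  exists d, T, P, (fun _ _ => point); split => [[]//|D _|[]//].
  by rewrite big_ord0 (_ : \bigcap_i _ = setT) ?probability_setT//; apply/seteqP; split => // w _ [].
pose P2 : probability (T1 * T)%type R := (P1 \x P)%E.
pose Y2 (i : 'I_n.+1) (w : T1 * T) : V := if unlift ord0 i is Some j then Y j w.1 else X w.2.
have Y20 D : Y2 ord0 @^-1` D = [set: T1] `*` (X @^-1` D).
  by rewrite /Y2 unlift_none; apply/seteqP; split => w //= [].
have Y2S j D : Y2 (lift ord0 j) @^-1` D = (Y j @^-1` D) `*` [set: T].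
  by rewrite /Y2 liftK; apply/seteqP; split => w //= [].
have pX D : measurable D -> measurable (X @^-1` D).
  by move=> mD; rewrite -[Y in measurable Y]setTI; exact: mX.
have pY j D : measurable D -> measurable (Y j @^-1` D).
  by move=> mD; rewrite -[Z in measurable Z]setTI; exact: mY.
have P2E A B : measurable A -> measurable B -> P2 (A `*` B) = (P1 A * P B)%E.
  by move=> mA mB; rewrite /P2/= product_measure1E.
have P20 D : measurable D -> P2 (Y2 ord0 @^-1` D) = P (X @^-1` D).
  move=> mD; rewrite Y20 P2E//; last exact: pX.
  by rewrite probability_setT mul1e.
have P2S j D : measurable D -> P2 (Y2 (lift ord0 j) @^-1` D) = P1 (Y j @^-1` D).
  move=> mD; rewrite Y2S P2E//; last exact: pY.
  by rewrite probability_setT mule1.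
exists _, (T1 * T)%type, P2, Y2; split.
- move=> i; case: (unliftP ord0 i) => [j ->|->].
    by rewrite /Y2 liftK; exact: measurableT_comp.
  by rewrite /Y2 unlift_none; exact: measurableT_comp.
- move=> D mD.
  have -> : \bigcap_i (Y2 i @^-1` D i) =
      (\bigcap_j (Y j @^-1` D (lift ord0 j))) `*` (X @^-1` D ord0).
    apply/seteqP; split => w /= h.
      split.
        by move=> j _; have := h (lift ord0 j) I; rewrite /Y2/= liftK.
      by have := h ord0 I; rewrite /Y2/= unlift_none.
    move=> i _; case: (unliftP ord0 i) => [j ->|->]; rewrite /Y2/= ?liftK ?unlift_none.
      by apply: h.1.
    exact: h.2.
  rewrite P2E//; last 2 first.
  - by apply: fin_bigcap_measurable => // j _; exact: pY.
  - exact: pX.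
  rewrite iY// big_ord_recl P20// muleC; congr (_ * _)%E.
  by apply: eq_bigr => j _; rewrite P2S.
- move=> i B mB; case: (unliftP ord0 i) => [j ->|->].
    by rewrite /pushforward P2S//; exact: lY.
  by rewrite /pushforward P20.
Qed.

End iid_copies.

(** * The exponent of a centered square integrable law *)

Section exponent.
Context {R : realType}.
Implicit Types (mu : {measure set R -> \bar R}) (theta : R).

Definition exponent_re mu theta : R := \int[mu]_x (1 - cos (theta * x)).
(** The compensator is theta x on the whole line, large jumps included, as
    befits a centered law. *)
Definition exponent_im mu theta : R := \int[mu]_x (theta * x - sin (theta * x)).

Definition exponent mu theta : R[i] := exponent_re mu theta +i* exponent_im mu theta.

Definition second_moment mu : R := \int[mu]_x (x ^+ 2).

Lemma measurable_one_sub_cos theta : measurable_fun setT (fun x : R => 1 - cos (theta * x)).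
Proof.
apply: measurable_funB => //; apply: measurable_cos; exact: measurable_funM.
Qed.

Lemma measurable_sub_sin theta : measurable_fun setT (fun x : R => theta * x - sin (theta * x)).
Proof.
apply: measurable_funB; first exact: measurable_funM.
by apply: measurable_sin; exact: measurable_funM.
Qed.

Lemma rintegrable_le d (T : measurableType d) (mu : {measure set T -> \bar R}) (f g : T -> R) :
  measurable_fun setT f -> (forall x, `|f x| <= g x) -> rintegrable mu g -> rintegrable mu f.
Proof.
move=> mf fg; apply: le_integrable => //; first exact/measurable_EFinP.
by move=> x _ /=; rewrite lee_fin (le_trans (fg x))// ler_norm.
Qed.

Section square_integrable.
Variable mu : {measure set R -> \bar R}.
Hypothesis mu2 : rintegrable mu (fun x => x ^+ 2).

Let scale c : rintegrable mu (fun x => c * x ^+ 2).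
Proof. exact: (rintegrableZl c mu2). Qed.

Lemma second_moment_ge0 : 0 <= second_moment mu.
Proof. by apply: Rintegral_ge0 => x _; exact: sqr_ge0. Qed.

Lemma integrable_one_sub_cos theta : rintegrable mu (fun x => 1 - cos (theta * x)).
Proof.
apply: (rintegrable_le (measurable_one_sub_cos theta) _ (scale (theta ^+ 2 / 2))) => x.
rewrite ger0_norm ?one_sub_cos_ge0// (le_trans (one_sub_cos_le_sqr _))//.
by rewrite exprMn mulrAC.
Qed.

Lemma integrable_sub_sin theta : rintegrable mu (fun x => theta * x - sin (theta * x)).
Proof.
apply: (rintegrable_le (measurable_sub_sin theta) _ (scale (theta ^+ 2))) => x.
have := sub_sin_lip (theta * x) 0; rewrite sin0 !subr0 normr0 addr0 => h.
by rewrite (le_trans h)// -expr2 real_normK ?num_real// exprMn.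
Qed.

Let lip (k : R -> R) :
  (forall theta, rintegrable mu (fun x => k (theta * x))) ->
  (forall x y, `|k x - k y| <= `|x - y| * (`|x| + `|y|)) ->
  forall a b, `|\int[mu]_x k (a * x) - \int[mu]_x k (b * x)| <=
    second_moment mu * (`|a - b| * (`|a| + `|b|)).
Proof.
move=> ik kl a b; rewrite -RintegralB//.
have iB : rintegrable mu (fun x => k (a * x) - k (b * x)).
  exact: (rintegrableB (ik a) (ik b)).
rewrite (le_trans (le_normr_Rintegral _ iB))// mulrC -RintegralZl//.
apply: le_Rintegral => // [|x _]; first exact: integrable_norm.
rewrite (le_trans (kl _ _))// -mulrBl 3!normrM -mulrDl mulrACA.
by rewrite -expr2 real_normK ?num_real.
Qed.

Lemma exponent_re_lip a b : `|exponent_re mu a - exponent_re mu b| <=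
  second_moment mu * (`|a - b| * (`|a| + `|b|)).
Proof.
apply: (@lip (fun x => 1 - cos x)); last exact: one_sub_cos_lip.
exact: integrable_one_sub_cos.
Qed.

Lemma exponent_im_lip a b : `|exponent_im mu a - exponent_im mu b| <=
  second_moment mu * (`|a - b| * (`|a| + `|b|)).
Proof.
apply: (@lip (fun x => x - sin x)); last exact: sub_sin_lip.
exact: integrable_sub_sin.
Qed.

Lemma exponent_re0 : exponent_re mu 0 = 0.
Proof.
rewrite /exponent_re; under eq_Rintegral do rewrite mul0r cos0 subrr.
by rewrite Rintegral_cst// mul0r.
Qed.

Lemma exponent_im0 : exponent_im mu 0 = 0.
Proof.
rewrite /exponent_im; under eq_Rintegral do rewrite mul0r sin0 subrr.
by rewrite Rintegral_cst// mul0r.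
Qed.

Lemma exponent_re_ge0 theta : 0 <= exponent_re mu theta.
Proof. by apply: Rintegral_ge0 => x _; exact: one_sub_cos_ge0. Qed.

Lemma exponent_re_le theta : exponent_re mu theta <= second_moment mu * (theta ^+ 2 / 2).
Proof.
rewrite mulrC -RintegralZl//.
apply: (le_Rintegral measurableT (integrable_one_sub_cos theta) (scale _)) => x _.
by rewrite (le_trans (one_sub_cos_le_sqr _))// exprMn mulrAC.
Qed.

End square_integrable.

End exponent.

Section triplet.
Context d (T : measurableType d) (R : realType) (P : probability T R).
Variables (X : {RV P >-> R}) (b : R) (mu : {measure set R -> \bar R}).
Hypotheses (X_centered : ('E_P[(X : T -> R)] = 0)%E)
  (X_sqr : ('E_P[(fun w => X w ^+ 2)%R] < +oo)%E)
  (X_triplet : levy_triplet P X b 0 mu).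

Let m : R := \int[P]_w (X w ^+ 2).

Let mX : measurable_fun setT X. Proof. exact: measurable_funP. Qed.

Let mX2 : measurable_fun setT (fun w => X w ^+ 2).
Proof. exact: measurable_funX. Qed.

Let iX2 : rintegrable P (fun w => X w ^+ 2).
Proof.
apply/integrableP; split; first exact/measurable_EFinP.
move: X_sqr; rewrite unlock; congr (_ < _)%E; apply: eq_integral => w _ /=.
by rewrite ger0_norm// sqr_ge0.
Qed.

Let m0 : 0 <= m. Proof. by apply: Rintegral_ge0 => w _; exact: sqr_ge0. Qed.

Let iX : rintegrable P X.
Proof.
have i1 : rintegrable P (fun w => 1 + X w ^+ 2).
  apply: (@integrableD _ _ _ _ _ measurableT (EFin \o cst 1) _ _ iX2).
  by apply: (@integrable_bounded _ _ _ _ _ 1) => // w; rewrite normr1.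
apply: (rintegrable_le mX _ i1) => w.
rewrite -(real_normK (num_real (X w))).
have := sqr_ge0 (`|X w| - 1); have := normr_ge0 (X w); nra.
Qed.

Let EX : \int[P]_w X w = 0.
Proof. by move: X_centered; rewrite unlock /Rintegral => ->. Qed.

Let imin : rintegrable mu (fun x => Num.min 1 (x ^+ 2)).
Proof.
have [_ [_ fin] _] := X_triplet.
apply/integrableP; split.
  by apply/measurable_EFinP; apply: measurable_minr => //; exact: measurable_funX.
move: fin; congr (_ < _)%E; apply: eq_integral => x _ /=.
by rewrite ger0_norm// le_min ler01 sqr_ge0.
Qed.

Let icos theta : rintegrable mu (fun x => 1 - cos (theta * x)).
Proof.
have i2 : rintegrable mu (fun x => (2 + theta ^+ 2) * Num.min 1 (x ^+ 2)).
  exact: (rintegrableZl _ imin).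
apply: (rintegrable_le (measurable_one_sub_cos theta) _ i2) => x.
rewrite ger0_norm ?one_sub_cos_ge0//.
have h1 := one_sub_cos_le_sqr (theta * x); have h2 := one_sub_cos_le2 (theta * x).
have h3 := sqr_ge0 theta; have h4 := sqr_ge0 x.
move: h1; rewrite exprMn minEle; case: ifP => h5; nra.
Qed.

Let rho theta : R := exponent_re mu theta.

Let Re_eta theta : complex.Re (levy_khintchine_exponent b 0 mu theta) = rho theta.
Proof.
rewrite /levy_khintchine_exponent raddfD/= /rho /exponent_re.
rewrite !(mul0r, mulr0, oppr0, subr0, add0r, addr0).
by apply: eq_Rintegral => x _; rewrite /= !(mul0r, mulr0, oppr0, subr0, add0r, addr0).
Qed.

Let chfX theta : chf P (fun w => theta * X w) =
  cexp (- levy_khintchine_exponent b 0 mu theta).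
Proof. by have [_ _ h] := X_triplet; exact: h. Qed.

Let Re_chf_ge theta : 1 - theta ^+ 2 * m / 2 <= complex.Re (chf P (fun w => theta * X w)).
Proof.
have mth : measurable_fun setT (fun w => theta * X w) by exact: measurable_funM.
have : \int[P]_w (1 - cos (theta * X w)) <= theta ^+ 2 / 2 * m.
  rewrite -RintegralZl//; apply: le_Rintegral => // [||w _].
  - exact: integrable_one_sub_cos_law.
  - exact: (rintegrableZl _ iX2).
  - by rewrite (le_trans (one_sub_cos_le_sqr _))// exprMn mulrAC.
rewrite Rintegral_one_sub_cos//; lra.
Qed.

Let ReN (z : R[i]) : complex.Re (- z) = - complex.Re z. Proof. by case: z. Qed.
Let ImN (z : R[i]) : complex.Im (- z) = - complex.Im z. Proof. by case: z. Qed.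

(** The inequality 1 - theta^2 m / 2 <= exp (- rho theta) is inverted near the
    origin, at the price of a factor 2. *)
Let rho_le theta : theta ^+ 2 * m <= 1 -> rho theta <= theta ^+ 2 * m.
Proof.
move=> h; have s0 : 0 <= theta ^+ 2 * m by rewrite mulr_ge0 ?sqr_ge0.
have := Re_chf_ge theta; rewrite chfX Re_cexp ReN Re_eta => h1.
have h2 : 1 - theta ^+ 2 * m / 2 <= expR (- rho theta).
  by apply: le_trans h1 _; rewrite ler_piMr ?expR_ge0// cos_le1.
rewrite leNgt; apply/negP => h3.
have : expR (- rho theta) < expR (- (theta ^+ 2 * m)) by rewrite ltr_expR ltrN2.
rewrite [X in _ < X]expRN => h4.
have h5 := expR_ge1Dx (theta ^+ 2 * m).
have h6 : (expR (theta ^+ 2 * m))^-1 <= (1 + theta ^+ 2 * m)^-1.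
  by rewrite lef_pV2 ?posrE ?expR_gt0// ltr_pwDl.
have h7 : 1 - theta ^+ 2 * m / 2 < (1 + theta ^+ 2 * m)^-1.
  exact: le_lt_trans h2 (lt_le_trans h4 h6).
move: h7; rewrite ltNge => /negP; apply.
rewrite -[X in X <= _]mul1r ler_pdivrMr ?ltr_pwDl//; nra.
Qed.

Let e : R := (1 + m)^-1.
Let e0 : 0 < e. Proof. by rewrite invr_gt0 ltr_pwDl. Qed.
Let e1 : e <= 1. Proof. by rewrite invf_le1 ?ltr_pwDl// lerDl. Qed.
Let em : e * m <= 1. Proof. by rewrite mulrC ler_pdivrMr ?ltr_pwDl// mul1r lerDr. Qed.

Let small x : 0 < x <= e -> x ^+ 2 * m <= 1.
Proof.
move=> /andP[x0 xe]; apply: le_trans em; rewrite ler_wpM2r//.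
rewrite expr2 (@le_trans _ _ (x * 1))//; last by rewrite mulr1.
by rewrite ler_wpM2l ?(ltW x0)// (le_trans xe).
Qed.

(** The real part of the exponent is of the order of theta^2 at the origin
    because the law has a second moment, and Fatou's lemma turns this into a
    second moment of the Levy measure. *)
Lemma levy_measure_square_integrable : rintegrable mu (fun x => x ^+ 2).
Proof.
have mx2 : measurable_fun setT (fun x : R => x ^+ 2) by exact: measurable_funX.
apply/integrableP; split; first exact/measurable_EFinP.
have : (\int[mu]_x (x ^+ 2)%:E <= (2 * m)%:E)%E.
  apply: (@integral_sqr_le_of_cos _ _ _ mu id _ e) => // x xe.
  have -> : (\int[mu]_w (1 - cos (x * id w))%:E = (rho x)%:E)%E.
    by rewrite /rho /exponent_re /Rintegral fineK//; exact: integrable_fin_num (icos x).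
  rewrite lee_fin (_ : x ^+ 2 * (2 * m) / 2 = x ^+ 2 * m); last by field.
  by apply: rho_le; exact: small.
move=> h; apply: le_lt_trans (ltry (2 * m)); apply: le_trans h.
rewrite le_eqVlt; apply/orP; left; apply/eqP; apply: eq_integral => x _ /=.
by rewrite ger0_norm// sqr_ge0.
Qed.

Let mu2 := levy_measure_square_integrable.
Let V := second_moment mu.

(** The jumps left out by the truncated compensator. *)
Let big x : R := if `|x| <= 1 then 0 else x.

Let mbig : measurable_fun setT big.
Proof.
by apply: measurable_fun_ifT => //; apply: measurable_fun_ler.
Qed.

Let ibig : rintegrable mu big.
Proof.
apply: (rintegrable_le mbig _ mu2) => x; rewrite /big.
case: ifPn => [_|]; first by rewrite normr0 sqr_ge0.
by rewrite -ltNge => h; rewrite -real_normK ?num_real// expr2 ler_peMr// ltW.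
Qed.

Let drift : R := b + \int[mu]_x big x.

Let Im_eta theta : complex.Im (levy_khintchine_exponent b 0 mu theta) =
  - (drift * theta) + exponent_im mu theta.
Proof.
have -> : exponent_im mu theta =
    \int[mu]_x (- sin (theta * x) + (if `|x| <= 1 then theta * x else 0)) +
    theta * \int[mu]_x big x.
  rewrite -RintegralZl// -RintegralD//.
  - apply: eq_Rintegral => x _; rewrite /big; case: ifP => _; ring.
  - have := rintegrableB (integrable_sub_sin mu2 theta)
      (rintegrableZl theta ibig).
    congr (_.-integrable _ _); apply/funext => x /=; congr (_%:E).
    by rewrite /big; case: ifP => _; ring.
  - exact: (rintegrableZl theta ibig).
rewrite /levy_khintchine_exponent raddfD/=.
have -> : \int[mu]_x complex.Im (1 - expi (theta * x) +
    'i * (if `|x| <= 1 then theta * x else 0)%:C) =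
    \int[mu]_x (- sin (theta * x) + (if `|x| <= 1 then theta * x else 0)).
  apply: eq_Rintegral => x _ /=.
  by rewrite !(mul0r, mulr0, oppr0, subr0, add0r, addr0, mul1r, sub0r).
rewrite !(mul0r, mulr0, oppr0, subr0, add0r, addr0, mul1r, sub0r, mulN1r) /drift; ring.
Qed.

Let Im_chf_le theta : `|complex.Im (chf P (fun w => theta * X w))| <= theta ^+ 2 * m.
Proof.
have isinX : rintegrable P (fun w => sin (theta * X w)).
  apply: (@integrable_bounded _ _ _ _ _ 1) => [|w]; last exact: sin_max.
  by apply: measurable_sin; exact: measurable_funM.
have ithX := rintegrableZl theta iX.
have -> : complex.Im (chf P (fun w => theta * X w)) =
    - \int[P]_w (theta * X w - sin (theta * X w)).
  by rewrite RintegralB// RintegralZl// EX mulr0 sub0r opprK.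
have iB := rintegrableB ithX isinX.
rewrite normrN (le_trans (le_normr_Rintegral _ iB))// -RintegralZl//.
apply: le_Rintegral => // [||w _].
- exact: (@integrable_norm _ _ _ _ _ (fun w => theta * X w - sin (theta * X w)) iB).
- exact: (rintegrableZl _ iX2).
- have := sub_sin_lip (theta * X w) 0; rewrite sin0 !subr0 normr0 addr0 => h.
  by rewrite (le_trans h)// -expr2 real_normK ?num_real// exprMn.
Qed.

(** The law is centered, so that the imaginary part of its characteristic
    function is of the order of theta^2 at the origin; so is the integral part
    of the exponent, and no linear term can remain. *)
Let drift0 : drift = 0.
Proof.
(* For 0 < x <= e the number z = drift x - exponent_im x satisfies sin z =
   O(x^2) and z = O(x), hence z = O(x^2), with K collecting the constants. *)
pose K := V + expR 1 * m + (`|drift| + V) ^+ 2.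
have V0 : 0 <= V by exact: second_moment_ge0.
have bound x : 0 < x <= e -> `|drift| <= K * x.
  move=> xe; have /andP[x0 xe'] := xe.
  have x1 : x <= 1 by rewrite (le_trans xe').
  have imle : `|exponent_im mu x| <= V * x ^+ 2.
    have := exponent_im_lip mu2 x 0; rewrite exponent_im0 !subr0 normr0 addr0.
    by rewrite -expr2 real_normK ?num_real.
  have rle : rho x <= 1 by rewrite (le_trans (rho_le (small xe)))// small.
  pose z := drift * x - exponent_im mu x.
  have Ez : complex.Im (chf P (fun w => x * X w)) = expR (- rho x) * sin z.
    by rewrite chfX Im_cexp ReN ImN Re_eta Im_eta /z opprD opprK.
  have sz : `|sin z| <= expR 1 * m * x ^+ 2.
    have := Im_chf_le x; rewrite Ez normrM ger0_norm ?expR_ge0// expRN => h.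
    have : `|sin z| <= expR (rho x) * (x ^+ 2 * m).
      by rewrite -ler_pdivrMl ?expR_gt0.
    move=> /le_trans; apply; rewrite -mulrA [m * _]mulrC ler_wpM2r//.
      by rewrite mulr_ge0// sqr_ge0.
    by rewrite ler_expR.
  have z2 : `|z| <= `|sin z| + `|z| ^+ 2.
    have := sub_sin_lip z 0; rewrite sin0 !subr0 normr0 addr0 -expr2 => h.
    have := ler_normD (z - sin z) (sin z); rewrite subrK => h'.
    by rewrite (le_trans h')// addrC lerD2l.
  have zx : `|z| <= (`|drift| + V) * x.
    rewrite /z (le_trans (ler_normB _ _))// normrM (gtr0_norm x0) mulrDl lerD2l.
    by rewrite (le_trans imle)// ler_wpM2l// expr2 ler_piMr// ltW.
  have zx2 : `|z| ^+ 2 <= ((`|drift| + V) * x) ^+ 2.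
    have p0 : 0 <= (`|drift| + V) * x by rewrite mulr_ge0 ?addr_ge0// ltW.
    by rewrite ler_sqr ?nnegrE.
  have dx : `|drift| * x <= `|z| + `|exponent_im mu x|.
    have -> : `|drift| * x = `|drift * x| by rewrite normrM (gtr0_norm x0).
    by have := ler_normD z (exponent_im mu x); rewrite /z subrK.
  have : `|drift| * x <= K * x * x.
    rewrite (le_trans dx)// /K.
    move: zx2; rewrite exprMn => zx2.
    have -> : (V + expR 1 * m + (`|drift| + V) ^+ 2) * x * x =
      V * x ^+ 2 + expR 1 * m * x ^+ 2 + (`|drift| + V) ^+ 2 * x ^+ 2 by ring.
    move: imle sz z2 zx2; lra.
  by rewrite ler_pM2r.
have K0 : 0 <= K.
  by apply: addr_ge0; [apply: addr_ge0 => //; apply: mulr_ge0 => //; exact: expR_ge0|exact: sqr_ge0].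
apply/eqP; rewrite -normr_eq0; apply/negP => /negP dn.
have d0 : 0 < `|drift| by rewrite lt_neqAle eq_sym dn normr_ge0.
pose x := Num.min e (`|drift| / (2 * (K + 1))).
have K1 : 0 < 2 * (K + 1) by rewrite mulr_gt0// ltr_wpDl.
have xe : 0 < x <= e by rewrite /x lt_min e0 divr_gt0//= ge_min lexx.
have := bound _ xe.
have : x <= `|drift| / (2 * (K + 1)) by rewrite /x ge_min lexx orbT.
rewrite ler_pdivlMr// => h1 h2.
have : 0 < x by case/andP: xe.
nra.
Qed.

Lemma chf_exponent theta : chf P (fun w => theta * X w) = cexp (- exponent mu theta).
Proof.
rewrite chfX; congr (cexp (- _)); apply: complex_ext; first exact: Re_eta.
by rewrite Im_eta drift0 mul0r oppr0 add0r.
Qed.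

End triplet.

(** * Continuity of exponents *)

Lemma continuous_of_sequences (R : realType) (f : R -> R) :
  (forall (u : nat -> R) x, u n @[n --> \oo] --> x -> f (u n) @[n --> \oo] --> f x) ->
  continuous f.
Proof.
move=> h x; apply/continuous_withinNx; apply/cvgr_dnbhsP => u [_ ux].
exact: h.
Qed.

(** The quotient of the two functions is continuous, takes only the values 1
    and -1, and is 1 at the origin. *)
Lemma continuous_square_root_unique (R : realType) (g : R -> R[i]) (z : R -> R[i]) :
  continuous (fun x => complex.Re (g x)) -> continuous (fun x => complex.Im (g x)) ->
  continuous (fun x => complex.Re (z x)) -> continuous (fun x => complex.Im (z x)) ->
  g 0 = 1 -> z 0 = 0 ->
  (forall x, g x ^+ 2 = cexp (- z x) ^+ 2) -> forall x, g x = cexp (- z x).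
Proof.
move=> cg1 cg2 cz1 cz2 g0 z0 sq x.
pose u y := g y * cexp (z y).
have cexpN y : cexp (- z y) * cexp (z y) = 1 by rewrite -cexpD addNr cexp0.
have u2 y : u y ^+ 2 = 1 by rewrite /u exprMn sq -exprMn cexpN expr1n.
have cu : continuous (fun y => complex.Re (u y)).
  have -> : (fun y => complex.Re (u y)) = (fun y =>
     complex.Re (g y) * (expR (complex.Re (z y)) * cos (complex.Im (z y))) -
     complex.Im (g y) * (expR (complex.Re (z y)) * sin (complex.Im (z y)))).
    by apply/funext => y; rewrite complex_ReM Re_cexp Im_cexp.
  move=> y; apply: cvgB; apply: cvgM; [exact: cg1| |exact: cg2|]; apply: cvgM.
  - exact: (cvg_comp _ _ (cz1 y) (@continuous_expR R _)).
  - exact: (cvg_comp _ _ (cz2 y) (@continuous_cos R _)).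
  - exact: (cvg_comp _ _ (cz1 y) (@continuous_expR R _)).
  - exact: (cvg_comp _ _ (cz2 y) (@continuous_sin R _)).
have upm y : u y = 1 \/ u y = -1.
  have /eqP := u2 y; rewrite sqrf_eq1 => /orP[]/eqP; by [left|right].
suff ux : u x = 1 by rewrite -[g x]mulr1 -(cexpN x) mulrCA -/(u x) ux mulr1.
have u0 : u 0 = 1 by rewrite /u g0 z0 cexp0 mulr1.
have [//|un] := upm x.
(* By the intermediate value theorem the real part of u would vanish between
   two points where u takes opposite signs. *)
have key a b : a <= b -> complex.Re (u a) * complex.Re (u b) = -1 -> False.
  move=> ab e.
  have [] := @IVT R (fun y => complex.Re (u y)) a b 0 ab.
  - by apply: continuous_subspaceT => y; exact: cu.
  - have [ua|ua] := upm a; have [ub|ub] := upm b; move: e; rewrite ua ub/= => e.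
    + by move: e; rewrite mulr1; lra.
    + by rewrite ge_min le_max lerN10 ler01 orbT.
    + by rewrite ge_min le_max lerN10 ler01 orbT.
    + by move: e; rewrite mulrNN mulr1; lra.
  - move=> c _; have [->|->] /= := upm c; lra.
have [x0|x0] := leP 0 x.
  by have := key _ _ x0; rewrite u0 un/= mul1r => /(_ erefl).
by have := key _ _ (ltW x0); rewrite u0 un/= mulr1 => /(_ erefl).
Qed.

Lemma continuous_chf d (T : measurableType d) (R : realType) (P : probability T R) (X : T -> R) :
  measurable_fun setT X ->
  continuous (fun x : R => complex.Re (chf P (fun w => x * X w))) /\
  continuous (fun x : R => complex.Im (chf P (fun w => x * X w))).
Proof.
move=> mX.
have h (u : nat -> R) (x : R) : u n @[n --> \oo] --> x ->
    ccvg (fun n => chf P (fun w => u n * X w)) (chf P (fun w => x * X w)).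
  move=> ux; apply: cvg_chf_ae => [n||].
  - exact: measurable_funM.
  - exact: measurable_funM.
  - by apply: aeW => w; apply: cvgMl.
by split; apply: continuous_of_sequences => u x /h[].
Qed.

Lemma cvg_of_norm_le (R : realType) (f g : nat -> R) (l : R) :
  (forall n, `|f n - l| <= g n) -> g n @[n --> \oo] --> (0 : R) ->
  f n @[n --> \oo] --> l.
Proof.
move=> fg /cvgrPdist_le g0; apply/cvgrPdist_le => e /g0; apply: filterS => n.
rewrite sub0r normrN distrC => h.
exact: le_trans (fg n) (le_trans (ler_norm _) h).
Qed.

Section quadratic_lipschitz.
Context {R : realType}.

(** The modulus of continuity that makes the integral of k o g depend
    continuously on g in L2. *)
Definition quad_lip (V : R) (k : R -> R) :=
  k 0 = 0 /\ forall a b, `|k a - k b| <= V * (`|a - b| * (`|a| + `|b|)).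

Lemma quad_lip_sqr V k a : quad_lip V k -> `|k a| <= V * a ^+ 2.
Proof.
move=> [k0 kl]; have := kl a 0; rewrite k0 !subr0 normr0 addr0 -expr2.
by rewrite real_normK ?num_real.
Qed.

Lemma quad_lip_continuous V k : quad_lip V k -> continuous k.
Proof.
move=> [k0 kl]; apply: continuous_of_sequences => u x ux.
apply: (cvg_of_norm_le (fun n => kl (u n) x)).
have h : V * (`|u n - x| * (`|u n| + `|x|)) @[n --> \oo] -->
    V * (`|x - x| * (`|x| + `|x|)).
  apply: cvgMr; apply: cvgM.
    by apply: cvg_norm; apply: cvgB => //; exact: cvg_cst.
  by apply: cvgD; [exact: cvg_norm|exact: cvg_cst].
by move: h; rewrite subrr normr0 mul0r mulr0.
Qed.

End quadratic_lipschitz.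

(** * Levy processes on a dyadic grid *)

Section levy.
Context d (T : measurableType d) (R : realType) (P : probability T R).
Variable X : R -> {RV P >-> R}.
Hypothesis levyX : levy_process P X.

Let mX t : measurable_fun setT (X t). Proof. exact: measurable_funP. Qed.

Lemma chf_cst0 : chf P (fun=> 0) = 1.
Proof.
by apply: complex_ext; rewrite /chf/= ?cos0 ?sin0 Rintegral_prob_cst.
Qed.

Lemma chf_grid_increments (h : R) (N : nat) (c : 'I_N -> R) : 0 <= h ->
  chf P (fun w => \sum_i c i * (X (i.+1%:R * h) w - X (i%:R * h) w)) =
  \prod_i chf P (fun w => c i * X h w).
Proof.
move=> h0; have [_ inc stat _] := levyX.
have := inc N (fun i => i%:R * h); rewrite mul0r => /(_ (lexx _)) indep.
have {}indep := indep _.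
rewrite (chf_independent (X := fun (i : 'I_N) w => X (i.+1%:R * h) w - X (i%:R * h) w)).
- apply: eq_bigr => i _; apply: chf_same_law => //.
    exact: measurable_funB.
  have -> : i.+1%:R * h = i%:R * h + h by rewrite -natr1 mulrDl mul1r.
  by apply: stat => //; rewrite mulr_ge0.
- by move=> i; exact: measurable_funB.
- by apply: indep => i j ij; rewrite ler_wpM2r// ler_nat.
Qed.

Section dyadic.
Variables (V : R) (kr ki : R -> R).
Hypotheses (krl : quad_lip V kr) (kil : quad_lip V ki).
Hypothesis chf1 : forall theta, chf P (fun w => theta * X 1 w) =
  cexp (- (kr theta +i* ki theta)).

(** Halving the time step takes a square root of the characteristic function,
    and continuity in theta selects the branch. *)
Lemma chf_dyadic n theta : chf P (fun w => theta * X (2 ^- n) w) =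
  cexp (- ((2 ^- n * kr theta) +i* (2 ^- n * ki theta))).
Proof.
elim: n theta => [|n IH] theta; first by rewrite expr0 invr1 !mul1r.
set h : R := 2 ^- n.+1.
have h0 : 0 <= h by rewrite invr_ge0 exprn_ge0.
have hh : 2 ^- n = h + h :> R.
  by rewrite /h exprS invfM; lra.
have sq x : chf P (fun w => x * X h w) ^+ 2 = chf P (fun w => x * X (2 ^- n) w).
  have := chf_grid_increments (fun _ : 'I_2 => x) h0.
  rewrite prodr_const card_ord => <-; apply: chf_ae_eq.
  - by apply: measurable_sum => i; apply: measurable_funM => //; exact: measurable_funB.
  - exact: measurable_funM.
  - have [X0 _ _ _] := levyX; apply: filterS X0 => w X0.
    rewrite big_ord_recl big_ord1 /= /bump/= add1n mul0r X0 !mul1r hh.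
    by rewrite (_ : 2%:R * h = h + h) ?mulr2n ?mulrDl ?mul1r//; ring.
have [c1 c2] := continuous_chf P (mX h).
have ckr := quad_lip_continuous krl; have cki := quad_lip_continuous kil.
apply: (@continuous_square_root_unique _ (fun x => chf P (fun w => x * X h w))
  (fun x => (h * kr x) +i* (h * ki x))) => //.
- by move=> x; apply: cvgMr; exact: ckr.
- by move=> x; apply: cvgMr; exact: cki.
- by rewrite -[RHS]chf_cst0; congr (chf P _); apply/funext => w; rewrite mul0r.
- by rewrite krl.1 kil.1 mulr0.
- move=> x; rewrite sq IH hh expr2 -cexpD; congr cexp.
  by apply: complex_ext => /=; ring.
Qed.

End dyadic.

Lemma measurable_min1 d' (T' : measurableType d') (f : T' -> R) :
  measurable_fun setT f -> measurable_fun setT (fun x => Num.min 1 `|f x|).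
Proof. by move=> mf; apply: measurable_minr => //; exact: measurableT_comp. Qed.

Lemma min1_le1 (x : R) : `|Num.min 1 (`|x|)| <= 1.
Proof. by rewrite ger0_norm ?le_min ?ler01 ?normr_ge0//= ge_min lexx. Qed.

Lemma cvg_min1 (u : nat -> R) (l : R) : u n @[n --> \oo] --> l ->
  Num.min 1 `|u n| @[n --> \oo] --> (Num.min 1 `|l| : R).
Proof.
move=> ul; apply: (@cvg_of_norm_le _ _ (fun n => `|u n - l|)).
  move=> n; have := ler_dist_dist (u n) l; move: `|u n - l| => e.
  by rewrite !ler_norml !minEle => /andP[h1 h2]; do 2 case: ifPn; rewrite -?ltNge => h3 h4; lra.
rewrite -[X in _ --> X](@normr0 _ R) -[X in `|X|](subrr l).
by apply: cvg_norm; apply: cvgB => //; exact: cvg_cst.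
Qed.

(** The increment over [s - e, s] has the law of X e, which tends to 0 in
    probability with e, as measured by the expectation of min 1 |X e|: a Levy
    process has no fixed time of discontinuity. *)
Lemma left_limit_ae_eq (s : R) (Y : T -> R) : 0 < s -> measurable_fun setT Y ->
  (forall w, Y w = left_limit (fun t => X t w) s) -> {ae P, forall w, Y w = X s w}.
Proof.
move=> s0 mY YE; have [X0 inc stat cad] := levyX.
pose e n : R := s / n.+1%:R.
have e0 n : 0 < e n by rewrite divr_gt0.
have es n : e n <= s by rewrite ler_pdivrMr// ler_peMr ?(ltW s0)// ler1n.
have cve : e n @[n --> \oo] --> (0 : R).
  rewrite -[X in _ --> X](mulr0 s); apply: cvgMr; exact: cvg_harmonic.
have cv1 : \int[P]_w Num.min 1 `|X s w - X (s - e n) w| @[n --> \oo] -->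
    \int[P]_w Num.min 1 `|X s w - Y w|.
  apply: (@cvg_Rintegral_bounded _ _ _ _ _ _ 1).
  - by move=> n; apply: measurable_min1; exact: measurable_funB.
  - by apply: measurable_min1; exact: measurable_funB.
  - by move=> n w; exact: min1_le1.
  - apply: filterS cad => w [_ /(_ s s0) cl].
    apply: cvg_min1.
    apply: cvgB; first exact: cvg_cst.
    rewrite YE; have /cvg_at_leftP := cl; apply; split.
      by move=> n; rewrite ltrBlDr ltrDl.
    by rewrite -[X in _ --> X]subr0; apply: cvgB => //; exact: cvg_cst.
have cv2 : \int[P]_w Num.min 1 `|X (e n) w| @[n --> \oo] --> \int[P]_w Num.min 1 `|(0 : R)|.
  apply: (@cvg_Rintegral_bounded _ _ _ _ _ _ 1).
  - by move=> n; apply: measurable_min1.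
  - by [].
  - by move=> n w; exact: min1_le1.
  - apply: filterS2 cad X0 => w [/(_ 0 (lexx _)) cr _] X0.
    apply: cvg_min1.
    by have /cvg_at_rightP := cr; rewrite X0; apply; split.
have e12 n : \int[P]_w Num.min 1 `|X s w - X (s - e n) w| =
    \int[P]_w Num.min 1 `|X (e n) w|.
  apply: (@same_law_Rintegral _ _ _ _ _ _ _ P P (fun w => X s w - X (s - e n) w) (X (e n))
    (fun x => Num.min 1 `|x|) 1) => //.
  - exact: measurable_funB.
  - by apply: measurable_min1.
  - exact: min1_le1.
  - have := stat (s - e n) (e n); rewrite subrK; apply; last exact: ltW.
    by rewrite subr_ge0.
move: cv1; rewrite (eq_cvg _ _ e12) => cv1.
have E0 : \int[P]_w Num.min 1 `|X s w - Y w| = 0.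
  transitivity (\int[P]_w Num.min 1 `|(0 : R)|); first exact: (cvg_unique _ cv1 cv2).
  by rewrite normr0 (min_idPr _) ?ler01// Rintegral_prob_cst.
have mm : measurable_fun setT (fun w => Num.min 1 `|X s w - Y w|).
  by apply: measurable_min1; exact: measurable_funB.
have im : rintegrable P (fun w => Num.min 1 `|X s w - Y w|).
  by apply: (integrable_bounded P mm) => w; exact: min1_le1.
have u0 w : 0 <= Num.min 1 `|X s w - Y w| by rewrite le_min ler01 normr_ge0.
apply: filterS (Rintegral_eq0_ae im u0 E0) => w.
rewrite minEle; case: ifP => _ h; first by move: h; lra.
by move/eqP: h; rewrite normr_eq0 subr_eq0 => /eqP.
Qed.

End levy.

(** * Two-sided Levy processes *)

Lemma sigma_process_increments d (T : measurableType d) (R : realType) (P : probability T R)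
    (X : R -> {RV P >-> R}) (N : nat) (c : 'I_N -> R) (s t : 'I_N -> R) (B : set R) :
  (forall i, 0 <= s i) -> (forall i, 0 <= t i) -> measurable B ->
  sigma_process X ((fun w => \sum_i c i * (X (s i) w - X (t i) w)) @^-1` B).
Proof.
move=> s0 t0 mB.
pose G := [set A : set T | exists2 t : R, 0 <= t &
  preimage_set_system [set: T] (X t) measurable A].
have mX r : 0 <= r -> measurable_fun setT (X r : g_sigma_algebraType G -> R).
  move=> r0 _ C mC; apply: sub_sigma_algebra; exists r => //.
  by exists C.
have mS : measurable_fun setT
    (fun w : g_sigma_algebraType G => \sum_i c i * (X (s i) w - X (t i) w)).
  apply: measurable_sum => i; apply: measurable_funM => //.
  by apply: measurable_funB; exact: mX.
by have := mS measurableT B mB; rewrite setTI.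
Qed.

Section two_sided.
Context d (T : measurableType d) (R : realType) (P : probability T R).
Variables (L : R -> {RV P >-> R}).
Hypothesis L_levy : two_sided_levy_process P L.

Let mL t : measurable_fun setT (L t). Proof. exact: measurable_funP. Qed.

(** After the reflection t -> - t this is the right continuity of the negative
    half of a two-sided process. *)
Lemma left_limit_left_continuous (x : R -> R) (t : R) (u : nat -> R) :
  cadlag x -> 0 < t -> (forall n, 0 < u n < t) -> u n @[n --> \oo] --> t ->
  left_limit x (u n) @[n --> \oo] --> left_limit x t.
Proof.
move=> [_ cx] t0 ut cu; apply/cvgrPdist_le => e e0.
have /cvgrPdist_le /(_ _ e0) := cx _ t0.
rewrite near_withinE /= => -[r /= r0 hr].
have /cvgrPdist_lt /(_ _ r0) := cu; apply: filterS => n hn.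
have /andP[un0 unt] := ut n.
have hn' : `|t - u n| < r := hn.
have cun := cx _ un0.
have h1 : \forall v \near (u n)^'-, `|left_limit x t - x v| <= e.
  near=> v; apply: hr => /=.
    have v1 : v < u n by near: v; exact: nbhs_left_lt.
    have v2 : t - r < v.
      near: v; apply: nbhs_left_gt.
      by move: hn'; rewrite ltr_norml; lra.
    by rewrite /= gtr0_norm; lra.
  have v1 : v < u n by near: v; exact: nbhs_left_lt.
  lra.
have cn : `|left_limit x t - x v| @[v --> (u n)^'-] --> `|left_limit x t - left_limit x (u n)|.
  by apply: cvg_norm; apply: cvgB => //; exact: cvg_cst.
exact: (cvgr_to_le cn h1).
Unshelve. all: by end_near. Qed.

Lemma two_sided_right_continuous : {ae P, forall w, forall (t : R) (u : nat -> R),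
  (forall n, t < u n) -> u n @[n --> \oo] --> t -> L (u n) w @[n --> \oo] --> L t w}.
Proof.
have [L1 [L2 [[_ _ _ c1] [_ _ _ c2] _ LE]]] := L_levy.
apply: filterS2 c1 c2 => w c1 c2 t u tu ut.
have [t0|t0] := leP 0 t.
  rewrite LE t0; under eq_fun => n do rewrite LE (le_trans t0 (ltW (tu n))).
  by have /cvg_at_rightP := c1.1 t t0; apply.
rewrite LE leNgt t0 /=.
have [N _ hN] : \forall n \near \oo, u n < 0.
  have /cvgrPdist_lt /(_ (- t)) := ut; rewrite oppr_gt0 => /(_ t0).
  by apply: filterS => n; rewrite ltr_norml; lra.
pose v n := - u (n + N)%N.
have LEv n : L (u (n + N)%N) w = - left_limit (fun s => L2 s w) (v n).
  by rewrite LE leNgt (hN (n + N)%N) //= leq_addl.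
rewrite -(cvg_shiftn N) (eq_cvg _ _ LEv).
apply: cvgN; apply: left_limit_left_continuous => //.
- by rewrite oppr_gt0.
- by move=> n; rewrite /v oppr_gt0 ltrN2 tu hN//= leq_addl.
- by apply: cvgN; rewrite (cvg_shiftn N u).
Qed.

Variables (V : R) (kr ki : R -> R).
Hypotheses (krl : quad_lip V kr) (kil : quad_lip V ki).
Hypothesis chf1 : forall theta, chf P (fun w => theta * L 1 w) =
  cexp (- (kr theta +i* ki theta)).

(** The M cells on the left of the origin come from the second copy, read
    backwards in time, and the M cells on its right from the first; at grid
    points left limits are values up to a null set. *)
Lemma chf_two_sided_grid (n M : nat) (c : 'I_(M + M) -> R) :
  chf P (fun w => \sum_j c j * (L (j.+1%:R * 2 ^- n - M%:R * 2 ^- n) w -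
                                L (j%:R * 2 ^- n - M%:R * 2 ^- n) w)) =
  \prod_j cexp (- ((2 ^- n * kr (c j)) +i* (2 ^- n * ki (c j)))).
Proof.
have [L1 [L2 [lev1 lev2 [same indep] LE]]] := L_levy.
set h : R := 2 ^- n.
have h0 : 0 < h by rewrite invr_gt0 exprn_gt0.
have m1 t : measurable_fun setT (L1 t) by exact: measurable_funP.
have m2 t : measurable_fun setT (L2 t) by exact: measurable_funP.
have chfL1 theta : chf P (fun w => theta * L1 1 w) = cexp (- (kr theta +i* ki theta)).
  by rewrite -chf1; congr (chf P _); apply/funext => w; rewrite LE ler01.
have chfL2 theta : chf P (fun w => theta * L2 1 w) = cexp (- (kr theta +i* ki theta)).
  rewrite -chfL1.
  have sl : same_law P (L2 1) P (L1 1).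
    move=> B mB.
    have := same 1%N (\row_j 1) (fun j => _).
    have j0 (j : 'I_1) : 0 <= (\row_(j < 1) (1 : R)) 0 j by rewrite mxE.
    move=> /(_ j0) /(_ ((fun v => tnth v ord0) @^-1` B)).
    have mT : measurable ((fun v : 1.-tuple R => tnth v ord0) @^-1` B).
      by rewrite -[X in measurable X]setTI; exact: measurable_tnth.
    move=> /(_ mT); rewrite /pushforward.
    have E (Z : R -> T -> R) : time_vector Z (\row_j 1) @^-1` ((fun v : 1.-tuple R => tnth v ord0) @^-1` B) =
        Z 1 @^-1` B.
      by apply/seteqP; split => w /=; rewrite tnth_mktuple mxE.
    by rewrite !E => ->.
  by apply: chf_same_law.
pose A1 w := \sum_(i < M) c (rshift M i) * (L1 (i.+1%:R * h) w - L1 (i%:R * h) w).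
pose A2 w := \sum_(i < M) c (lshift M (rev_ord i)) * (L2 (i.+1%:R * h) w - L2 (i%:R * h) w).
have mA1 : measurable_fun setT A1.
  by apply: measurable_sum => i; apply: measurable_funM => //; exact: measurable_funB.
have mA2 : measurable_fun setT A2.
  by apply: measurable_sum => i; apply: measurable_funM => //; exact: measurable_funB.
have aeL2 : {ae P, forall w, forall i : nat, L (- (i%:R * h)) w = - L2 (i%:R * h) w}.
  apply/ae_foralln => -[|i].
    have [X1 _ _ _] := lev1; have [X2 _ _ _] := lev2.
    by apply: filterS2 X1 X2 => w e1 e2; rewrite mul0r oppr0 LE lexx e1 e2 oppr0.
  have ih : 0 < i.+1%:R * h by rewrite mulr_gt0.
  have := @left_limit_ae_eq _ _ _ P L2 lev2 (i.+1%:R * h) (fun w => - L (- (i.+1%:R * h)) w) ih.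
  have mLi : measurable_fun setT (fun w => - L (- (i.+1%:R * h)) w).
    by apply: measurableT_comp.
  move=> /(_ mLi) H; apply: filterS (H _) => w; first by move=> <-; rewrite opprK.
  by rewrite LE oppr_ge0 leNgt ih/= !opprK.
have -> : chf P (fun w => \sum_j c j * (L (j.+1%:R * h - M%:R * h) w - L (j%:R * h - M%:R * h) w)) =
    chf P (fun w => \sum_(b : bool) 1 * (if b then A1 else A2) w).
  apply: chf_ae_eq.
  - by apply: measurable_sum => i; apply: measurable_funM => //; exact: measurable_funB.
  - by apply: measurable_sum => i; apply: measurable_funM => //; case: i.
  - apply: filterS aeL2 => w hw.
    rewrite big_bool/= !mul1r addrC big_split_ord/=; congr (_ + _).
      rewrite (reindex_inj rev_ord_inj)/=; apply: eq_bigr => i _; congr (_ * _).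
      have iM : (i.+1 <= M)%N by [].
      have -> : (M - i.+1).+1%:R * h - M%:R * h = - (i%:R * h).
        by rewrite -subSn// subSS natrB ?(ltnW iM)// mulrBl addrAC subrr sub0r.
      have -> : (M - i.+1)%:R * h - M%:R * h = - (i.+1%:R * h).
        by rewrite natrB// mulrBl addrAC subrr sub0r.
      by rewrite !hw opprK addrC.
    apply: eq_bigr => i _; congr (_ * _).
    have e1 (j : nat) : (M + j)%:R * h - M%:R * h = j%:R * h.
      by rewrite natrD mulrDl addrAC subrr add0r.
    by rewrite -addnS !e1 !LE !mulr_ge0// ltW.
have indepA : mutually_independent_rv P (fun b : bool => if b then A1 else A2).
  apply: independent_of_product_rule => [[]//|D mD].
  rewrite big_bool/= muleC.
  have -> : \bigcap_b ((if b then A1 else A2) @^-1` D b) = (A1 @^-1` D true) `&` (A2 @^-1` D false).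
    apply/seteqP; split => w /= hw; first by split; [exact: (hw true)|exact: (hw false)].
    by case=> _; [exact: hw.1|exact: hw.2].
  rewrite muleC; apply: indep; apply: sigma_process_increments => // i;
    by rewrite mulr_ge0// ltW.
rewrite (chf_independent (X := fun b : bool => if b then A1 else A2) (fun=> 1)); last 2 first.
- by case.
- exact: indepA.
rewrite big_bool/=.
under [X in chf P X]eq_fun do rewrite mul1r.
under [X in _ * chf P X]eq_fun do rewrite mul1r.
rewrite /A1 /A2 (chf_grid_increments lev1)// ?ltW// (chf_grid_increments lev2)// ?ltW//.
rewrite mulrC big_split_ord/=; congr (_ * _).
  rewrite [RHS](reindex_inj rev_ord_inj)/=; apply: eq_bigr => i _.
  exact: (chf_dyadic lev2 krl kil chfL2).
by apply: eq_bigr => i _; exact: (chf_dyadic lev1 krl kil chfL1).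
Qed.

End two_sided.

(** * Step functions on a grid *)

Lemma telescope_window (V : zmodType) (F : nat -> V) (a b N : nat) : (a <= b <= N)%N ->
  \sum_(j < N) (if (a <= j < b)%N then F j.+1 - F j else 0) = F b - F a.
Proof.
elim: N b => [|N IH] b /andP[ab bN].
  have b0 : b = 0%N by apply/eqP; rewrite -leqn0.
  by move: ab; rewrite b0 leqn0 => /eqP ->; rewrite big_ord0 subrr.
rewrite big_ord_recr/=; have [bN'|bN'] := leqP b N.
  by rewrite andbF addr0 IH// ab.
have bE : b = N.+1 by apply/eqP; rewrite eqn_leq bN.
have [aN|aN] := leqP a N; last first.
  have aE : a = N.+1 by apply/eqP; rewrite eqn_leq aN -bE ab.
  rewrite bE aE subrr addr0 big1// => j _.
  by rewrite leqNgt ltnS (ltnW (ltn_ord j)).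
rewrite bE /= (eq_bigr (fun j : 'I_N => if (a <= j < N)%N then F j.+1 - F j else 0)).
  by rewrite IH ?aN ?leqnn// addrC addrA subrK.
by move=> j _; rewrite ltn_ord (leqW (ltn_ord j)).
Qed.

Section grid.
Context {R : realType}.
Variables (h : R) (M N : nat).
Hypothesis h0 : 0 < h.
(* The grid is shifted so that the index M is at the origin. *)
Let tau (j : nat) : R := j%:R * h - M%:R * h.

Lemma grid_lt a b : (tau a < tau b) = (a < b)%N.
Proof. by rewrite /tau ltrD2r ltr_pM2r// ltr_nat. Qed.

Lemma grid_le a b : (tau a <= tau b) = (a <= b)%N.
Proof. by rewrite /tau lerD2r ler_pM2r// ler_nat. Qed.

Definition on_grid (s : seq (R * (R * R))) :=
  forall p, p \in s -> exists a b : nat,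
    [/\ p.2.1 = tau a, p.2.2 = tau b & (a <= b <= N)%N].

Lemma step_fun_cons (p : R * (R * R)) s (u : R) : step_fun (p :: s) u =
  (if p.2.1 < u <= p.2.2 then p.1 else 0) + step_fun s u.
Proof. by rewrite /step_fun big_cons. Qed.

Lemma step_integral_cons (T : Type) (L : R -> T -> R) (p : R * (R * R)) s w :
  step_integral L (p :: s) w = p.1 * (L p.2.2 w - L p.2.1 w) + step_integral L s w.
Proof. by rewrite /step_integral big_cons. Qed.

Lemma step_integral_grid (T : Type) (L : R -> T -> R) s w : on_grid s ->
  step_integral L s w =
  \sum_(j < N) step_fun s (tau j.+1) * (L (tau j.+1) w - L (tau j) w).
Proof.
elim: s => [_|p s IH sg].
  rewrite /step_integral big_nil big1// => j _.
  by rewrite /step_fun big_nil mul0r.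
rewrite step_integral_cons IH => [|q qs]; last by apply: sg; rewrite in_cons qs orbT.
under [RHS]eq_bigr do rewrite step_fun_cons mulrDl.
rewrite big_split/=; congr (_ + _).
have [a [b [-> -> abN]]] := sg p (mem_head _ _).
rewrite -(telescope_window (fun j => L (tau j) w) abN) mulr_sumr.
apply: eq_bigr => j _; rewrite grid_lt grid_le ltnS.
by case: ifP; rewrite ?mul0r ?mulr0.
Qed.

Lemma grid_cell (u : R) : tau 0 < u <= tau N -> exists2 j : 'I_N, tau j < u & u <= tau j.+1.
Proof.
elim: N => [|n IH] /andP[u0 uN].
  by move: (lt_le_trans u0 uN); rewrite ltxx.
have [un|un] := leP u (tau n).
  have [|j j1 j2] := IH; first by rewrite u0.
  by exists (widen_ord (leqnSn n) j).
by exists ord_max.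
Qed.

Lemma step_fun_cell s (u : R) (j : nat) : on_grid s -> tau j < u -> u <= tau j.+1 ->
  step_fun s u = step_fun s (tau j.+1).
Proof.
move=> sg ju uj; apply: eq_big_seq => p /sg [a [b [-> -> _]]].
rewrite grid_lt grid_le ltnS.
have -> : (tau a < u) = (a <= j)%N.
  apply/idP/idP => [au|aj]; last by rewrite (le_lt_trans _ ju)// grid_le.
  by rewrite -ltnS -grid_lt (lt_le_trans au).
have -> // : (u <= tau b) = (j < b)%N.
apply/idP/idP => [ub|jb]; last by rewrite (le_trans uj)// grid_le.
by rewrite -grid_lt (lt_le_trans ju).
Qed.

Lemma step_fun_out s (u : R) : on_grid s -> ~~ (tau 0 < u <= tau N) -> step_fun s u = 0.
Proof.
move=> sg hu; rewrite /step_fun big_seq big1// => p /sg [a [b [-> -> /andP[ab bN]]]].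
case: ifP => // /andP[au ub]; move: hu; rewrite negb_and => /orP[]; last first.
  by rewrite (le_trans ub)// grid_le.
by rewrite (le_lt_trans _ au)// grid_le.
Qed.

Lemma kernel_step_fun_grid (k : R -> R) s (u : R) : k 0 = 0 -> on_grid s ->
  k (step_fun s u) = \sum_(j < N) k (step_fun s (tau j.+1)) * \1_`]tau j, tau j.+1] u.
Proof.
move=> k0 sg; have [uin|uout] := boolP (tau 0 < u <= tau N); last first.
  rewrite (step_fun_out sg uout) k0 big1// => j _.
  rewrite indicE memNset ?mulr0//= in_itv/= => /andP[ju uj].
  move/negP: uout; apply; rewrite (le_lt_trans _ ju) ?grid_le//=.
  by rewrite (le_trans uj) ?grid_le.
have [j ju uj] := grid_cell uin.
rewrite (bigD1 j)//= big1 => [|i ij].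
  rewrite indicE mem_set/= ?in_itv/= ?ju// mulr1 addr0.
  by rewrite (step_fun_cell sg ju uj).
rewrite indicE memNset ?mulr0//= in_itv/= => /andP[iu ui].
move/negP: ij; apply; rewrite -val_eqE/= eqn_leq -ltnS -grid_lt (lt_le_trans iu)//=.
by rewrite -ltnS -grid_lt (lt_le_trans ju).
Qed.

Lemma Rintegral_step_fun_grid (k : R -> R) s : k 0 = 0 -> on_grid s ->
  \int[leb]_u k (step_fun s u) = \sum_(j < N) h * k (step_fun s (tau j.+1)).
Proof.
move=> k0 sg.
under eq_Rintegral do rewrite (kernel_step_fun_grid _ k0 sg).
have i1 (j : nat) : rintegrable leb (\1_`]tau j, tau j.+1] : R -> R).
  exact: integrable_indic_itv.
have muE (j : nat) : \int[leb]_u (\1_`]tau j, tau j.+1] u : R) = h.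
  have lm : leb (`]tau j, tau j.+1]%classic : set R) = h%:E.
    rewrite lebesgue_measure_itv/= lte_fin grid_lt ltnSn -EFinB; congr (_%:E).
    by rewrite /tau -natr1; ring.
  by rewrite /Rintegral integral_indic// setIT; exact: (congr1 fine lm).
have ic (j : nat) (c : R) : rintegrable leb (fun u : R => c * \1_`]tau j, tau j.+1] u).
  exact: (rintegrableZl c (i1 j)).
elim: {sg} N => [|n IH].
  under eq_Rintegral do rewrite big_ord0.
  by rewrite big_ord0 /Rintegral integral0.
under eq_Rintegral do rewrite big_ord_recr/=.
rewrite RintegralD//; last first.
  have := @integrable_sum _ _ R leb setT measurableT 'I_n (index_enum 'I_n) xpredT
    (fun j u => (k (step_fun s (tau j.+1)) * \1_`]tau j, tau j.+1] u)%:E) (fun j _ => ic j _).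
  by congr (_.-integrable _ _); apply/funext => u /=; rewrite sumEFin.
by rewrite IH big_ord_recr/= RintegralZl// muE mulrC.
Qed.

End grid.

(** * Characteristic functions of integrals of step functions *)

Lemma complex_sum (R : realType) (I : Type) (s : seq I) (a b : I -> R) :
  \sum_(i <- s) (a i +i* b i) = (\sum_(i <- s) a i) +i* (\sum_(i <- s) b i).
Proof.
elim: s => [|i s IH]; first by rewrite !big_nil.
by rewrite !big_cons IH.
Qed.

Section exponent_integral.
Context {R : realType}.

(** The exponent of the integral of g: the exponent of the driving process
    integrated along the integrand. *)
Definition integrated_exponent (kr ki : R -> R) (g : R -> R) : R[i] :=
  (\int[leb]_u kr (g u)) +i* (\int[leb]_u ki (g u)).

Definition valid_steps (s : seq (R * (R * R))) := all (fun p => p.2.1 <= p.2.2) s.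

Lemma measurable_step_fun (s : seq (R * (R * R))) : measurable_fun setT (step_fun s).
Proof.
elim: s => [|p s IH].
  by rewrite (_ : step_fun [::] = fun=> 0)//; apply/funext => u; rewrite /step_fun big_nil.
rewrite (_ : step_fun (p :: s) =
  fun u => (if p.2.1 < u <= p.2.2 then p.1 else 0) + step_fun s u); last first.
  by apply/funext => u; rewrite step_fun_cons.
apply: measurable_funD => //; apply: measurable_fun_ifT => //.
by apply: measurable_and; [exact: measurable_fun_ltr|exact: measurable_fun_ler].
Qed.

Lemma measurable_step_integral d (T : measurableType d) (P : probability T R)
    (L : R -> {RV P >-> R}) s :
  measurable_fun setT (step_integral L s).
Proof.
have mL t : measurable_fun setT (L t) by exact: measurable_funP.
elim: s => [|p s IH].
  by rewrite (_ : step_integral L [::] = fun=> 0)//; apply/funext => u; rewrite /step_integral big_nil.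
rewrite (_ : step_integral L (p :: s) =
  fun w => p.1 * (L p.2.2 w - L p.2.1 w) + step_integral L s w); last first.
  by apply/funext => u; rewrite step_integral_cons.
by apply: measurable_funD => //; apply: measurable_funM => //; exact: measurable_funB.
Qed.

End exponent_integral.

Section rounding.
Context {R : realType}.
Variable B : nat.

Definition round_index (n : nat) (t : R) : nat := (Num.truncn ((t + B%:R) * 2 ^+ n)).+1.

(** Strictly upwards, since paths are continuous from the right only. *)
Definition round_up (n : nat) (t : R) : R :=
  (round_index n t)%:R * 2 ^- n - (B * 2 ^ n)%:R * 2 ^- n.

Definition round_steps n (s : seq (R * (R * R))) :=
  [seq (p.1, (round_up n p.2.1, round_up n p.2.2)) | p <- s].

Lemma round_up_bounds n t : `|t| < B%:R -> t < round_up n t <= t + 2 ^- n.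
Proof.
rewrite ltr_norml => /andP[t1 t2].
have p0 : (0 : R) < 2 ^+ n by rewrite exprn_gt0.
have x0 : 0 <= (t + B%:R) * 2 ^+ n by rewrite mulr_ge0 ?(ltW p0)//; lra.
have /andP[h1 h2] := truncn_itv x0.
have BE : (B * 2 ^ n)%:R * 2 ^- n = B%:R :> R by rewrite natrM natrX mulfK// gt_eqF.
rewrite /round_up BE /round_index; apply/andP; split.
  by rewrite ltrBrDr -[X in X < _](mulfK (lt0r_neq0 p0)) ltr_pM2r// invr_gt0.
rewrite lerBlDr -natr1 mulrDl mul1r addrAC lerD2r.
by rewrite ler_pdivrMr.
Qed.

Lemma round_index_le n t : `|t| < B%:R -> (round_index n t <= B * 2 ^ n + B * 2 ^ n)%N.
Proof.
rewrite ltr_norml => /andP[t1 t2].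
have p0 : (0 : R) < 2 ^+ n by rewrite exprn_gt0.
have x0 : 0 <= (t + B%:R) * 2 ^+ n by rewrite mulr_ge0 ?(ltW p0)//; lra.
have /andP[h1 h2] := truncn_itv x0.
rewrite /round_index -(ltr_nat R) (le_lt_trans h1)//.
by rewrite natrD natrM natrX -mulrDl ltr_pM2r//; lra.
Qed.

Lemma round_index_mono n t t' : `|t| < B%:R -> t <= t' -> (round_index n t <= round_index n t')%N.
Proof.
rewrite ltr_norml => /andP[t1 t2] tt'.
have p0 : (0 : R) < 2 ^+ n by rewrite exprn_gt0.
rewrite /round_index ltnS; apply: le_truncn.
by rewrite ler_pM2r// lerD2r.
Qed.

Definition bounded_steps (s : seq (R * (R * R))) :=
  all (fun p => (`|p.2.1| < B%:R) && (`|p.2.2| < B%:R)) s.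

Lemma round_steps_on_grid n s : valid_steps s -> bounded_steps s ->
  on_grid (2 ^- n) (B * 2 ^ n) (B * 2 ^ n + B * 2 ^ n) (round_steps n s).
Proof.
move=> vs bs p /mapP[q qs ->] /=.
have /andP[b1 b2] := allP bs q qs; have v := allP vs q qs.
exists (round_index n q.2.1), (round_index n q.2.2); split => //.
by rewrite round_index_mono// round_index_le.
Qed.

Lemma cvg_round_up t : `|t| < B%:R -> round_up n t @[n --> \oo] --> t.
Proof.
move=> tB; apply: (@squeeze_cvgr _ _ _ _ (fun=> t) (fun n => t + 2^-1 ^+ n)).
- by apply: nearW => n; have /andP[/ltW -> ] := round_up_bounds n tB; rewrite exprVn.
- exact: cvg_cst.
- rewrite -[X in _ --> X]addr0; apply: cvgD; first exact: cvg_cst.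
  by apply: cvg_expr; rewrite ger0_norm ?invr_ge0// invf_lt1// ltr1n.
Qed.

Lemma cvg_step_integral_round (T : Type) (L : R -> T -> R) (s : seq (R * (R * R))) w :
  bounded_steps s ->
  (forall (t : R) (u : nat -> R), (forall n, t < u n) -> u n @[n --> \oo] --> t ->
     L (u n) w @[n --> \oo] --> L t w) ->
  step_integral L (round_steps n s) w @[n --> \oo] --> step_integral L s w.
Proof.
move=> bs rc; elim: s bs => [_|p s IH /= /andP[/andP[b1 b2] bs]].
  by under eq_fun do rewrite /step_integral big_nil; rewrite /step_integral big_nil; exact: cvg_cst.
under eq_fun do rewrite step_integral_cons; rewrite step_integral_cons.
apply: cvgD; last exact: IH.
have rcB t : `|t| < B%:R -> L (round_up n t) w @[n --> \oo] --> L t w.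
  by move=> tB; apply: rc => [n|]; [case/andP: (round_up_bounds n tB)|exact: cvg_round_up].
by apply: cvgMr; apply: cvgB; exact: rcB.
Qed.

Lemma cvg_step_fun_round (s : seq (R * (R * R))) (u : R) : bounded_steps s ->
  step_fun (round_steps n s) u @[n --> \oo] --> step_fun s u.
Proof.
elim: s => [_|p s IH /= /andP[/andP[b1 b2] bs]].
  by under eq_fun do rewrite /step_fun big_nil; rewrite /step_fun big_nil; exact: cvg_cst.
under eq_fun do rewrite step_fun_cons; rewrite step_fun_cons.
apply: cvgD; last exact: IH.
apply: cvg_near_cst => /=.
have lt_near t : `|t| < B%:R -> \forall n \near \oo, (round_up n t < u) = (t < u).
  move=> tB; have [tu|ut] := ltP t u.
    have /cvgrPdist_lt /(_ (u - t)) := cvg_round_up tB; rewrite subr_gt0 => /(_ tu).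
    by apply: filterS => n; rewrite ltr_norml => /andP[h1 h2]; lra.
  apply: nearW => n; apply/negbTE; rewrite -leNgt (le_trans ut)//.
  by have /andP[/ltW] := round_up_bounds n tB.
apply: filterS2 (lt_near _ b1) (lt_near _ b2) => n e1 e2.
by rewrite e1 leNgt [in RHS]leNgt e2.
Qed.

Lemma step_fun_round_bound n (s : seq (R * (R * R))) (u : R) : bounded_steps s ->
  `|step_fun (round_steps n s) u| <=
    (\sum_(p <- s) `|p.1|) * \1_`[- B%:R, B%:R + 1] u.
Proof.
elim: s => [_|p s IH /= /andP[/andP[b1 b2] bs]].
  by rewrite /step_fun !big_nil normr0 mul0r.
rewrite step_fun_cons big_cons mulrDl (le_trans (ler_normD _ _))// lerD ?IH//=.
case: ifP => [/andP[h1 h2]|_]; last by rewrite normr0 mulr_ge0.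
rewrite indicE mem_set ?mulr1//= in_itv/=.
have /andP[h3 _] := round_up_bounds n b1; have /andP[_ h4] := round_up_bounds n b2.
have h5 : 2 ^- n <= 1 :> R by rewrite -exprVn exprn_ile1// invf_le1// ler1n.
move: b1 b2; rewrite !ltr_norml => /andP[b11 b12] /andP[b21 b22].
by apply/andP; split; lra.
Qed.

End rounding.

Section step_integral_chf.
Context d (T : measurableType d) (R : realType) (P : probability T R).
Variables (L : R -> {RV P >-> R}).
Hypothesis L_levy : two_sided_levy_process P L.
Variables (V : R) (kr ki : R -> R).
Hypotheses (krl : quad_lip V kr) (kil : quad_lip V ki).
Hypothesis chf1 : forall theta, chf P (fun w => theta * L 1 w) =
  cexp (- (kr theta +i* ki theta)).

Lemma exists_step_bound (s : seq (R * (R * R))) : exists B : nat, bounded_steps B s.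
Proof.
elim: s => [|p s [B hB]]; first by exists 0%N.
pose B' := maxn B (maxn (Num.truncn `|p.2.1|).+1 (Num.truncn `|p.2.2|).+1).
exists B' => /=; apply/andP; split.
  apply/andP; split.
    by rewrite (lt_le_trans (truncnS_gt _))// ler_nat /B' !leq_max leqnn orbT.
  by rewrite (lt_le_trans (truncnS_gt _))// ler_nat /B' !leq_max leqnn !orbT.
apply: sub_all hB => q /andP[h1 h2].
by rewrite (lt_le_trans h1) ?(lt_le_trans h2)// ler_nat /B' leq_maxl.
Qed.

Lemma cvg_integral_kernel_round (B : nat) (k : R -> R) s : quad_lip V k -> bounded_steps B s ->
  \int[leb]_u k (step_fun (round_steps B n s) u) @[n --> \oo] -->
  \int[leb]_u k (step_fun s u).
Proof.
move=> kl bs; have ck := quad_lip_continuous kl.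
have mk := continuous_measurable_fun ck.
pose C : R := \sum_(p <- s) `|p.1|.
have C0 : 0 <= C by apply: sumr_ge0.
have V0 : 0 <= V.
  have := quad_lip_sqr 1 kl; rewrite expr1n mulr1; exact: le_trans.
pose D : set R := `[- B%:R, B%:R + 1]%classic.
apply: (@cvg_Rintegral_dominated _ _ R leb
  (fun n u => k (step_fun (round_steps B n s) u)) (fun u => k (step_fun s u))
  (fun u => (V * C ^+ 2) * \1_D u)).
- by move=> n; apply: (measurableT_comp mk); exact: measurable_step_fun.
- by apply: (measurableT_comp mk); exact: measurable_step_fun.
- have i1 : rintegrable leb (\1_D : R -> R) by exact: integrable_indic_itv.
  exact: (rintegrableZl _ i1).
- move=> n u; rewrite (le_trans (quad_lip_sqr _ kl))// -mulrA ler_wpM2l//.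
  rewrite -(real_normK (num_real (step_fun _ u))).
  have := step_fun_round_bound n u bs; rewrite -/C -/D.
  rewrite !indicE; case: (u \in D); rewrite /= ?mulr1 ?mulr0 => h.
    by rewrite lerXn2r// nnegrE.
  by have /eqP -> : `|step_fun (round_steps B n s) u| == 0; rewrite ?expr0n// eq_le h normr_ge0.
- apply: aeW => u /=; exact: (cvg_comp _ _ (@cvg_step_fun_round _ _ _ u bs) (ck _)).
Qed.

(** The grid formula is applied to the rounded steps. Right continuity of the
    paths gives the limit of the left-hand side, and dominated convergence on
    a bounded interval that of the right-hand side. *)
Lemma chf_step_integral s : valid_steps s ->
  chf P (step_integral L s) = cexp (- integrated_exponent kr ki (step_fun s)).
Proof.
move=> vs; have [B bs] := exists_step_bound s.
have c1 : ccvg (fun n => chf P (step_integral L (round_steps B n s))) (chf P (step_integral L s)).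
  apply: cvg_chf_ae.
  - by move=> n; exact: measurable_step_integral.
  - exact: measurable_step_integral.
  - have := two_sided_right_continuous L_levy; apply: filterS => w hw.
    exact: cvg_step_integral_round.
have c2 : ccvg (fun n => cexp (- integrated_exponent kr ki (step_fun (round_steps B n s))))
    (cexp (- integrated_exponent kr ki (step_fun s))).
  by apply: ccvg_cexpN; split => /=; exact: cvg_integral_kernel_round.
have e n : chf P (step_integral L (round_steps B n s)) =
    cexp (- integrated_exponent kr ki (step_fun (round_steps B n s))).
  have sg := @round_steps_on_grid _ _ n _ vs bs.
  have h0 : (0 : R) < 2 ^- n by rewrite invr_gt0 exprn_gt0.
  rewrite /integrated_exponent (Rintegral_step_fun_grid h0 krl.1 sg).
  rewrite (Rintegral_step_fun_grid h0 kil.1 sg).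
  rewrite (_ : step_integral _ _ = fun w => \sum_(j < B * 2 ^ n + B * 2 ^ n)
      step_fun (round_steps B n s) (j.+1%:R * 2 ^- n - (B * 2 ^ n)%:R * 2 ^- n) *
      (L (j.+1%:R * 2 ^- n - (B * 2 ^ n)%:R * 2 ^- n) w -
       L (j%:R * 2 ^- n - (B * 2 ^ n)%:R * 2 ^- n) w)); last first.
    by apply/funext => w; exact: (step_integral_grid h0 _ _ sg).
  rewrite (chf_two_sided_grid L_levy krl kil chf1 n
    (fun j : 'I_(B * 2 ^ n + B * 2 ^ n) => step_fun (round_steps B n s) (j.+1%:R * 2 ^- n - (B * 2 ^ n)%:R * 2 ^- n))).
  rewrite -cexp_sum; congr cexp; rewrite sumrN; congr (- _).
  exact: complex_sum.
rewrite (_ : (fun n => chf P _) = (fun n => cexp (- integrated_exponent kr ki (step_fun (round_steps B n s))))) in c1.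
  exact: ccvg_unique c1 c2.
by apply/funext => n; exact: e.
Qed.

End step_integral_chf.

(** * Square integrals and dilations of the line *)

Section lebesgue_scaling.
Context {R : realType}.
Local Open Scope ereal_scope.

(** By uniqueness of Lebesgue measure: its image under division by c,
    multiplied by 1/c, gives intervals their length. *)
Lemma ge0_integral_dilation (c : R) (phi : R -> \bar R) : (0 < c)%R ->
  measurable_fun setT phi -> (forall u, 0 <= phi u) ->
  \int[leb]_u phi (u / c)%R = c%:E * \int[leb]_u phi u.
Proof.
move=> c0 mphi phi0.
pose s (u : measurableTypeR R) : measurableTypeR R := ((u : R) / c)%R.
have ms : measurable_fun setT s.
  exact: (measurable_funM (@measurable_id _ _ setT) (measurable_cst _)).
have ci : (0 <= c^-1)%R by rewrite invr_ge0 ltW.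
pose push : {measure set (measurableTypeR R) -> \bar R} :=
  pushforward leb s.
pose nu : {measure set (measurableTypeR R) -> \bar R} := mscale (NngNum ci) (push ms).
have lebE A : measurable A -> leb A = nu A.
  apply: lebesgue_measure_unique => _ [[a b] /= _ <-].
  rewrite /nu /mscale /= /pushforward.
  have -> : s @^-1` `]a, b] = `](a * c)%R, (b * c)%R]%classic.
    by apply/seteqP; split => u /=; rewrite !in_itv/= /s ltr_pdivlMr// ler_pdivrMr.
  rewrite !lebesgue_measure_itv/= !lte_fin ltr_pM2r//; case: ifP => _; last by rewrite mule0.
  by rewrite -!EFinB -EFinM -mulrBl mulrCA mulVf ?mulr1// gt_eqF.
have -> : \int[leb]_u phi u = \int[nu]_u phi u.
  by apply: eq_measure_integral => A mA _; exact: lebE.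
rewrite ge0_integral_mscale//= muleA -EFinM mulfV ?gt_eqF// mul1e.
by rewrite ge0_integral_pushforward.
Qed.

Lemma Rintegral_dilation (c : R) (phi : R -> R) : (0 < c)%R -> rintegrable leb phi ->
  (\int[leb]_u phi (u / c) = c * \int[leb]_u phi u)%R.
Proof.
move=> c0 iphi; have mphi' := measurable_int _ iphi.
rewrite /Rintegral integralE [in RHS]integralE.
have pE : \int[leb]_u (fun u => (phi (u / c)%R)%:E)^\+ u = c%:E * \int[leb]_u (EFin \o phi)^\+ u.
  rewrite -(@ge0_integral_dilation c (EFin \o phi)^\+ c0 (measurable_funepos mphi'))//.
  by apply: eq_integral => u _; rewrite !funeposE.
have nE : \int[leb]_u (fun u => (phi (u / c)%R)%:E)^\- u = c%:E * \int[leb]_u (EFin \o phi)^\- u.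
  rewrite -(@ge0_integral_dilation c (EFin \o phi)^\- c0 (measurable_funeneg mphi'))//.
  by apply: eq_integral => u _; rewrite !funenegE.
rewrite pE nE -muleBr//; last exact: integrable_add_def.
rewrite fineM// -[X in X \is a fin_num]integralE; exact: integrable_fin_num.
Qed.

End lebesgue_scaling.

Section square_tools.
Context d (T : measurableType d) (R : realType) (mu : {measure set T -> \bar R}).
Local Open Scope ereal_scope.

Lemma integral_sqrD_le (a b : T -> R) : measurable_fun setT a -> measurable_fun setT b ->
  \int[mu]_u ((a u + b u) ^+ 2)%:E <=
  2%:E * \int[mu]_u (a u ^+ 2)%:E + 2%:E * \int[mu]_u (b u ^+ 2)%:E.
Proof.
move=> ma mb.
have mE (f : T -> R) : measurable_fun setT f -> measurable_fun setT (fun u => (f u ^+ 2)%:E).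
  by move=> mf; apply/measurable_EFinP; exact: measurable_funX.
have ge (f : T -> R) : forall u, setT u -> 0 <= (f u ^+ 2)%:E by move=> u _; rewrite lee_fin sqr_ge0.
rewrite -!ge0_integralZl//; [|exact: mE|exact: ge|exact: mE|exact: ge].
rewrite -ge0_integralD//; last 4 first.
- by move=> u _; rewrite mule_ge0// ge.
- by apply: measurable_funeM; exact: mE.
- by move=> u _; rewrite mule_ge0// ge.
- by apply: measurable_funeM; exact: mE.
apply: ge0_le_integral => //.
- exact: (ge (fun u => a u + b u)%R).
- by apply: (mE (fun u => a u + b u)%R); exact: measurable_funD.
- by apply: emeasurable_funD; apply: measurable_funeM; exact: mE.
- move=> u _; rewrite -!EFinM -EFinD lee_fin.
  have := sqr_ge0 (a u - b u)%R; lra.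
Qed.

Lemma cvg_sqrD (a_ b_ : nat -> T -> R) :
  (forall n, measurable_fun setT (a_ n)) -> (forall n, measurable_fun setT (b_ n)) ->
  \int[mu]_u (a_ n u ^+ 2)%:E @[n --> \oo] --> 0 ->
  \int[mu]_u (b_ n u ^+ 2)%:E @[n --> \oo] --> 0 ->
  \int[mu]_u ((a_ n u + b_ n u) ^+ 2)%:E @[n --> \oo] --> 0.
Proof.
move=> ma mb ca cb.
apply: (@squeeze_cvge _ _ _ _ (cst 0) _ (fun n => 2%:E * \int[mu]_u (a_ n u ^+ 2)%:E
   + 2%:E * \int[mu]_u (b_ n u ^+ 2)%:E)).
- apply: nearW => n; rewrite integral_sqrD_le// andbT.
  by apply: integral_ge0 => u _; rewrite lee_fin sqr_ge0.
- exact: cvg_cst.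
- rewrite -[X in _ --> X](adde0 0); apply: cvgeD => //.
    by rewrite -[X in _ --> X](mule0 2%:E); apply: cvgeZl.
  by rewrite -[X in _ --> X](mule0 2%:E); apply: cvgeZl.
Qed.

Lemma cvg_sqrZ (c : R) (a_ : nat -> T -> R) :
  (forall n, measurable_fun setT (a_ n)) ->
  \int[mu]_u (a_ n u ^+ 2)%:E @[n --> \oo] --> 0 ->
  \int[mu]_u ((c * a_ n u) ^+ 2)%:E @[n --> \oo] --> 0.
Proof.
move=> ma ca.
have e n : \int[mu]_u ((c * a_ n u) ^+ 2)%:E = (c ^+ 2)%:E * \int[mu]_u (a_ n u ^+ 2)%:E.
  rewrite -ge0_integralZl//.
  - by apply: eq_integral => u _; rewrite exprMn EFinM.
  - by apply/measurable_EFinP; exact: measurable_funX.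
  - by move=> u _; rewrite lee_fin sqr_ge0.
  - by rewrite lee_fin sqr_ge0.
rewrite (eq_cvg _ _ e).
have h : (c ^+ 2)%:E * \int[mu]_u (a_ n u ^+ 2)%:E @[n --> \oo] --> (c ^+ 2)%:E * 0.
  by apply: cvgeZl.
by move: h; rewrite mule0.
Qed.

End square_tools.

Lemma cvg_sqr_sum d (T : measurableType d) (R : realType) (mu : {measure set T -> \bar R})
    (I : Type) (r : seq I) (c : I -> R) (a_ : I -> nat -> T -> R) :
  (forall i n, measurable_fun setT (a_ i n)) ->
  (forall i, (\int[mu]_u (a_ i n u ^+ 2)%:E)%E @[n --> \oo] --> 0%E) ->
  (\int[mu]_u ((\sum_(i <- r) c i * a_ i n u) ^+ 2)%:E)%E @[n --> \oo] --> 0%E.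
Proof.
move=> ma ca; elim: r => [|i r IH].
  under eq_fun do under eq_integral do rewrite big_nil expr0n/=.
  by under eq_fun do rewrite integral0; exact: cvg_cst.
under eq_fun do under eq_integral do rewrite big_cons.
apply: (@cvg_sqrD _ _ _ mu (fun n u => c i * a_ i n u) (fun n u => \sum_(j <- r) c j * a_ j n u)) => //.
- by move=> n; exact: measurable_funM.
- by move=> n; apply: measurable_sum => j; exact: measurable_funM.
- exact: cvg_sqrZ.
Qed.

Section kernel_integral.
Context d (T : measurableType d) (R : realType) (mu : {measure set T -> \bar R}).
Variables (V : R) (k : R -> R).
Hypotheses (V0 : 0 <= V) (kl : quad_lip V k).

Let mk : measurable_fun setT k.
Proof. exact: continuous_measurable_fun (quad_lip_continuous kl). Qed.

Lemma integrable_kernel (g : T -> R) : measurable_fun setT g ->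
  rintegrable mu (fun u => g u ^+ 2) -> rintegrable mu (fun u => k (g u)).
Proof.
move=> mg ig; apply: (rintegrable_le (measurableT_comp mk mg) _
  (rintegrableZl V ig)) => u.
exact: quad_lip_sqr.
Qed.

(** The factor |a| + |b| of the modulus is at most |a - b| + 2 |b|, and the
    mixed term is split by Young's inequality with a free weight e. *)
Lemma kernel_integral_sub (g g' : T -> R) (e : R) : 0 < e ->
  measurable_fun setT g -> measurable_fun setT g' ->
  rintegrable mu (fun u => g u ^+ 2) -> rintegrable mu (fun u => (g' u - g u) ^+ 2) ->
  `|\int[mu]_u k (g' u) - \int[mu]_u k (g u)| <=
  V * ((1 + e^-1) * \int[mu]_u ((g' u - g u) ^+ 2) + e * \int[mu]_u (g u ^+ 2)).
Proof.
move=> e0 mg mg' ig id_.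
have Z c (f : T -> R) : rintegrable mu f -> rintegrable mu (fun u => c * f u).
  by move=> fi; exact: (rintegrableZl c fi).
have D (f h : T -> R) : rintegrable mu f -> rintegrable mu h -> rintegrable mu (fun u => f u + h u).
  by move=> fi hi; exact: (@integrableD _ _ _ _ _ measurableT _ _ fi hi).
have ig' : rintegrable mu (fun u => g' u ^+ 2).
  apply: (rintegrable_le _ _ (D _ _ (Z 2 _ ig) (Z 2 _ id_))).
    exact: measurable_funX.
  move=> u; rewrite ger0_norm ?sqr_ge0//.
  have := sqr_ge0 (g u - (g' u - g u)); lra.
have ik := integrable_kernel mg ig; have ik' := integrable_kernel mg' ig'.
rewrite -RintegralB//.
have iB : rintegrable mu (fun u => k (g' u) - k (g u)).
  exact: (rintegrableB ik' ik).
have iR := D _ _ (Z (1 + e^-1) _ id_) (Z e _ ig).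
rewrite -!(RintegralZl _ measurableT)// -RintegralD//; [|exact: Z|exact: Z].
rewrite -RintegralZl//.
rewrite (le_trans (le_normr_Rintegral _ iB))//.
apply: (le_Rintegral measurableT (integrable_norm iB) (Z V _ iR)) => u _.
have [_ kl'] := kl; rewrite (le_trans (kl' _ _))// ler_wpM2l//.
move: (g' u) (g u) => x y; rewrite -(real_normK (num_real (x - y))) -(real_normK (num_real y)).
have h1 : `|x| <= `|x - y| + `|y| by rewrite -{1}(subrK y x) ler_normD.
move: h1 (normr_ge0 (x - y)) (normr_ge0 y) (normr_ge0 x); move: `|x - y| `|x| `|y| => p q r h1 p0 r0 q0.
have h2 : p * (q + r) <= p * (p + 2 * r) by rewrite ler_wpM2l//; lra.
apply: le_trans h2 _.
suff : 2 * (p * r) <= e^-1 * p ^+ 2 + e * r ^+ 2 by lra.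
rewrite -(ler_pM2l e0) mulrDr mulVKf ?gt_eqF//.
have := sqr_ge0 (p - e * r); lra.
Qed.

End kernel_integral.

(** * Continuity of integrated exponents *)

(** Choice of the weight in kernel_integral_sub: first e, which makes the
    second term small, then the range of D, which depends on e. *)
Lemma two_scale_le (R : realType) (V G eps : R) : 0 <= V -> 0 <= G -> 0 < eps ->
  exists2 eta : R, 0 < eta & forall D, 0 <= D <= eta ->
    exists2 e : R, 0 < e & V * ((1 + e^-1) * D + e * G) <= eps.
Proof.
move=> V0 G0 eps0.
have VG : 0 <= V * G by rewrite mulr_ge0.
pose e := eps / (2 * (V * G + 1)).
have e0 : 0 < e by rewrite divr_gt0// mulr_gt0// ltr_wpDl.
have ei : 0 < e^-1 by rewrite invr_gt0.
pose W := V * (1 + e^-1).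
have W0 : 0 <= W by rewrite mulr_ge0// addr_ge0// ltW.
exists (eps / (2 * (W + 1))); first by rewrite divr_gt0// mulr_gt0// ltr_wpDl.
move=> D /andP[D0 DE]; exists e => //.
have h1 : V * G * e <= eps / 2.
  rewrite /e mulrA ler_pdivrMr ?mulr_gt0 ?ltr_wpDl//; lra.
have h2 : W * D <= eps / 2.
  move: DE; rewrite ler_pdivlMr ?mulr_gt0 ?ltr_wpDl// => DE.
  have : 0 <= W * D by rewrite mulr_ge0.
  lra.
have -> : V * ((1 + e^-1) * D + e * G) = W * D + V * G * e by rewrite /W; ring.
lra.
Qed.

Section kernel_limits.
Context d (T : measurableType d) (R : realType) (mu : {measure set T -> \bar R}).
Variables (V : R) (k : R -> R).
Hypotheses (V0 : 0 <= V) (kl : quad_lip V k).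

Lemma cvg_kernel_integral (g_ : nat -> T -> R) (g : T -> R) :
  (forall n, measurable_fun setT (g_ n)) -> measurable_fun setT g ->
  rintegrable mu (fun u => g u ^+ 2) ->
  (\int[mu]_u ((g_ n u - g u) ^+ 2)%:E)%E @[n --> \oo] --> 0%E ->
  \int[mu]_u k (g_ n u) @[n --> \oo] --> \int[mu]_u k (g u).
Proof.
move=> mg_ mg ig cv; apply/cvgrPdist_le => eps eps0.
have G0 : 0 <= \int[mu]_u (g u ^+ 2) by apply: Rintegral_ge0 => u _; exact: sqr_ge0.
have [eta eta0 h] := two_scale_le V0 G0 eps0.
have /fine_cvgP[fin /cvgrPdist_le /(_ _ eta0)] := cv.
move: fin; apply: filterS2 => n fn; rewrite sub0r normrN => Dn.
have Dn0 : 0 <= \int[mu]_u ((g_ n u - g u) ^+ 2).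
  by apply: Rintegral_ge0 => u _; exact: sqr_ge0.
have [|e e0 he] := h (\int[mu]_u ((g_ n u - g u) ^+ 2)).
  by rewrite Dn0 (le_trans (ler_norm _) Dn).
have id_ : rintegrable mu (fun u => (g_ n u - g u) ^+ 2).
  apply/integrableP; split.
    by apply/measurable_EFinP; apply: measurable_funX; exact: measurable_funB.
  move: fn; rewrite ge0_fin_numE; last by apply: integral_ge0 => u _; rewrite lee_fin sqr_ge0.
  apply: le_lt_trans; rewrite le_eqVlt; apply/orP; left; apply/eqP.
  by apply: eq_integral => u _ /=; rewrite ger0_norm// sqr_ge0.
rewrite distrC; apply: le_trans he.
exact: kernel_integral_sub.
Qed.

Lemma rintegrable_sqrD (a b : T -> R) : measurable_fun setT a -> measurable_fun setT b ->
  rintegrable mu (fun u => a u ^+ 2) -> rintegrable mu (fun u => b u ^+ 2) ->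
  rintegrable mu (fun u => (a u + b u) ^+ 2).
Proof.
move=> ma mb ia ib.
have i2 := @integrableD _ _ _ _ _ measurableT _ _
  (rintegrableZl 2 ia) (rintegrableZl 2 ib).
apply: (rintegrable_le (g := fun u => 2 * a u ^+ 2 + 2 * b u ^+ 2) _ _ i2).
  by apply: measurable_funX; exact: measurable_funD.
move=> u; rewrite ger0_norm ?sqr_ge0//.
have := sqr_ge0 (a u - b u); lra.
Qed.

Lemma rintegrable_sqrZ (c : R) (a : T -> R) :
  rintegrable mu (fun u => a u ^+ 2) -> rintegrable mu (fun u => (c * a u) ^+ 2).
Proof.
move=> ia; have := rintegrableZl (c ^+ 2) ia.
by congr (_.-integrable _ _); apply/funext => u /=; rewrite exprMn.
Qed.

Lemma rintegrable_sqr_sum (I : Type) (s : seq I) (a : I -> T -> R) :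
  (forall i, measurable_fun setT (a i)) -> (forall i, rintegrable mu (fun u => a i u ^+ 2)) ->
  rintegrable mu (fun u => (\sum_(i <- s) a i u) ^+ 2).
Proof.
move=> ma ia; elim: s => [|i s IH].
  under [X in EFin \o X]eq_fun do rewrite big_nil expr0n/=.
  exact: integrable0.
under [X in EFin \o X]eq_fun do rewrite big_cons.
by apply: rintegrable_sqrD => //; exact: measurable_sum.
Qed.

(** Coefficients at distance at most r give combinations at distance at most r
    times the sum of the |a_j|, which is square integrable. *)
Lemma kernel_integral_near (n : nat) (a : 'I_n -> T -> R) (theta0 : 'rV[R]_n) (eps : R) :
  (forall i, measurable_fun setT (a i)) -> (forall i, rintegrable mu (fun u => a i u ^+ 2)) ->
  0 < eps ->
  \forall theta \near theta0,
    `|\int[mu]_u k (\sum_j (theta : 'rV[R]_n) 0 j * a j u) -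
      \int[mu]_u k (\sum_j theta0 0 j * a j u)| <= eps.
Proof.
move=> ma ia eps0.
pose g (theta : 'rV[R]_n) u := \sum_j theta 0 j * a j u.
have mg theta : measurable_fun setT (g theta).
  by apply: measurable_sum => j; exact: measurable_funM.
have ig theta : rintegrable mu (fun u => g theta u ^+ 2).
  apply: rintegrable_sqr_sum => j; first exact: measurable_funM.
  exact: rintegrable_sqrZ.
pose H u := \sum_j `|a j u|.
have mna j : measurable_fun setT (fun u => `|a j u|) by exact: measurableT_comp.
have mH : measurable_fun setT H by exact: measurable_sum.
have iH : rintegrable mu (fun u => H u ^+ 2).
  apply: rintegrable_sqr_sum => // j.
  by under [X in EFin \o X]eq_fun do rewrite real_normK ?num_real//; exact: ia.
have G0 : 0 <= \int[mu]_u (g theta0 u ^+ 2) by apply: Rintegral_ge0 => u _; exact: sqr_ge0.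
have [eta eta0 h] := two_scale_le V0 G0 eps0.
pose K := \int[mu]_u (H u ^+ 2).
have K0 : 0 <= K by apply: Rintegral_ge0 => u _; exact: sqr_ge0.
(* Chosen so that r^2 K, which bounds the square distance, is at most eta. *)
pose r := Num.sqrt (eta / (K + 1)).
have K1 : 0 < K + 1 by rewrite ltr_wpDl.
have r0 : 0 < r by rewrite sqrtr_gt0 divr_gt0.
have rE : r ^+ 2 * (K + 1) = eta by rewrite sqr_sqrtr ?divfK ?gt_eqF// divr_ge0 ?ltW.
near=> theta.
have th : forall j, `|theta 0 j - theta0 0 j| <= r.
  have : ball theta0 r theta by near: theta; exact: nbhsx_ballx.
  by move=> [_ hb] j; rewrite distrC ltW//; exact: hb.
have dle u : `|g theta u - g theta0 u| <= r * H u.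
  rewrite /g -sumrB (le_trans (ler_norm_sum _ _ _))// mulr_sumr ler_sum// => j _.
  by rewrite -mulrBl normrM ler_wpM2r.
have d2 u : (g theta u - g theta0 u) ^+ 2 <= r ^+ 2 * H u ^+ 2.
  rewrite -exprMn -(real_normK (num_real (_ - _))) ler_sqr ?nnegrE//.
  exact: le_trans (normr_ge0 _) (dle u).
have irH := rintegrableZl (r ^+ 2) iH.
have id_ : rintegrable mu (fun u => (g theta u - g theta0 u) ^+ 2).
  apply: (rintegrable_le (g := fun u => r ^+ 2 * H u ^+ 2) _ _ irH).
    by apply: measurable_funX; exact: measurable_funB.
  by move=> u; rewrite ger0_norm ?sqr_ge0.
have D0 : 0 <= \int[mu]_u ((g theta u - g theta0 u) ^+ 2).
  by apply: Rintegral_ge0 => u _; exact: sqr_ge0.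
have [|e e0 he] := h (\int[mu]_u ((g theta u - g theta0 u) ^+ 2)).
  rewrite D0/= -rE.
  apply: (@le_trans _ _ (r ^+ 2 * K)); last by rewrite ler_wpM2l ?sqr_ge0// lerDl.
  rewrite -RintegralZl//; apply: le_Rintegral => // u _; exact: d2.
apply: le_trans he.
exact: kernel_integral_sub.
Unshelve. all: by end_near. Qed.

End kernel_limits.

(** * Stochastic integrals and finite-dimensional exponents *)

Section stochastic_integral.
Context d (T : measurableType d) (R : realType) (P : probability T R).
Variables (L : R -> {RV P >-> R}).

(** Stated for functions rather than for bundled random variables, so that
    linear combinations can be formed freely. *)
Definition stochastic_integral (g : R -> R) (Y : T -> R) :=
  exists s : nat -> seq (R * (R * R)),
    [/\ forall m, valid_steps (s m),
        (\int[leb]_u ((step_fun (s m) u - g u) ^+ 2)%:E)%E @[m --> \oo] --> 0%E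
      & (\int[P]_w ((step_integral L (s m) w - Y w) ^+ 2)%:E)%E @[m --> \oo] --> 0%E].

Lemma stochastic_integralP (g : R -> R) (Y : {RV P >-> R}) :
  is_levy_integral P L g Y -> stochastic_integral g Y.
Proof.
move=> [_ [s [h1 h2 h3]]]; exists s; split => //.
by move: h3; rewrite unlock.
Qed.

Lemma step_fun_cat (s s' : seq (R * (R * R))) u :
  step_fun (s ++ s') u = step_fun s u + step_fun s' u.
Proof. by rewrite /step_fun big_cat. Qed.

Lemma step_integral_cat (s s' : seq (R * (R * R))) w :
  step_integral L (s ++ s') w = step_integral L s w + step_integral L s' w.
Proof. by rewrite /step_integral big_cat. Qed.

Definition scale_steps (c : R) (s : seq (R * (R * R))) := [seq (c * p.1, p.2) | p <- s].

Lemma step_fun_scale c (s : seq (R * (R * R))) u : step_fun (scale_steps c s) u = c * step_fun s u.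
Proof.
rewrite /step_fun big_map mulr_sumr; apply: eq_bigr => p _ /=.
by case: ifP; rewrite ?mulr0.
Qed.

Lemma step_integral_scale c (s : seq (R * (R * R))) w :
  step_integral L (scale_steps c s) w = c * step_integral L s w.
Proof.
by rewrite /step_integral big_map mulr_sumr; apply: eq_bigr => p _ /=; rewrite mulrA.
Qed.

Lemma valid_scale c s : valid_steps s -> valid_steps (scale_steps c s).
Proof. by rewrite /valid_steps all_map. Qed.

Definition combine_steps (I : Type) (r : seq I) (c : I -> R) (s : I -> seq (R * (R * R))) :=
  flatten [seq scale_steps (c i) (s i) | i <- r].

Lemma step_fun_combine (I : Type) (r : seq I) c s u :
  step_fun (combine_steps r c s) u = \sum_(i <- r) c i * step_fun (s i) u :> R.
Proof.
elim: r => [|i r IH]; first by rewrite /step_fun !big_nil.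
by rewrite big_cons -IH /= step_fun_cat step_fun_scale.
Qed.

Lemma valid_combine (I : Type) (r : seq I) c s :
  (forall i, valid_steps (s i)) -> valid_steps (@combine_steps I r c s).
Proof.
move=> h; elim: r => [//|i r IH]; rewrite /valid_steps /= all_cat.
by apply/andP; split; [exact: valid_scale|exact: IH].
Qed.

Lemma step_integral_combine (I : Type) (r : seq I) c s w :
  step_integral L (combine_steps r c s) w = \sum_(i <- r) c i * step_integral L (s i) w :> R.
Proof.
elim: r => [|i r IH]; first by rewrite /step_integral !big_nil.
by rewrite big_cons -IH /= step_integral_cat step_integral_scale.
Qed.

Lemma cvg_step_fun_combine (I : Type) (r : seq I) (c : I -> R) (g : I -> R -> R)
    (s : I -> nat -> seq (R * (R * R))) :
  (forall i, measurable_fun setT (g i)) ->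
  (forall i, (\int[leb]_u ((step_fun (s i m) u - g i u) ^+ 2)%:E)%E @[m --> \oo] --> 0%E) ->
  (\int[leb]_u ((step_fun (combine_steps r c (s^~ m)) u - \sum_(i <- r) c i * g i u) ^+ 2)%:E)%E
    @[m --> \oo] --> 0%E.
Proof.
move=> mg h.
have E m : (\int[leb]_u ((step_fun (combine_steps r c (s^~ m)) u - \sum_(i <- r) c i * g i u) ^+ 2)%:E =
    \int[leb]_u ((\sum_(i <- r) c i * (step_fun (s i m) u - g i u)) ^+ 2)%:E)%E.
  apply: eq_integral => u _; congr ((_ ^+ 2)%:E).
  by rewrite step_fun_combine -sumrB; apply: eq_bigr => i _; rewrite mulrBr.
rewrite (eq_cvg _ _ E).
have mB i m : measurable_fun setT (fun u => step_fun (s i m) u - g i u).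
  by apply: measurable_funB => //; exact: measurable_step_fun.
exact: (@cvg_sqr_sum _ (measurableTypeR R) R leb _ r c
  (fun i m u => step_fun (s i m) u - g i u) mB h).
Qed.

Lemma stochastic_integral_sum (I : Type) (r : seq I) (c : I -> R) (g : I -> R -> R) (Y : I -> T -> R) :
  (forall i, measurable_fun setT (g i)) -> (forall i, measurable_fun setT (Y i)) ->
  (forall i, stochastic_integral (g i) (Y i)) ->
  stochastic_integral (fun u => \sum_(i <- r) c i * g i u) (fun w => \sum_(i <- r) c i * Y i w).
Proof.
move=> mg mY /choice[s hs]; exists (fun m => combine_steps r c (s^~ m)); split.
- by move=> m; apply: valid_combine => i; have [] := hs i.
- by apply: cvg_step_fun_combine => // i; have [] := hs i.
have E m : (\int[P]_w ((step_integral L (combine_steps r c (s^~ m)) w -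
      \sum_(i <- r) c i * Y i w) ^+ 2)%:E =
    \int[P]_w ((\sum_(i <- r) c i * (step_integral L (s i m) w - Y i w)) ^+ 2)%:E)%E.
  apply: eq_integral => w _; congr ((_ ^+ 2)%:E).
  by rewrite step_integral_combine -sumrB; apply: eq_bigr => i _; rewrite mulrBr.
rewrite (eq_cvg _ _ E); apply: cvg_sqr_sum => i; last by have [] := hs i.
by move=> m; apply: measurable_funB => //; exact: measurable_step_integral.
Qed.

Variables (V : R) (kr ki : R -> R).
Hypotheses (V0 : 0 <= V) (krl : quad_lip V kr) (kil : quad_lip V ki).
Hypothesis chf_steps : forall s, valid_steps s ->
  chf P (step_integral L s) = cexp (- integrated_exponent kr ki (step_fun s)).

Lemma chf_stochastic_integral (g : R -> R) (Y : T -> R) : measurable_fun setT g -> measurable_fun setT Y ->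
  rintegrable leb (fun u => g u ^+ 2) -> stochastic_integral g Y ->
  chf P Y = cexp (- integrated_exponent kr ki g).
Proof.
move=> mg mY ig [s [v c e]].
have mI m : measurable_fun setT (step_integral L (s m)) by exact: measurable_step_integral.
have c1 := cvg_chf_L2 mI mY e.
have c2 : ccvg (fun m => cexp (- integrated_exponent kr ki (step_fun (s m))))
    (cexp (- integrated_exponent kr ki g)).
  by apply: ccvg_cexpN; split => /=; apply: (cvg_kernel_integral V0) => // m;
    exact: measurable_step_fun.
rewrite (_ : (fun m => chf P _) =
  (fun m => cexp (- integrated_exponent kr ki (step_fun (s m))))) in c1.
  exact: ccvg_unique c1 c2.
by apply/funext => m; exact: chf_steps.
Qed.

End stochastic_integral.

Section finite_dimensional_exponent.
Context {R : realType}.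
Variables (V : R) (kr ki : R -> R).
Hypotheses (V0 : 0 <= V) (krl : quad_lip V kr) (kil : quad_lip V ki).
Variable f : R -> R -> R.
Hypothesis mf : forall t, measurable_fun setT (f t).
Hypothesis if2 : forall t, rintegrable leb (fun u => f t u ^+ 2).

(** The exponent of (S_(t_1), ..., S_(t_k)) when S is the process with kernel
    f. *)
Definition fdd_exponent (k : nat) (t theta : 'rV[R]_k) : R[i] :=
  integrated_exponent kr ki (fun u => \sum_j theta 0 j * f (t 0 j) u).

Lemma normc_le_ReIm (z : R[i]) : `|z| <= (`|complex.Re z| + `|complex.Im z|)%:C.
Proof.
case: z => a b; rewrite normc_def lecR /=.
rewrite -[leRHS]ger0_norm ?addr_ge0// -sqrtr_sqr ler_sqrt ?sqr_ge0//.
rewrite sqrrD !real_normK ?num_real// addrAC lerDl mulrn_wge0// mulr_ge0//.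
Qed.

Lemma continuous_fdd_exponent k (t : 'rV[R]_k) : continuous (fdd_exponent t : 'rV[R]_k -> R[i]^o).
Proof.
move=> theta0.
have FF : Filter (nbhs theta0) by exact: nbhs_filter.
suff h : forall e : R[i], 0 < e -> \forall theta \near theta0,
    `|(fdd_exponent t theta0 : R[i]^o) - fdd_exponent t theta| <= e.
  exact: (iffRL (@cvgrPdist_le _ _ _ _ FF _ _) h).
move=> e.
rewrite ltcE => /andP[/eqP Ime Ree] /=.
have e2 : 0 < complex.Re e / 2 by rewrite divr_gt0.
have n1 := @kernel_integral_near _ (measurableTypeR R) R leb V kr V0 krl k
  (fun j => f (t 0 j)) theta0 _ (fun j => mf (t 0 j)) (fun j => if2 (t 0 j)) e2.
have n2 := @kernel_integral_near _ (measurableTypeR R) R leb V ki V0 kil k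
  (fun j => f (t 0 j)) theta0 _ (fun j => mf (t 0 j)) (fun j => if2 (t 0 j)) e2.
near=> theta.
have h1 : `|\int[leb]_u kr (\sum_j theta 0 j * f (t 0 j) u) -
    \int[leb]_u kr (\sum_j theta0 0 j * f (t 0 j) u)| <= complex.Re e / 2.
  by near: theta; exact: n1.
have h2 : `|\int[leb]_u ki (\sum_j theta 0 j * f (t 0 j) u) -
    \int[leb]_u ki (\sum_j theta0 0 j * f (t 0 j) u)| <= complex.Re e / 2.
  by near: theta; exact: n2.
rewrite distrC (le_trans (normc_le_ReIm _))// lecE /= Ime eqxx/=.
by rewrite [leRHS]splitr lerD.
Unshelve. all: by end_near. Qed.

Lemma fdd_exponent0 k (t : 'rV[R]_k) : fdd_exponent t 0 = 0.
Proof.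
rewrite /fdd_exponent; have -> : (fun u => \sum_j (0 : 'rV[R]_k) 0 j * f (t 0 j) u) = fun=> 0.
  by apply/funext => u; rewrite big1// => j _; rewrite mxE mul0r.
by rewrite /integrated_exponent krl.1 kil.1 /Rintegral integral0.
Qed.

Lemma integrated_exponent_dilation (c : R) (g : R -> R) : 0 < c -> measurable_fun setT g ->
  rintegrable leb (fun u => g u ^+ 2) ->
  integrated_exponent kr ki (fun u => g (u / c)) = c%:C * integrated_exponent kr ki g.
Proof.
move=> c0 mg ig; apply: complex_ext.
  rewrite complex_ReM /= mul0r subr0.
  have ik := @integrable_kernel _ (measurableTypeR R) R leb _ _ krl _ mg ig.
  exact: (Rintegral_dilation c0 ik).
rewrite complex_ImM /= mul0r addr0.
have ik := @integrable_kernel _ (measurableTypeR R) R leb _ _ kil _ mg ig.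
exact: (Rintegral_dilation c0 ik).
Qed.

(** The substitution u -> a^delta u in the integral over u. *)
Lemma fdd_exponent_scaling (alpha delta : R)
    (f_scaling : forall t u a : R, 0 < a ->
       f t u = a `^ (alpha - delta / 2) * f (t / a) (u / a `^ delta))
    (a : R) k (theta t : 'rV[R]_k) : 0 < a ->
  fdd_exponent (a *: t) theta =
  (a `^ delta)%:C * fdd_exponent t (a `^ (alpha - delta / 2) *: theta).
Proof.
move=> a0; rewrite /fdd_exponent -integrated_exponent_dilation ?powR_gt0//.
- congr integrated_exponent; apply/funext => u; apply: eq_bigr => j _.
  rewrite !mxE (f_scaling _ u a a0) [a * _]mulrC mulfK ?gt_eqF//.
  by rewrite mulrCA mulrA.
- by apply: measurable_sum => j; exact: measurable_funM.
- have mm j : measurable_fun setT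
      (fun u => (a `^ (alpha - delta / 2) *: theta) 0 j * f (t 0 j) u) by exact: measurable_funM.
  by apply: rintegrable_sqr_sum => j; [exact: mm|exact: rintegrable_sqrZ].
Qed.

End finite_dimensional_exponent.

(** * Almost sure limits *)

Section almost_sure_limit.
Context d (T : measurableType d) (R : realType) (P : probability T R).
Local Open Scope ereal_scope.

(** The inequality |x| <= 2^-n + 2^n x^2 makes the increments summable in
    mean, hence almost surely; an upper limit provides a measurable version of
    the limit. *)
Lemma ae_cvg_of_summable (I_ : nat -> T -> R) (K : R) :
  (forall n, measurable_fun setT (I_ n)) -> (0 <= K)%R ->
  (forall n, \int[P]_w ((I_ n.+1 w - I_ n w) ^+ 2)%:E <= (K * 8^-1 ^+ n)%:E) ->
  exists2 Y : T -> R, measurable_fun setT Y &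
    {ae P, forall w, I_ n w @[n --> \oo] --> Y w}.
Proof.
move=> mI K0 hI.
pose D n w := (I_ n.+1 w - I_ n w)%R.
have mD n : measurable_fun setT (D n) by exact: measurable_funB.
have mDn n : measurable_fun setT (fun w => `|D n w|%:E).
  by apply/measurable_EFinP; exact: measurableT_comp.
have ED n : \int[P]_w `|D n w|%:E <= (2 * (1 + K) / (2 ^ n.+1)%:R)%:E.
  have a0 : (0 < 2^-1 ^+ n :> R)%R by rewrite exprn_gt0// invr_gt0.
  apply: (le_trans (integral_norm_le_sqr P a0 (mD n))).
  apply: (@le_trans _ _ ((2^-1 ^+ n)%:E + (2^-1 ^+ n)^-1%:E * (K * 8^-1 ^+ n)%:E)).
    by rewrite leeD2l// lee_wpmul2l ?hI// lee_fin invr_ge0 ltW.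
  rewrite -EFinM -EFinD lee_fin natrX exprS invfM.
  have -> : (2 * (1 + K) * (2^-1 * (2 ^+ n)^-1) = 2^-1 ^+ n + K * 2^-1 ^+ n :> R)%R.
    by rewrite exprVn; field; rewrite expf_neq0.
  rewrite lerD2l mulrCA ler_wpM2l//.
  have -> : (8^-1 = 2^-1 * (2^-1 * 2^-1) :> R)%R by field.
  rewrite exprMn mulKf ?gt_eqF// exprMn ler_piMr ?(ltW a0)//.
  by rewrite exprn_ile1// ?invr_ge0// invf_le1// ler1n.
have mS : measurable_fun setT (fun w => \sum_(0 <= n <oo) `|D n w|%:E).
  by apply: ge0_emeasurable_sum => // n w _ _; rewrite lee_fin.
have ES : \int[P]_w (\sum_(0 <= n <oo) `|D n w|%:E) < +oo.
  rewrite integral_nneseries//.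
  apply: le_lt_trans (ltry (2 * (1 + K))).
  apply: le_trans (epsilon_trick0 xpredT _); last by rewrite mulr_ge0// addr_ge0.
  by apply: lee_nneseries => [n _ _|n _]; [apply: integral_ge0 => w _; rewrite lee_fin|exact: ED].
have iS : P.-integrable setT (fun w => \sum_(0 <= n <oo) `|D n w|%:E).
  apply/integrableP; split => //; move: ES; congr (_ < _); apply: eq_integral => w _.
  by rewrite gee0_abs// nneseries_ge0// => n _ _; rewrite lee_fin.
have aecv : {ae P, forall w, cvgn (fun n => I_ n w)}.
  apply: filterS (integrable_ae measurableT iS) => w /(_ Logic.I) fS.
  have : cvgn [normed series (fun n => D n w)].
    apply: nondecreasing_is_cvgn.
      by apply: nondecreasing_series => n _ _; rewrite normr_ge0.
    exists (fine (\sum_(0 <= n <oo) `|D n w|%:E)) => _ [n _ <-].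
    rewrite -lee_fin fineK// /series/= -sumEFin.
    by apply: nneseries_lim_ge => m _ _; rewrite lee_fin.
  move=> /normed_cvg; rewrite (_ : series _ = (fun n => I_ n w - I_ 0%N w)%R); last first.
    by have := telescopeK (fun n => I_ n w).
  move=> cv.
  have -> : (fun n => I_ n w) = (fun n => (I_ n w - I_ 0%N w) + I_ 0%N w)%R.
    by apply/funext => n; rewrite subrK.
  by apply: is_cvgD => //; exact: is_cvg_cst.
exists (fun w => fine (limn_esup (fun n => (I_ n w)%:E))).
  apply: measurableT_comp => //; apply: measurable_fun_limn_esup => n.
  exact/measurable_EFinP.
apply: filterS aecv => w cw.
have cE : (I_ n w)%:E @[n --> \oo] --> (limn (fun n => I_ n w))%:E.
  by apply: cvg_EFin => //; exact: nearW.
rewrite is_cvg_limn_esupE; last by apply/cvg_ex; eexists; exact: cE.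
by rewrite (cvg_lim _ cE).
Qed.

End almost_sure_limit.

(** * Time-compressed stochastic integrals *)

Section step_functions.
Context {R : realType}.

Lemma rintegrable_step_sqr (s : seq (R * (R * R))) : rintegrable leb (fun u => step_fun s u ^+ 2).
Proof.
elim: s => [|p s IH].
  under [X in EFin \o X]eq_fun do rewrite /step_fun big_nil expr0n/=.
  exact: integrable0.
under [X in EFin \o X]eq_fun do rewrite step_fun_cons.
have i1 : rintegrable leb (\1_`]p.2.1, p.2.2] : R -> R) by exact: integrable_indic_itv.
have mE : measurable_fun setT (fun u => if p.2.1 < u <= p.2.2 then p.1 else 0).
  have := measurable_step_fun [:: p].
  by congr measurable_fun; apply/funext => u; rewrite /step_fun big_seq1.
apply: (@rintegrable_sqrD _ (measurableTypeR R) R leb _ _ mE (measurable_step_fun s) _ IH).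
have := rintegrableZl (p.1 ^+ 2) i1.
congr (_.-integrable _ _); apply/funext => u /=; congr (_%:E).
rewrite indicE; case: ifP => hu.
  by rewrite mem_set ?mulr1//= in_itv/=.
by rewrite memNset ?mulr0 ?expr0n//= in_itv/= hu.
Qed.

Definition dilate_steps (c : R) (s : seq (R * (R * R))) :=
  [seq (p.1, (c * p.2.1, c * p.2.2)) | p <- s].

Lemma step_fun_dilate c (s : seq (R * (R * R))) u : 0 < c ->
  step_fun (dilate_steps c s) u = step_fun s (u / c).
Proof.
move=> c0; rewrite /step_fun big_map; apply: eq_bigr => p _ /=.
by rewrite ltr_pdivlMr// ler_pdivrMr// ![c * _]mulrC.
Qed.

Lemma valid_dilate c s : 0 < c -> valid_steps s -> valid_steps (dilate_steps c s).
Proof.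
move=> c0; rewrite /valid_steps all_map; apply: sub_all => p /=.
by rewrite ler_pM2l.
Qed.

End step_functions.

Section roots.
Context d (T : measurableType d) (R : realType) (P : probability T R).
Variables (L : R -> {RV P >-> R}).
Variables (V : R) (kr ki : R -> R).
Hypotheses (V0 : 0 <= V) (krl : quad_lip V kr) (kil : quad_lip V ki).
Hypothesis kr_ge0 : forall x, 0 <= kr x.
Hypothesis chf_steps : forall s, valid_steps s ->
  chf P (step_integral L s) = cexp (- integrated_exponent kr ki (step_fun s)).

Let mI s : measurable_fun setT (step_integral L s).
Proof. exact: measurable_step_integral. Qed.

(** A substitute for the isometry: for x times the integral, both parts of the
    exponent are bounded by V x^2 Q, with Q the square integral of the step
    function, and integral_sqr_le_of_cos converts this into a second moment.
    The term in Q^2 comes from the imaginary part. *)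
Lemma step_integral_sqr_le s : valid_steps s ->
  (\int[P]_w (step_integral L s w ^+ 2)%:E <=
   (2 * V * (\int[leb]_u (step_fun s u ^+ 2)) +
    V ^+ 2 * (\int[leb]_u (step_fun s u ^+ 2)) ^+ 2)%R%:E)%E.
Proof.
move=> vs; set Q : R := \int[leb]_u (step_fun s u ^+ 2).
have Q0 : 0 <= Q by apply: Rintegral_ge0 => u _; exact: sqr_ge0.
apply: (@integral_sqr_le_of_cos _ _ _ _ _ _ 1) => // x /andP[x0 x1].
have mxI : measurable_fun setT (fun w => x * step_integral L s w) by exact: measurable_funM.
have -> : (\int[P]_w (1 - cos (x * step_integral L s w))%:E =
    (\int[P]_w (1 - cos (x * step_integral L s w)))%:E)%E.
  by rewrite /Rintegral fineK//; exact: integrable_fin_num (integrable_one_sub_cos_law P mxI).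
rewrite lee_fin Rintegral_one_sub_cos//.
have -> : (fun w => x * step_integral L s w) = step_integral L (scale_steps x s).
  by apply/funext => w; rewrite step_integral_scale.
rewrite chf_steps; last exact: valid_scale.
pose A := \int[leb]_u kr (x * step_fun s u); pose B := \int[leb]_u ki (x * step_fun s u).
have E1 : integrated_exponent kr ki (step_fun (scale_steps x s)) = A +i* B.
  by congr (_ +i* _); apply: eq_Rintegral => u _; rewrite step_fun_scale.
rewrite E1 Re_cexp /=.
have is2 := rintegrable_step_sqr s.
have bnd k : quad_lip V k -> `|\int[leb]_u k (x * step_fun s u)| <= V * x ^+ 2 * Q.
  move=> kl.
  have mxs : measurable_fun setT (fun u => x * step_fun s u).
    by apply: measurable_funM => //; exact: measurable_step_fun.
  have ixs : rintegrable leb (fun u => (x * step_fun s u) ^+ 2) by exact: rintegrable_sqrZ.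
  have ik := @integrable_kernel _ (measurableTypeR R) R leb _ _ kl _ mxs ixs.
  rewrite (le_trans (le_normr_Rintegral _ ik))// -RintegralZl//.
  apply: le_Rintegral => //.
  - exact: integrable_norm ik.
  - exact: (rintegrableZl (V * x ^+ 2) is2).
  - by move=> u _; rewrite (le_trans (quad_lip_sqr _ kl))// exprMn mulrA.
have hA : A <= V * x ^+ 2 * Q by rewrite (le_trans (ler_norm _))// bnd.
have A0 : 0 <= A by apply: Rintegral_ge0 => u _; exact: kr_ge0.
have hB : B ^+ 2 <= (V * x ^+ 2 * Q) ^+ 2.
  rewrite -(real_normK (num_real B)) ler_sqr ?nnegrE ?bnd//.
  by rewrite mulr_ge0// mulr_ge0// sqr_ge0.
have h1 := expR_ge1Dx (- A); have h2 := one_sub_cos_le_sqr B.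
have h3 : expR (- A) <= 1 by rewrite -expR0 ler_expR oppr_le0.
rewrite cosN.
have h4 : 1 - expR (- A) * cos B <= A + B ^+ 2 / 2.
  have := expR_ge0 (- A); have := one_sub_cos_ge0 B; nra.
rewrite (le_trans h4)//.
have x4 : (V * x ^+ 2 * Q) ^+ 2 <= x ^+ 2 * (V ^+ 2 * Q ^+ 2).
  have -> : (V * x ^+ 2 * Q) ^+ 2 = x ^+ 2 * (x ^+ 2 * (V ^+ 2 * Q ^+ 2)) by ring.
  rewrite ler_wpM2l ?sqr_ge0// ler_piMl ?mulr_ge0 ?sqr_ge0// expr_le1// ltW//.
move: x4 hB hA; lra.
Qed.

(** Dilation by c multiplies the square integral of a step function by c, so
    that the integrals of the dilated steps are Cauchy whenever the steps are,
    and a subsequence with geometric rate converges almost surely. The limit U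
    is the integral of u -> g (u / c). *)
Lemma exists_compressed_integral (c : R) (g : R -> R) (Y : T -> R) : 0 < c <= 1 ->
  measurable_fun setT g -> stochastic_integral L g Y ->
  exists (r : nat -> seq (R * (R * R))) (U : T -> R),
    [/\ forall m, valid_steps (r m), measurable_fun setT U,
        (\int[leb]_u ((step_fun (r m) u - g u) ^+ 2)%:E)%E @[m --> \oo] --> 0%E
      & {ae P, forall w, step_integral L (dilate_steps c (r m)) w @[m --> \oo] --> U w}].
Proof.
move=> /andP[c0 c1] mg [s [vs cs _]].
(* The rate 8^-i beats the factor 2^i of the almost sure convergence
   criterion. *)
have eps0 i : 0 < 8^-1 ^+ i :> R by rewrite exprn_gt0// invr_gt0.
have small i : exists m, (\int[leb]_u ((step_fun (s m) u - g u) ^+ 2)%:E <= (8^-1 ^+ i)%:E)%E.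
  have /fine_cvgP[fin /cvgrPdist_le /(_ _ (eps0 i))] := cs.
  move=> /(filterI fin) [N _ /(_ N (leqnn N)) [fN]]; rewrite /= sub0r normrN => h.
  by exists N; rewrite -(fineK fN) lee_fin (le_trans (ler_norm _) h).
have [phi hphi] := choice small.
pose r m := s (phi m).
have mstep m : measurable_fun setT (fun u => step_fun (r m) u - g u).
  by apply: measurable_funB => //; exact: measurable_step_fun.
pose D m := dilate_steps c (combine_steps [:: true; false]
  (fun b : bool => if b then 1 else -1) (fun b : bool => if b then r m.+1 else r m)).
have vD m : valid_steps (D m).
  by apply: valid_dilate => //; apply: valid_combine => -[]; exact: vs.
have ID m w : step_integral L (D m) w = step_integral L (dilate_steps c (r m.+1)) w -
    step_integral L (dilate_steps c (r m)) w.
  have dil t : step_integral L (dilate_steps c t) w =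
      \sum_(p <- t) p.1 * (L (c * p.2.2) w - L (c * p.2.1) w).
    by rewrite /step_integral big_map.
  rewrite !dil /combine_steps /= cats0 big_cat /= !big_map/=.
  rewrite (eq_bigr (fun p => p.1 * (L (c * p.2.2) w - L (c * p.2.1) w))); last first.
    by move=> p _; rewrite mul1r.
  by congr (_ + _); rewrite -sumrN; apply: eq_bigr => p _; rewrite !mulNr mul1r.
pose q m := \int[leb]_u (step_fun (D m) u ^+ 2).
have qle m : q m <= 4 * 8^-1 ^+ m.
  have stepD u : step_fun (D m) u = (step_fun (r m.+1) (u / c) - step_fun (r m) (u / c)).
    rewrite step_fun_dilate// step_fun_combine !big_cons big_nil.
    by rewrite mul1r mulN1r addr0.
  have fE : (\int[leb]_u (step_fun (D m) u ^+ 2)%:E = c%:E * \int[leb]_u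
      ((step_fun (r m.+1) u - step_fun (r m) u) ^+ 2)%:E)%E.
    rewrite -(@ge0_integral_dilation _ c (fun u => ((step_fun (r m.+1) u - step_fun (r m) u) ^+ 2)%:E) c0).
    - by apply: eq_integral => u _; rewrite stepD.
    - apply/measurable_EFinP; apply: measurable_funX.
      by apply: measurable_funB; exact: measurable_step_fun.
    - by move=> u; rewrite lee_fin sqr_ge0.
  have dle : (\int[leb]_u ((step_fun (r m.+1) u - step_fun (r m) u) ^+ 2)%:E <= (4 * 8^-1 ^+ m)%:E)%E.
    have mN : measurable_fun setT (fun u => - (step_fun (r m) u - g u)).
      by apply: measurableT_comp.
    have := integral_sqrD_le leb (mstep m.+1) mN.
    under eq_integral do rewrite opprB addrA subrK.
    under [X in (_ <= _ + 2%:E * X)%E -> _]eq_integral do rewrite sqrrN.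
    move=> h; apply: (le_trans h).
    have e1 := hphi m.+1; have e2 := hphi m.
    apply: (@le_trans _ _ (2%:E * (8^-1 ^+ m)%:E + 2%:E * (8^-1 ^+ m)%:E)%E).
      apply: leeD; apply: lee_wpmul2l; rewrite ?lee_fin// ?(le_trans e1)// lee_fin exprS.
      by rewrite ler_piMl ?(ltW (eps0 m))// invf_le1// ler1n.
    by rewrite -EFinM -EFinD lee_fin; lra.
  have fin := integrable_fin_num measurableT (rintegrable_step_sqr (D m)).
  rewrite -lee_fin /q /Rintegral fineK; last exact: fin.
  rewrite fE; apply: le_trans dle; rewrite -[leRHS]mul1e.
  apply: lee_wpmul2r; last by rewrite lee_fin.
  by apply: integral_ge0 => u _; rewrite lee_fin sqr_ge0.
have q0 m : 0 <= q m by apply: Rintegral_ge0 => u _; exact: sqr_ge0.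
have [||m|U mU cU] := @ae_cvg_of_summable _ _ _ P
    (fun m => step_integral L (dilate_steps c (r m))) (8 * V + 16 * V ^+ 2).
- by move=> m; exact: mI.
- by rewrite addr_ge0// mulr_ge0// sqr_ge0.
- under eq_integral do rewrite -ID.
  apply: le_trans (step_integral_sqr_le (vD m)) _.
  rewrite lee_fin -/(q m).
  have h1 := qle m; have h0 := q0 m.
  have e1 : 8^-1 ^+ m <= 1 :> R by rewrite exprn_ile1// ?invr_ge0// invf_le1// ler1n.
  have h2 : q m ^+ 2 <= 16 * 8^-1 ^+ m.
    apply: (@le_trans _ _ ((4 * 8^-1 ^+ m) ^+ 2)); first by rewrite ler_sqr ?nnegrE// mulr_ge0// ltW.
    have := eps0 m; nra.
  have h3 : V * q m <= V * (4 * 8^-1 ^+ m) by rewrite ler_wpM2l.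
  have h4 : V ^+ 2 * q m ^+ 2 <= V ^+ 2 * (16 * 8^-1 ^+ m) by rewrite ler_wpM2l ?sqr_ge0.
  lra.
exists r, U; split => //.
- by move=> m; exact: vs.
- apply: (@squeeze_cvge _ _ _ _ (cst 0%E) _ (fun m => (8^-1 ^+ m)%:E)).
  + apply: nearW => m; rewrite hphi andbT.
    by apply: integral_ge0 => u _; rewrite lee_fin sqr_ge0.
  + exact: cvg_cst.
  + apply: cvg_EFin; first exact: nearW.
    by apply: cvg_expr; rewrite ger0_norm ?invr_ge0// invf_lt1// ltr1n.
Qed.

End roots.

(** * Infinite divisibility *)

Lemma cvg_sum_seq (R : realType) (I : Type) (r : seq I) (u : I -> nat -> R) (l : I -> R) :
  (forall i, u i n @[n --> \oo] --> l i) ->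
  \sum_(i <- r) u i n @[n --> \oo] --> \sum_(i <- r) l i.
Proof.
move=> h; elim: r => [|i r IH].
  by under eq_fun do rewrite big_nil; rewrite big_nil; exact: cvg_cst.
by under eq_fun do rewrite big_cons; rewrite big_cons; apply: cvgD.
Qed.

Section infinite_divisibility.
Context d (T : measurableType d) (R : realType) (P : probability T R).
Variables (L : R -> {RV P >-> R}).
Variables (V : R) (kr ki : R -> R).
Hypotheses (V0 : 0 <= V) (krl : quad_lip V kr) (kil : quad_lip V ki).
Hypothesis kr_ge0 : forall x, 0 <= kr x.
Hypothesis chf_steps : forall s, valid_steps s ->
  chf P (step_integral L s) = cexp (- integrated_exponent kr ki (step_fun s)).

(** The integrals of u -> g_j (u / c) have an exponent c times that of the
    integrals of the g_j, by the substitution u -> c u. *)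
Lemma exists_root_vector (k : nat) (g : 'I_k -> R -> R) (Y : 'I_k -> T -> R) (c : R) :
  0 < c <= 1 -> (forall j, measurable_fun setT (g j)) ->
  (forall j, rintegrable leb (fun u => g j u ^+ 2)) ->
  (forall j, stochastic_integral L (g j) (Y j)) ->
  exists U : 'I_k -> T -> R, (forall j, measurable_fun setT (U j)) /\
    forall theta : 'I_k -> R, chf P (fun w => \sum_j theta j * U j w) =
      cexp (- (c%:C * integrated_exponent kr ki (fun u => \sum_j theta j * g j u))).
Proof.
move=> c01 mg ig hY; have /andP[c0 c1] := c01.
have ex j : exists rU : (nat -> seq (R * (R * R))) * (T -> R),
    [/\ forall m, valid_steps (rU.1 m), measurable_fun setT rU.2,
        (\int[leb]_u ((step_fun (rU.1 m) u - g j u) ^+ 2)%:E)%E @[m --> \oo] --> 0%E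
      & {ae P, forall w, step_integral L (dilate_steps c (rU.1 m)) w @[m --> \oo] --> rU.2 w}].
  have [r [U h]] := exists_compressed_integral V0 krl kil kr_ge0 chf_steps c01 (mg j) (hY j).
  by exists (r, U).
have [rU hrU] := choice ex.
exists (fun j => (rU j).2); split => [j|theta]; first by have [] := hrU j.
have mgs : measurable_fun setT (fun u => \sum_j theta j * g j u).
  by apply: measurable_sum => j; exact: measurable_funM.
have mm (a : R) (h : R -> R) : measurable_fun setT h -> measurable_fun setT (fun u => a * h u).
  by move=> mh; exact: measurable_funM.
have igs : rintegrable leb (fun u => (\sum_j theta j * g j u) ^+ 2).
  apply: (@rintegrable_sqr_sum _ (measurableTypeR R) R leb _ _ (fun j u => theta j * g j u)) => j.
    exact: mm.
  exact: rintegrable_sqrZ.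
pose C m := combine_steps (index_enum 'I_k) theta (fun j => (rU j).1 m).
pose Cd m := combine_steps (index_enum 'I_k) theta (fun j => dilate_steps c ((rU j).1 m)).
have vC m : valid_steps (Cd m).
  by apply: valid_combine => j; apply: valid_dilate => //; have [] := hrU j.
have c1' : ccvg (fun m => chf P (step_integral L (Cd m)))
    (chf P (fun w => \sum_j theta j * (rU j).2 w)).
  apply: cvg_chf_ae.
  - by move=> m; exact: measurable_step_integral.
  - by apply: measurable_sum => j; apply: measurable_funM => //; have [] := hrU j.
  - have : {ae P, forall w, forall j, step_integral L (dilate_steps c ((rU j).1 m)) w @[m --> \oo] --> (rU j).2 w}.
      have H : forall s : seq 'I_k, {ae P, forall w, forall j, j \in s ->
          step_integral L (dilate_steps c ((rU j).1 m)) w @[m --> \oo] --> (rU j).2 w}.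
        elim=> [|j s IH]; first by apply: aeW.
        have [_ _ _ hj] := hrU j.
        apply: filterS2 hj IH => w hj hs i; rewrite in_cons => /orP[/eqP ->//|]; exact: hs.
      by apply: filterS (H (index_enum 'I_k)) => w h j; apply: h; rewrite mem_index_enum.
    apply: filterS => w hw.
    under eq_fun do rewrite step_integral_combine.
    by apply: cvg_sum_seq => j; apply: cvgMr; exact: hw.
have e m : chf P (step_integral L (Cd m)) =
    cexp (- (c%:C * integrated_exponent kr ki (step_fun (C m)))).
  rewrite chf_steps//; congr (cexp (- _)).
  rewrite -(integrated_exponent_dilation krl kil c0 (measurable_step_fun _) (rintegrable_step_sqr _)).
  congr integrated_exponent; apply/funext => u.
  rewrite !step_fun_combine; apply: eq_bigr => j _.
  by rewrite step_fun_dilate.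
have cC : (\int[leb]_u ((step_fun (C m) u - \sum_j theta j * g j u) ^+ 2)%:E)%E @[m --> \oo] --> 0%E.
  by apply: cvg_step_fun_combine => // j; have [] := hrU j.
have c2 : ccvg (fun m => c%:C * integrated_exponent kr ki (step_fun (C m)))
    (c%:C * integrated_exponent kr ki (fun u => \sum_j theta j * g j u)).
  apply: ccvgM; first by split; exact: cvg_cst.
  by split => /=; apply: (cvg_kernel_integral V0) => // m; exact: measurable_step_fun.
have {}c2 := ccvg_cexpN c2.
rewrite (_ : (fun m => chf P _) =
  (fun m => cexp (- (c%:C * integrated_exponent kr ki (step_fun (C m)))))) in c1'.
  exact: ccvg_unique c1' c2.
by apply/funext => m; exact: e.
Qed.

Lemma cexp_natM (z : R[i]) n : cexp (n%:R * z) = cexp z ^+ n.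
Proof.
elim: n => [|n IH]; first by rewrite mul0r cexp0 expr0.
by rewrite -natr1 mulrDl mul1r cexpD IH exprSr.
Qed.

(** The sum of n independent copies of a vector with exponent psi / n has
    exponent psi, and the exponent determines the law. *)
Lemma infinitely_divisible_of_roots (k : nat) (X : T -> k.-tuple R) (psi : ('I_k -> R) -> R[i]) :
  measurable_fun setT X ->
  (forall theta, chf P (fun w => \sum_j theta j * tnth (X w) j) = cexp (- psi theta)) ->
  (forall n, (0 < n)%N -> exists U : 'I_k -> T -> R, (forall j, measurable_fun setT (U j)) /\
    forall theta, chf P (fun w => \sum_j theta j * U j w) = cexp (- ((n%:R^-1)%:C * psi theta))) ->
  infinitely_divisible_vector P X.
Proof.
move=> mX chfX roots n n0.
have [U [mU chfU]] := roots n n0.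
pose W w := [tuple U j w | j < k].
have mW : measurable_fun setT W.
  apply/measurable_fun_tnthP => j.
  by rewrite (_ : _ \o _ = U j)//; apply/funext => w /=; rewrite tnth_mktuple.
have [d' [T' [P' [Z [indZ lawZ]]]]] := exists_iid_copies P n mW.
have mZ i : measurable_fun setT (Z i) by exact: measurable_funP.
exists d', T', P', Z; split => //.
  by move=> i j B mB; rewrite (lawZ i B mB) (lawZ j B mB).
have mS : measurable_fun setT (fun w => [tuple \sum_(i < n) tnth (Z i w) j | j < k]).
  apply/measurable_fun_tnthP => j.
  rewrite (_ : _ \o _ = fun w => \sum_(i < n) tnth (Z i w) j); last first.
    by apply/funext => w /=; rewrite tnth_mktuple.
  by apply: measurable_sum => i; exact: (measurableT_comp (measurable_tnth j) (mZ i)).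
apply: (same_law_of_chf mX mS) => theta.
rewrite chfX.
pose lin (v : k.-tuple R) := \sum_j theta j * tnth v j.
have mlin : measurable_fun setT lin.
  by apply: measurable_sum => j; apply: measurable_funM => //; exact: measurable_tnth.
have mlZ i : measurable_fun setT (fun w => lin (Z i w)) by exact: (measurableT_comp mlin (mZ i)).
have -> : (fun w => \sum_j theta j * tnth [tuple \sum_(i < n) tnth (Z i w) j0 | j0 < k] j) =
    (fun w => \sum_(i < n) 1 * lin (Z i w)).
  apply/funext => w; rewrite /lin.
  under eq_bigr do rewrite tnth_mktuple mulr_sumr.
  by rewrite exchange_big; apply: eq_bigr => i _; rewrite mul1r.
have indlin : mutually_independent_rv P' (fun i w => lin (Z i w)).
  move=> J E hE; apply: indZ => i iJ; have [B mB <-] := hE i iJ.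
  exists (lin @^-1` B) => //.
  by rewrite -[X in measurable X]setTI; exact: mlin.
rewrite (chf_independent (fun=> 1) mlZ indlin).
have chfZ i : chf P' (fun w => 1 * lin (Z i w)) = cexp (- ((n%:R^-1)%:C * psi theta)).
  rewrite -chfU.
  have sl : same_law P' (fun w => lin (Z i w)) P (fun w => lin (W w)).
    move=> B mB; apply: (lawZ i (lin @^-1` B)).
    by rewrite -[X in measurable X]setTI; exact: mlin.
  rewrite (chf_same_law 1 (mlZ i) (measurableT_comp mlin mW) sl).
  congr (chf P _); apply/funext => w; rewrite mul1r /lin.
  by apply: eq_bigr => j _; rewrite tnth_mktuple.
rewrite (eq_bigr _ (fun i _ => chfZ i)) prodr_const card_ord -cexp_natM; congr cexp.
rewrite mulrN mulrA -[n%:R]/(n%:R : R[i]) -(rmorph_nat (real_complex R)) -rmorphM/=.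
by rewrite mulfV ?mul1r// pnatr_eq0 -lt0n.
Qed.

End infinite_divisibility.

(** * Uniqueness of the parameters *)

(** As x -> 0, the functional equation at a = 2 compares quadratic
    coefficients and gives the equality of alpha and alpha'. If delta and
    delta' differed, the equation at x = a^(- (alpha - delta/2)) would read r
    1 = r b / b^2 for every b > 0, and the limit b -> 0 would give r 1 = W /
    2. *)
Lemma parameters_unique (R : realType) (r : R -> R) (W alpha delta alpha' delta' : R) : 0 < W ->
  (forall u : nat -> R, (forall n, 0 < u n) -> u n @[n --> \oo] --> (0 : R) ->
     r (u n) / u n ^+ 2 @[n --> \oo] --> W / 2) ->
  r 1 < W / 2 ->
  (forall a x, 0 < a -> a `^ delta * r (a `^ (alpha - delta / 2) * x) =
     a `^ delta' * r (a `^ (alpha' - delta' / 2) * x)) ->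
  alpha' = alpha /\ delta' = delta.
Proof.
move=> W0 rlim r1 req.
have a0 : (0 : R) < 2 by [].
pose x n : R := n.+1%:R^-1.
have x0 n : 0 < x n by rewrite invr_gt0.
have cx : x n @[n --> \oo] --> (0 : R) by exact: cvg_harmonic.
have pinj (p q : R) : 2 `^ p = 2 `^ q -> p = q.
  move=> /(congr1 (@ln R)); rewrite !ln_powR; apply: mulIf.
  by rewrite gt_eqF// ln_gt0// ltr1n.
have lim al de : 2 `^ de * r (2 `^ (al - de / 2) * x n) / x n ^+ 2 @[n --> \oo] -->
    2 `^ (al * 2) * (W / 2).
  pose c : R := 2 `^ (al - de / 2).
  have c0 : 0 < c by rewrite powR_gt0.
  have := rlim (fun n => c * x n) (fun n => mulr_gt0 c0 (x0 n)).
  have cc : c * x n @[n --> \oo] --> (0 : R).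
    by rewrite -[X in _ --> X](mulr0 c); apply: cvgMr; exact: cx.
  move=> /(_ cc) l.
  suff E n : 2 `^ de * r (c * x n) / x n ^+ 2 = 2 `^ (al * 2) * (r (c * x n) / (c * x n) ^+ 2).
    by rewrite (eq_cvg _ _ E); apply: cvgMr; exact: l.
  have -> : 2 `^ (al * 2) = 2 `^ de * c ^+ 2.
    rewrite -(powR_mulrn _ (ltW c0)) /c -powRrM -powRD; last by rewrite pnatr_eq0 implybT.
    by congr (_ `^ _); field.
  by field; rewrite !gt_eqF.
have aE : alpha' = alpha.
  have l1 := lim alpha delta; have l2 := lim alpha' delta'.
  have E n : 2 `^ delta * r (2 `^ (alpha - delta / 2) * x n) / x n ^+ 2 =
             2 `^ delta' * r (2 `^ (alpha' - delta' / 2) * x n) / x n ^+ 2.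
    by rewrite req.
  rewrite (eq_cvg _ _ E) in l1.
  have : 2 `^ (alpha * 2) * (W / 2) = 2 `^ (alpha' * 2) * (W / 2) by exact: (cvg_unique _ l1 l2).
  move=> /(mulIf _) -/(_ (lt0r_neq0 (divr_gt0 W0 a0))) /pinj.
  by move=> /(mulIf _) -/(_ (lt0r_neq0 a0)).
split => //; apply/eqP; apply/negPn/negP => dd.
have dn : delta - delta' != 0 by rewrite subr_eq0 eq_sym.
have key b : 0 < b -> r 1 = r b / b ^+ 2.
  (* The exponent is such that a^((delta - delta') / 2) = b. *)
  move=> b0; pose a := b `^ (2 / (delta - delta')).
  have ap : 0 < a by rewrite powR_gt0.
  have := req a (a `^ (- (alpha - delta / 2))) ap.
  have an : a != 0 by rewrite gt_eqF.
  have ai p : p ==> (a != 0) by rewrite an implybT.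
  rewrite -!powRD ?ai// subrr powRr0 aE.
  have -> : alpha - delta' / 2 - (alpha - delta / 2) = (delta - delta') / 2 by field.
  have -> : a `^ ((delta - delta') / 2) = b.
    rewrite /a -powRrM (_ : _ * _ = 1) ?powRr1 ?(ltW b0)//; by field.
  have -> : a `^ delta = a `^ delta' * b ^+ 2.
    rewrite -(powR_mulrn _ (ltW b0)) /a -!powRrM -powRD; last by rewrite [b == 0]gt_eqF// implybT.
    by congr (_ `^ _); field.
  rewrite -mulrA => /(mulfI _) -/(_ (lt0r_neq0 (powR_gt0 _ ap))) <-.
  by rewrite mulrAC mulfV ?mul1r// expf_neq0// gt_eqF.
have := rlim x x0 cx; rewrite -(eq_cvg _ _ (fun n => key _ (x0 n))) => l.
have : r 1 = W / 2 by apply: (cvg_unique _ _ l) => //; exact: cvg_cst.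
by move: r1 => /[swap] ->; rewrite ltxx.
Qed.

Section strictness.
Context {R : realType}.
Variable mu : {measure set R -> \bar R}.
Hypothesis mu2 : rintegrable mu (fun x => x ^+ 2).

Lemma cvg_one_sub_cos (u : nat -> R) (y : R) : (forall n, 0 < u n) ->
  u n @[n --> \oo] --> (0 : R) -> (1 - cos (u n * y)) / u n ^+ 2 @[n --> \oo] --> y ^+ 2 / 2.
Proof.
move=> u0 cu.
apply: (@cvg_of_norm_le _ _ (fun n => u n * `|y| ^+ 3)); last first.
  by rewrite -[X in _ --> X](mul0r (`|y| ^+ 3)); apply: cvgMl; exact: cu.
move=> n; have h1 := one_sub_cos_ge (u n * y); have h2 := one_sub_cos_le_sqr (u n * y).
have un := u0 n; have un2 : 0 < u n ^+ 2 by rewrite exprn_gt0.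
move: h1 h2; rewrite normrM (gtr0_norm un) !exprMn => h1 h2.
have p3 : 0 <= `|y| ^+ 3 by rewrite exprn_ge0.
rewrite ler_norml; apply/andP; split.
  rewrite lerBrDr ler_pdivlMr//.
  have : 0 <= u n ^+ 3 * `|y| ^+ 3 by rewrite mulr_ge0// exprn_ge0// ltW.
  lra.
rewrite lerBlDr ler_pdivrMr//.
have : 0 <= u n ^+ 3 * `|y| ^+ 3 by rewrite mulr_ge0// exprn_ge0// ltW.
lra.
Qed.

Lemma cvg_exponent_re (u : nat -> R) (y : R) : (forall n, 0 < u n) ->
  u n @[n --> \oo] --> (0 : R) ->
  exponent_re mu (u n * y) / u n ^+ 2 @[n --> \oo] --> second_moment mu * (y ^+ 2 / 2).
Proof.
move=> u0 cu.
have sc c : rintegrable mu (fun x => c * x ^+ 2).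
  exact: (rintegrableZl c mu2).
have E n : exponent_re mu (u n * y) / u n ^+ 2 =
    \int[mu]_x ((1 - cos (u n * (y * x))) / u n ^+ 2).
  rewrite RintegralZr//.
    by congr (_ / _); apply: eq_Rintegral => x _; rewrite mulrA.
  have := integrable_one_sub_cos mu2 (u n * y).
  by congr (_.-integrable _ _); apply/funext => x /=; rewrite mulrA.
rewrite (eq_cvg _ _ E) mulrC -RintegralZl//.
apply: (@cvg_Rintegral_dominated _ _ R mu _ _ (fun x => y ^+ 2 / 2 * x ^+ 2)).
- move=> n; apply: measurable_funM => //.
  apply: measurable_funB => //; apply: measurable_cos.
  by apply: measurable_funM => //; exact: measurable_funM.
- by apply: measurable_funM => //; exact: measurable_funX.
- exact: sc.
- move=> n x; have un2 : 0 < u n ^+ 2 by rewrite exprn_gt0.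
  rewrite normrM ger0_norm ?one_sub_cos_ge0// ger0_norm ?invr_ge0 ?(ltW un2)//.
  rewrite ler_pdivrMr// (le_trans (one_sub_cos_le_sqr _))// !exprMn; lra.
- apply: aeW => x.
  have := @cvg_one_sub_cos u (y * x) u0 cu.
  by rewrite exprMn mulrAC.
Qed.

(** Equality would force 1 - cos (y x) = (y x)^2 / 2, hence x = 0, for mu-
    almost every x. *)
Lemma exponent_re_lt (y : R) : 0 < second_moment mu -> y != 0 ->
  exponent_re mu y < second_moment mu * (y ^+ 2 / 2).
Proof.
move=> V0 y0; rewrite lt_neqAle exponent_re_le// andbT; apply/negP => /eqP e.
have sc := rintegrableZl (y ^+ 2 / 2) mu2.
have ic := integrable_one_sub_cos mu2 y.
have ih : rintegrable mu (fun x => y ^+ 2 / 2 * x ^+ 2 - (1 - cos (y * x))).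
  exact: (rintegrableB sc ic).
have h0 x : 0 <= y ^+ 2 / 2 * x ^+ 2 - (1 - cos (y * x)).
  by rewrite subr_ge0 (le_trans (one_sub_cos_le_sqr _))// exprMn mulrAC.
have E0 : \int[mu]_x (y ^+ 2 / 2 * x ^+ 2 - (1 - cos (y * x))) = 0.
  by rewrite RintegralB// RintegralZl// -/(exponent_re mu y) e mulrC subrr.
have ae0 := Rintegral_eq0_ae ih h0 E0.
have : second_moment mu = \int[mu]_x 0.
  have mx2 : measurable_fun setT (fun x : R => x ^+ 2) by exact: measurable_funX.
  apply: (ae_eq_Rintegral mx2) => //.
  apply: filterS ae0 => x /eqP; rewrite subr_eq0 => /eqP hx.
  have [->|x0] := eqVneq x 0; first by rewrite expr0n.
  have := one_sub_cos_lt_sqr (mulf_neq0 y0 x0).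
  by rewrite -hx exprMn mulrAC ltxx.
rewrite [X in _ = X]/Rintegral integral0 /= => V00.
by move: V0; rewrite V00 ltxx.
Qed.

Variable g : R -> R.
Hypothesis mg : measurable_fun setT g.
Hypothesis ig : rintegrable leb (fun u => g u ^+ 2).

Let kl : quad_lip (second_moment mu) (exponent_re mu).
Proof. split; [exact: exponent_re0|exact: exponent_re_lip]. Qed.

Let mk : measurable_fun setT (exponent_re mu).
Proof. exact: continuous_measurable_fun (quad_lip_continuous kl). Qed.

Let iZ c : rintegrable leb (fun u => c * g u ^+ 2).
Proof. exact: (rintegrableZl c ig). Qed.

Lemma cvg_integral_exponent_re (u : nat -> R) : (forall n, 0 < u n) ->
  u n @[n --> \oo] --> (0 : R) ->
  (\int[leb]_v exponent_re mu (u n * g v)) / u n ^+ 2 @[n --> \oo] -->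
  (second_moment mu * \int[leb]_v (g v ^+ 2)) / 2.
Proof.
move=> u0 cu.
have mng (c : R) : measurable_fun setT (fun v => exponent_re mu (c * g v)).
  by apply: (measurableT_comp mk); exact: measurable_funM.
have E n : (\int[leb]_v exponent_re mu (u n * g v)) / u n ^+ 2 =
    \int[leb]_v (exponent_re mu (u n * g v) / u n ^+ 2).
  rewrite RintegralZr//.
  have mm : measurable_fun setT (fun v => u n * g v) by exact: measurable_funM.
  exact: (@integrable_kernel _ (measurableTypeR R) R leb _ _ kl _ mm (rintegrable_sqrZ _ ig)).
have -> : second_moment mu * \int[leb]_v (g v ^+ 2) / 2 =
    \int[leb]_v (second_moment mu / 2 * g v ^+ 2) by rewrite RintegralZl// mulrAC.
rewrite (eq_cvg _ _ E).
apply: (@cvg_Rintegral_dominated _ (measurableTypeR R) R leb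
  (fun n v => exponent_re mu (u n * g v) / u n ^+ 2) _ (fun v => second_moment mu / 2 * g v ^+ 2)).
- have mm n : measurable_fun setT (fun v => exponent_re mu (u n * g v) / u n ^+ 2).
    by apply: measurable_funM => //; exact: mng.
  exact: mm.
- have mm : measurable_fun setT (fun v => second_moment mu / 2 * g v ^+ 2).
    by apply: measurable_funM => //; exact: measurable_funX.
  exact: mm.
- exact: iZ.
- move=> n v; have un2 : 0 < u n ^+ 2 by rewrite exprn_gt0.
  rewrite normrM ger0_norm ?exponent_re_ge0// ger0_norm ?invr_ge0 ?(ltW un2)//.
  rewrite ler_pdivrMr// (le_trans (exponent_re_le mu2 _))// exprMn; lra.
- apply: aeW => v.
  have -> : second_moment mu / 2 * g v ^+ 2 = second_moment mu * (g v ^+ 2 / 2) by field.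
  exact: cvg_exponent_re.
Qed.

Lemma integral_exponent_re_lt : 0 < second_moment mu -> 0 < \int[leb]_v (g v ^+ 2) ->
  \int[leb]_v exponent_re mu (g v) < (second_moment mu * \int[leb]_v (g v ^+ 2)) / 2.
Proof.
move=> V0 G0; rewrite mulrAC -RintegralZl//.
have ik := @integrable_kernel _ (measurableTypeR R) R leb _ _ kl _ mg ig.
have le v : exponent_re mu (g v) <= second_moment mu / 2 * g v ^+ 2.
  apply: le_trans (exponent_re_le mu2 _) _.
  by rewrite (_ : _ / 2 * _ = second_moment mu * (g v ^+ 2 / 2))//; field.
rewrite lt_neqAle (le_Rintegral measurableT ik (iZ _) (fun v _ => le v)) andbT.
apply/negP => /eqP e.
have ih : rintegrable leb (fun v => second_moment mu / 2 * g v ^+ 2 - exponent_re mu (g v)).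
  exact: (rintegrableB (iZ _) ik).
have h0 v : 0 <= second_moment mu / 2 * g v ^+ 2 - exponent_re mu (g v) by rewrite subr_ge0.
have E0 : \int[leb]_v (second_moment mu / 2 * g v ^+ 2 - exponent_re mu (g v)) = 0.
  by rewrite RintegralB// e subrr.
have ae0 := Rintegral_eq0_ae ih h0 E0.
have : \int[leb]_v (g v ^+ 2) = \int[leb]_v 0.
  have mg2 : measurable_fun setT (fun v => g v ^+ 2) by exact: measurable_funX.
  apply: (@ae_eq_Rintegral _ (measurableTypeR R) R leb _ (cst 0) mg2) => //.
  apply: filterS ae0 => v /eqP; rewrite subr_eq0 => /eqP hv.
  have [->|v0] := eqVneq (g v) 0; first by rewrite expr0n.
  have := exponent_re_lt V0 v0.
  by rewrite -hv (_ : _ / 2 * _ = second_moment mu * (g v ^+ 2 / 2)) ?ltxx//; field.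
rewrite [X in _ = X]/Rintegral integral0 /= => G00.
by move: G0; rewrite G00 ltxx.
Qed.

End strictness.

Section second_moment.
Context d (T : measurableType d) (R : realType) (P : probability T R).
Variables (X : {RV P >-> R}) (b : R) (mu : {measure set R -> \bar R}).
Hypotheses (X_centered : ('E_P[(X : T -> R)] = 0)%E)
  (X_sqr : ('E_P[(fun w => X w ^+ 2)%R] < +oo)%E)
  (X_triplet : levy_triplet P X b 0 mu).

(** If the second moment of mu were 0, both parts of the exponent would
    vanish, the characteristic function of X would be 1, and the second moment
    of X would be 0. *)
Lemma second_moment_gt0 : (0 < 'E_P[(fun w => X w ^+ 2)%R])%E -> 0 < second_moment mu.
Proof.
move=> X0; rewrite lt0r second_moment_ge0 andbT; apply/negP => /eqP V0.
have mu2 := levy_measure_square_integrable X_sqr X_triplet.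
have kr0 theta : exponent_re mu theta = 0.
  by apply/eqP; rewrite eq_le exponent_re_ge0 andbT (le_trans (exponent_re_le mu2 _))// V0 mul0r.
have ki0 theta : exponent_im mu theta = 0.
  have := exponent_im_lip mu2 theta 0.
  by rewrite exponent_im0 V0 mul0r subr0 normr_le0 => /eqP.
have mxX x : measurable_fun setT (fun w => x * X w) by exact: measurable_funM.
have : (\int[P]_w (X w ^+ 2)%:E <= 0%:E)%E.
  apply: (@integral_sqr_le_of_cos _ _ _ _ _ _ 1) => // x _.
  rewrite mulr0 mul0r -[leLHS]fineK; last first.
    exact: integrable_fin_num (integrable_one_sub_cos_law P (mxX x)).
  rewrite -/(Rintegral _ _ _) Rintegral_one_sub_cos//.
  rewrite (chf_exponent X_centered X_sqr X_triplet) Re_cexp /exponent kr0 ki0 /=.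
  by rewrite oppr0 expR0 cos0 mulr1 subrr.
by move: X0; rewrite unlock ltNge => /negP.
Qed.

End second_moment.

(** * Dilative stability of kernel processes *)

Section kernel_process.
Context d (T : measurableType d) (R : realType) (P : probability T R).
Variables (L : R -> {RV P >-> R}) (V : R) (kr ki : R -> R).
Hypotheses (V0 : 0 <= V) (krl : quad_lip V kr) (kil : quad_lip V ki).
Hypothesis kr_ge0 : forall x, 0 <= kr x.
Hypothesis chf_steps : forall s, valid_steps s ->
  chf P (step_integral L s) = cexp (- integrated_exponent kr ki (step_fun s)).
Variables (f : R -> R -> R) (S : R -> {RV P >-> R}).
Hypothesis mf : forall t, measurable_fun setT (f t).
Hypothesis if2 : forall t, rintegrable leb (fun u => f t u ^+ 2).
Hypothesis SL : forall t, stochastic_integral L (f t) (S t).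

Lemma chf_kernel_process k (t : 'rV[R]_k) (theta : 'I_k -> R) :
  chf P (fun w => \sum_j theta j * S (t 0 j) w) =
  cexp (- integrated_exponent kr ki (fun u => \sum_j theta j * f (t 0 j) u)).
Proof.
apply: (@chf_stochastic_integral _ _ _ P L V kr ki V0 krl kil chf_steps).
- by apply: measurable_sum => j; exact: measurable_funM.
- by apply: measurable_sum => j; exact: measurable_funM.
- have mm j : measurable_fun setT (fun u => theta j * f (t 0 j) u) by exact: measurable_funM.
  by apply: rintegrable_sqr_sum => j; [exact: mm|exact: rintegrable_sqrZ].
- by apply: (@stochastic_integral_sum _ _ _ P L _ _ theta (fun j => f (t 0 j))).
Qed.

Lemma infinitely_divisible_kernel_process : infinitely_divisible P S.
Proof.
move=> k t _.
apply: (@infinitely_divisible_of_roots _ _ _ _ _ _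
  (fun theta => integrated_exponent kr ki (fun u => \sum_j theta j * f (t 0 j) u))).
- apply/measurable_fun_tnthP => j.
  rewrite (_ : _ \o _ = S (t 0 j))//; apply/funext => w /=.
  by rewrite tnth_mktuple.
- move=> theta; rewrite -chf_kernel_process; congr chf.
  by apply/funext => w; apply: eq_bigr => j _; rewrite tnth_mktuple.
- move=> n n0; apply: (@exists_root_vector _ _ _ P L V kr ki V0 krl kil kr_ge0 chf_steps k
    (fun j => f (t 0 j)) (fun j => S (t 0 j))) => //.
  by rewrite invr_gt0 ltr0n n0 invf_le1 ?ltr0n// ler1n.
Qed.

Lemma characteristic_exponent_kernel_process k (t : 'rV[R]_k) :
  characteristic_exponent P S t (fdd_exponent kr ki f t).
Proof.
split; first exact: (continuous_fdd_exponent V0 krl kil mf if2).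
- exact: (fdd_exponent0 krl kil f t).
- by move=> theta; have := chf_kernel_process t (theta 0).
Qed.

Variables alpha delta : R.
Hypothesis f_scaling : forall t u a : R, 0 < a ->
  f t u = a `^ (alpha - delta / 2) * f (t / a) (u / a `^ delta).

Lemma dilatively_stable_kernel_process : dilatively_stable P S alpha delta.
Proof.
split; first exact: infinitely_divisible_kernel_process.
exists (fun k => @fdd_exponent _ kr ki f k); split.
  by move=> k t _; exact: characteristic_exponent_kernel_process.
by move=> a k theta t a0 _; exact: (fdd_exponent_scaling krl kil mf if2 f_scaling).
Qed.

End kernel_process.

(** The modulus of the characteristic function is exp (- Re psi), so that any
    two exponents of the same law have the same real part, and the functional
    equation carries over from one to the other. *)
Lemma stable_exponent_re d (T : measurableType d) (R : realType) (P : probability T R)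
    (S : R -> {RV P >-> R}) (psi : forall k, 'rV[R]_k -> 'rV[R]_k -> R[i]) (alpha delta : R) :
  dilatively_stable P S alpha delta ->
  (forall k (t : 'rV[R]_k), (0 < k)%N -> characteristic_exponent P S t (psi k t)) ->
  forall a x, 0 < a ->
    complex.Re (psi 1%N (const_mx a) (const_mx x)) =
    a `^ delta * complex.Re (psi 1%N (const_mx 1) (const_mx (a `^ (alpha - delta / 2) * x))).
Proof.
move=> [_ [psi' [h' sc]]] h a x a0.
have ReE (t theta : 'rV[R]_1) : complex.Re (psi 1%N t theta) = complex.Re (psi' 1%N t theta).
  have [_ _ e] := h _ t (ltn0Sn 0); have [_ _ e'] := h' _ t (ltn0Sn 0).
  have := congr1 sqnorm (etrans (esym (e theta)) (e' theta)).
  rewrite !sqnorm_cexp => /eqP; rewrite eqrXn2 ?expR_ge0// => /eqP /expR_inj.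
  by rewrite !raddfN => /oppr_inj.
rewrite !ReE; have := sc a 1%N (const_mx x) (const_mx 1) a0 (ltn0Sn 0).
rewrite (_ : a *: const_mx 1 = const_mx a); last by apply/matrixP => i j; rewrite !mxE mulr1.
rewrite (_ : _ *: const_mx x = const_mx (a `^ (alpha - delta / 2) * x)); last first.
  by apply/matrixP => i j; rewrite !mxE.
by move=> ->; rewrite complex_ReM /= mul0r subr0.
Qed.
Close Scope complex_scope.

Theorem proposition2p3 (R : realType) (d : measure_display)
    (Omega : measurableType d) (P : probability Omega R)
    (L : R -> {RV P >-> R})
    (L_levy : two_sided_levy_process P L)
    (L_nongaussian : no_gaussian_component P L)
    (L_centered : ('E_P[(L 1%R : Omega -> R)] = 0)%E)
    (L_square_integrable : ('E_P[(fun w => L 1 w ^+ 2)%R] < +oo)%E)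
    (f : R -> R -> R)
    (f_measurable : measurable_fun [set: R * R] (fun p : R * R => f p.1 p.2))
    (f_L2 : forall t, f t \in Lfun lebesgue_measure 2%:E)
    (S : R -> {RV P >-> R})
    (S_integral : forall t, is_levy_integral P L (f t) (S t))
    (alpha delta : R)
    (f_scaling : forall t u T : R, 0 < T ->
       f t u = T `^ (alpha - delta / 2) * f (t / T) (u / T `^ delta)) :
  dilatively_stable P S alpha delta /\
  ((0 < 'E_P[(fun w => L 1 w ^+ 2)%R])%E ->
   (0 < \int[lebesgue_measure]_u ((f 1 u) ^+ 2)%:E)%E ->
   forall alpha' delta' : R, dilatively_stable P S alpha' delta' ->
     alpha' = alpha /\ delta' = delta).
Proof.
have [b [mu trip]] := L_nongaussian.
have mu2 := levy_measure_square_integrable L_square_integrable trip.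
have V0 := second_moment_ge0 mu.
have krl : quad_lip (second_moment mu) (exponent_re mu).
  by split; [exact: exponent_re0|exact: exponent_re_lip].
have kil : quad_lip (second_moment mu) (exponent_im mu).
  by split; [exact: exponent_im0|exact: exponent_im_lip].
have chf_steps := chf_step_integral L_levy krl kil
  (chf_exponent L_centered L_square_integrable trip).
have mf t : measurable_fun setT (f t).
  by have := f_L2 t; rewrite inE => /andP[]; rewrite inE.
have if2 t : rintegrable leb (fun u => f t u ^+ 2) by exact: Lfun2_integrable_sqr (f_L2 t).
have SL t := stochastic_integralP (S_integral t).
have stable : dilatively_stable P S alpha delta.
  exact: (dilatively_stable_kernel_process V0 krl kil (exponent_re_ge0 mu) chf_steps mf if2 SL f_scaling).
split => // L0 f0 alpha' delta' stable'.
have char k (t : 'rV[R]_k) (_ : (0 < k)%N) :=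
  characteristic_exponent_kernel_process V0 krl kil chf_steps mf if2 SL t.
pose r x := \int[leb]_v exponent_re mu (x * f 1 v).
have rE x : complex.Re (fdd_exponent (exponent_re mu) (exponent_im mu) f
    (const_mx 1 : 'rV[R]_1) (const_mx x)) = r x.
  by apply: eq_Rintegral => v _; rewrite big_ord1 !mxE.
have V1 := second_moment_gt0 L_centered L_square_integrable trip L0.
have F1 : 0 < \int[leb]_v (f 1 v ^+ 2).
  by rewrite -lte_fin /Rintegral fineK//; exact: integrable_fin_num (if2 1).
apply: (@parameters_unique _ r (second_moment mu * \int[leb]_v (f 1 v ^+ 2))).
- exact: mulr_gt0.
- by move=> u u0 cu; exact: (cvg_integral_exponent_re mu2 (mf 1) (if2 1) u0 cu).
- have := integral_exponent_re_lt mu2 (mf 1) (if2 1) V1 F1.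
  by congr (_ < _); apply: eq_Rintegral => v _; rewrite mul1r.
- move=> a x a0; rewrite -!rE.
  by rewrite -(stable_exponent_re stable char x a0) -(stable_exponent_re stable' char x a0).
Qed.
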